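(* Fix a constant $M>0$. Let $$\mathcal{F}_s(M)=\Big\{\Omega=\Omega^T\in\mathbb{R}^{p\times p}: M^{-1}\le\lambda_{\min}(\Omega)\le\lambda_{\max}(\Omega)\le M,\ \max_{1\le i\le p}\sum_{j=1}^p\mathbb{I}\{\Omega_{ij}\ne0\}\le s\Big\}.$$ For $\Omega\in\mathcal{F}_s(M)$, $\epsilon\in[0,1)$ and an arbitrary distribution $Q$ on $\mathbb{R}^p$, let $X_1,\dots,X_n$ ($n$ even) be i.i.d. from $\mathbb{P}_{(\epsilon,\Omega,Q)}=(1-\epsilon)N(0,\Omega^{-1})+\epsilon Q$; write $X_{ji}$ for the $j$th coordinate of $X_i$ and $X_{-j,i}\in\mathbb{R}^{p-1}$ for $X_i$ with coordinate $j$ removed. Let $\Theta_s=\{\beta\in\mathbb{R}^{p-1}\setminus\{0\}:\sum_{l}\mathbb{I}\{\beta_l\ne0\}\le s\}$, and for $\mathcal{U}\subset\mathbb{R}^{p-1}\setminus\{0\}$ define the empirical regression depth $$\mathcal{D}_{\mathcal{U}}\big(\beta,\{(Z_i,w_i)\}_{i=1}^{N}\big)=\inf_{u\in\mathcal{U}}\frac1N\sum_{i=1}^N\mathbb{I}\{u^TZ_i(w_i-Z_i^T\beta)\ge0\}.$$ For each $j\in[p]$, let $\hat\beta_{(j)}$ be any maximizer over $\beta\in\Theta_s$ of $\mathcal{D}_{\Theta_{2s}}(\beta,\{(X_{-j,i},X_{ji})\}_{i=1}^{n/2})$; set $w_{ji}=(X_{ji}-\hat\beta_{(j)}^TX_{-j,i})^2$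 for $i=n/2+1,\dots,n$, and $$\widehat\Omega_{jj}=\Big(\frac{\mathrm{Median}(\{w_{ji}\}_{i=n/2+1}^n)}{[\Phi^{-1}(3/4)]^2}\Big)^{-1},\qquad \widehat\Omega_{-j,j}=-\widehat\Omega_{jj}\hat\beta_{(j)},$$ where $\Phi$ is the standard normal CDF and $\widehat\Omega_{-j,j}$ denotes the $j$th column of $\widehat\Omega$ without its $j$th entry. Then there exist constants $c_0,C,C'>0$ (depending only on $M$) such that whenever $\epsilon^2+\frac{s\log(ep/s)}{n}\le c_0$, $$\|\widehat\Omega-\Omega\|_{\ell_1}^2\le C\Big(\frac{s^2\log(ep/s)}{n}\vee s\epsilon^2\Big)$$ with $\mathbb{P}_{(\epsilon,\Omega,Q)}$-probability at least $1-\exp\big(-C'(s\log(ep/s)+n\epsilon^2)\big)$, uniformly over all $Q$ and $\Omega\in\mathcal{F}_s(M)$.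
   Context: $\|A\|_{\ell_1}=\max_{j}\sum_i|A_{ij}|$ is the matrix $\ell_1$ norm (maximum absolute column sum). $\lambda_{\min},\lambda_{\max}$ are smallest and largest eigenvalues. $a\vee b=\max(a,b)$. *)

(* Defs.v *)
From HB Require Import structures.
From mathcomp Require Import all_boot all_order all_algebra.
From mathcomp Require Import all_classical all_reals all_analysis.
Set Implicit Arguments. Unset Strict Implicit. Unset Printing Implicit Defensive.
Import Order.TTheory GRing.Theory Num.Theory.
Import numFieldNormedType.Exports.
Local Open Scope classical_set_scope.
Local Open Scope ring_scope.

Section defs.
Variable R : realType.

Definition Phi (x : R) : R := fine (normal_prob 0 1 `]-oo, x]).

Definition dotv (m : nat) (u v : 'rV[R]_m) : R := \sum_(l < m) u 0 l * v 0 l.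

Definition dott (p : nat) (u : 'rV[R]_p) (x : p.-tuple R) : R :=
  \sum_(k < p) u 0 k * tnth x k.

Definition l1norm (p : nat) (A : 'M[R]_p) : R :=
  \big[Num.max/0]_(j < p) \sum_(i < p) `|A i j|.

Definition in_Fs (M : R) (s p : nat) (Om : 'M[R]_p) : Prop :=
  [/\ Om^T = Om,
      (forall a, eigenvalue Om a -> M^-1 <= a <= M) &
      (forall i : 'I_p, (#|[pred j : 'I_p | Om i j != 0%R]| <= s)%N)].

(* N(0, Sigma) on R^p: the probability all of whose one-dimensional
   projections u^T x (u <> 0) are N(0, u^T Sigma u)  (Cramer-Wold) *)
Definition gaussian (p : nat) (Sigma : 'M[R]_p)
    (nu : probability (p.-tuple R) R) : Prop :=
  forall u : 'rV[R]_p, u != 0 ->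
    forall A : set R, measurable A ->
      nu [set x | A (dott u x)] =
      normal_prob 0 (Num.sqrt ((u *m Sigma *m u^T) 0 0)) A.

Definition independent d (T : measurableType d) (P : probability T R)
    d' (T' : measurableType d') (n : nat) (X : 'I_n -> T -> T') : Prop :=
  forall A : 'I_n -> set T', (forall i, measurable (A i)) ->
    P (\bigcap_(i in [set: 'I_n]) (X i @^-1` A i)) =
    (\prod_(i < n) P (X i @^-1` A i))%E.

Definition Theta (m s : nat) : set 'rV[R]_m :=
  fun b => b != 0 /\ (#|[pred l : 'I_m | b ord0 l != 0%R]| <= s)%N.

Definition depth (m N : nat) (U : set 'rV[R]_m) (b : 'rV[R]_m)
    (Z : 'I_N -> 'rV[R]_m) (w : 'I_N -> R) : R :=
  inf [set (N%:R)^-1 *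
           (#|[pred i : 'I_N | 0 <= dotv u (Z i) * (w i - dotv b (Z i))]|)%:R
       | u in U].

Definition is_median (N : nat) (w : 'I_N -> R) (md : R) : Prop :=
  (N%:R / 2 : R) <= (#|[pred i : 'I_N | w i <= md]|)%:R /\
  (N%:R / 2 : R) <= (#|[pred i : 'I_N | md <= w i]|)%:R.

(* Oh is a possible output of the estimator from the sample x_1..x_{2m}
   (any choice of the maximizers beta_(j) and of the medians), q = Phi^{-1}(3/4) *)
Definition estimator (p m s : nat) (q : R) (x : 'I_(m + m) -> p.-tuple R)
    (Oh : 'M[R]_p) : Prop :=
  exists (bh : 'I_p -> 'rV[R]_p.-1) (md : 'I_p -> R),
  forall j : 'I_p,
    let Z := fun i : 'I_(m + m) => \row_(l < p.-1) tnth (x i) (lift j l) in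
    let Z1 := fun k : 'I_m => Z (lshift m k) in
    let w1 := fun k : 'I_m => tnth (x (lshift m k)) j in
    [/\ Theta s (bh j),
        (forall b, Theta s b ->
           depth (Theta (s.*2)) b Z1 w1 <= depth (Theta (s.*2)) (bh j) Z1 w1),
        is_median (fun k : 'I_m =>
           (tnth (x (rshift m k)) j - dotv (bh j) (Z (rshift m k))) ^+ 2) (md j),
        Oh j j = (md j / q ^+ 2)^-1 &
        forall l : 'I_p.-1, Oh (lift j l) j = - (Oh j j * bh j 0 l)].

End defs.

(* Main.v *)
(* Only one-sided deviations P_n(A) <= P(A) + O(r), r^2 = eps^2 + s log(ep/s) / n, are needed, uniformly
   over the regions {f1, f2 >= 0} u {f3, f4 >= 0} cut out by four affine forms with a common support of
   size 4s.  They follow from symmetrization, chaining and the Sauer-Shelah bound for the traces of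
   half-spaces, first for rational forms (countably many, so that the good event is measurable) and then
   for real ones by continuity from above.  Contamination only adds eps to P(A).

   Column j of Omega gives the residual xi = X_j - beta . X_{-j}, which is uncorrelated with X_{-j}.
   At the true beta every direction u has {u . X_{-j} xi >= 0} of probability 1/2, so the depth of the
   maximizer is at least 1/2 - O(r).  Tested in the direction u = beta_hat - beta it is at most
   P(u . X_{-j} (xi - u . X_{-j}) >= 0) + O(r), and this probability falls below 1/2 proportionally
   to sd(u . X_{-j}) / sd(xi); hence sd(u . X_{-j}) = O(r).  Since the residual of beta_hat is Gaussian
   with variance 1 / Omega_jj + O(r^2), its empirical median gives Omega_jj up to O(r), and sparsity
   turns these l2 bounds into the l1 bound for the column.

   Probabilities of sign patterns of two Gaussian projections depend only on their Gram matrix: this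
   holds for the means of trigonometric polynomials by the definition of [gaussian], and the sign
   function is a bounded limit of such polynomials. *)
Require Import Defs.
From HB Require Import structures.
From mathcomp Require Import all_boot all_order all_algebra.
From mathcomp Require Import boolp reals sequences exp.
From mathcomp Require Import ring lra zify.
Set Implicit Arguments. Unset Strict Implicit. Unset Printing Implicit Defensive.
Import Order.TTheory GRing.Theory Num.Theory.
Local Open Scope ring_scope.

(** * Traces of half-spaces *)

(** Counting traces at one scale only would cost a factor log n per degree of freedom. Chaining
    removes it: the packing numbers at scale n / 4^l have a logarithm at most linear in l, which
    geometric weights make summable. The probabilistic part lives on a finite space, because
    finitely many regions distinguish only finitely many membership patterns of a point;
    expectations are then finite sums, and independence is needed on cylinders only. Four affine
    forms are enough for the three kinds of events that occur: a product of two forms is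
    nonnegative, a form is at most a in absolute value, or at least a. The size 4s leaves room for a
    test direction (2s) together with the support of a residual. The Gaussian hypothesis concerns
    one-dimensional projections only, so no planar density is at hand. The loss of probability in a
    thin wedge is instead bounded below by counting: equally likely wedges of angle pi/N together
    force a sign change. A lower bound linear in the angle is all that the estimation error
    requires. *)

Section Shattering.
Variable T : finType.
Implicit Types (F : {set {set T}}) (S A : {set T}).

Definition shattered F S := [forall A : {set T}, (A \subset S) ==> [exists B in F, B :&: S == A]].

Lemma shatteredP F S :
  reflect (forall A, A \subset S -> exists2 B, B \in F & B :&: S = A) (shattered F S).
Proof.
apply: (iffP forallP) => [H A AS|H A].
  by move: (H A); rewrite AS => /exists_inP[B BF /eqP]; exists B.
by apply/implyP => /H[B BF BSA]; apply/exists_inP; exists B => //; apply/eqP.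
Qed.

Lemma shatteredS F (G : {set {set T}}) S : F \subset G -> shattered F S -> shattered G S.
Proof.
move=> FG /shatteredP H; apply/shatteredP => A /H[B BF]; exists B => //.
exact: (subsetP FG).
Qed.

(** Pajor's form of the Sauer-Shelah lemma. Split [F] along a point x on which two members disagree.
    A set shattered by one half cannot contain x; a set S shattered by both halves yields a second
    set [x |: S] shattered by [F], so the two inductive counts add up. *)
Lemma card_le_shattered F : (#|F| <= #|[set S | shattered F S]|)%N.
Proof.
elim: {F}_.+1 {-2}F (ltnSn #|F|) => // n IH F; rewrite ltnS => Fn.
have [F1|] := leqP #|F| 1.
  have [->|/set0Pn[B BF]] := eqVneq F set0; first by rewrite cards0.
  apply: leq_trans F1 _; rewrite card_gt0; apply/set0Pn; exists set0.
  rewrite inE; apply/shatteredP => A; rewrite subset0 => /eqP->.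
  by exists B => //; rewrite setI0.
move=> /card_gt1P[A [B [AF BF AB]]].
have [x xAB] : exists x, (x \in A) != (x \in B).
  by apply/existsP; apply: contraNT AB; rewrite negb_exists => /forallP H;
     apply/eqP/setP => x; apply/eqP; move: (H x); rewrite negbK.
pose Fx := [set C in F | x \in C]; pose Fn' := [set C in F | x \notin C].
have FE : #|F| = (#|Fx| + #|Fn'|)%N.
  rewrite -(cardsID [set C : {set T} | x \in C] F); congr addn; apply: eq_card => C;
  by rewrite !inE // andbC.
have [Fx0 Fn0] : (0 < #|Fx|)%N /\ (0 < #|Fn'|)%N.
  move: xAB; case xA : (x \in A); case xB : (x \in B) => // _; split; rewrite card_gt0; apply/set0Pn.
  - by exists A; rewrite !inE AF.
  - by exists B; rewrite !inE BF xB.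
  - by exists B; rewrite !inE BF.
  - by exists A; rewrite !inE AF xA.
have FxF : Fx \subset F by apply/subsetP => C; rewrite inE => /andP[].
have FnF : Fn' \subset F by apply/subsetP => C; rewrite inE => /andP[].
have /IH hx : (#|Fx| < n)%N by apply: leq_trans Fn; rewrite FE -[X in (X < _)%N]addn0 ltn_add2l.
have /IH hn : (#|Fn'| < n)%N by apply: leq_trans Fn; rewrite FE -[X in (X < _)%N]add0n ltn_add2r.
set Sx := [set S | shattered Fx S] in hx; set Sn := [set S | shattered Fn' S] in hn.
have xSx S : S \in Sx -> x \notin S.
  rewrite inE => /shatteredP /(_ set0 (sub0set _))[C]; rewrite inE => /andP[_ xC] CS.
  by apply/negP => xS; have := in_set0 x; rewrite -CS inE xC xS.
have xSn S : S \in Sn -> x \notin S.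
  rewrite inE => /shatteredP /(_ S (subxx _))[C]; rewrite inE => /andP[_ xC] CS.
  by apply: contra xC => xS; move: xS; rewrite -{1}CS inE => /andP[].
(* The sum of the two counts is rewritten as union plus intersection; the intersection is then moved
   by S -> [x |: S] to sets containing x, which are disjoint from the union. *)
rewrite FE (leq_trans (leq_add hx hn)) // -cardsUI.
have inj : {in Sx :&: Sn &, injective (fun S => x |: S)}.
  move=> S S'; rewrite !inE => /andP[] _ sS /andP[] _ sS' E.
  have xS : x \notin S by apply: xSn; rewrite inE.
  have xS' : x \notin S' by apply: xSn; rewrite inE.
  by rewrite -(setU1K xS) E setU1K.
rewrite -(card_in_imset inj) -cardsUI.
have -> : (Sx :|: Sn) :&: [set x |: S | S in Sx :&: Sn] = set0.
  apply/setP => S; rewrite [RHS]in_set0; apply/negP; rewrite in_setI => /andP[SU /imsetP[S' _ E]].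
  have : x \notin S by move: SU; rewrite in_setU => /orP[/xSx|/xSn].
  by rewrite E setU11.
rewrite cards0 addn0; apply: subset_leq_card; apply/subsetP => S.
rewrite in_setU => /orP[|].
  by rewrite in_setU !inE => /orP[]; apply: shatteredS.
case/imsetP => S'; rewrite in_setI => /andP[S'x S'n] ->.
rewrite inE; apply/shatteredP => C CS.
have xS' := xSx _ S'x.
have CS' : C :\ x \subset S'.
  apply/subsetP => z; rewrite !inE => /andP[zx zC].
  by have := subsetP CS z zC; rewrite !inE (negPf zx).
have [xC|xC] := boolP (x \in C).
  move: S'x; rewrite inE => /shatteredP /(_ _ CS')[D]; rewrite inE => /andP[DF xD] DE.
  exists D => //; rewrite setIUr DE -[RHS](setD1K xC); congr (_ :|: _).
  by apply/setIidPr; rewrite sub1set.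
move: S'n; rewrite inE => /shatteredP /(_ _ CS')[D]; rewrite inE => /andP[DF xD] DE.
exists D => //; rewrite setIUr DE.
have -> : D :&: [set x] = set0 by apply/setP => z; rewrite !inE; case: eqP => [->|]; rewrite ?(negPf xD) ?andbF.
rewrite set0U; apply/setP => z; rewrite !inE; case: eqP => [->|] //=; by rewrite (negPf xC).
Qed.

End Shattering.

Lemma sum_expr_card (R : comNzRingType) (T : finType) (y : R) :
  \sum_(S : {set T}) y ^+ #|S| = (1 + y) ^+ #|T|.
Proof.
rewrite -[in RHS](prodr_const) addrC.
have := @bigA_distr R 0 1 *%R +%R T (fun=> y) (fun=> 1) => ->.
apply: eq_bigr => S _.
by rewrite -big_mkcond /= prodr_const.
Qed.

(** Each set of size at most V has weight y^#|S| >= y^V in the binomial expansion of (1 + y)^#|T|.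
    The parameter y stays free: it is tuned to the scale in [card_packing] and to the sparsity in
    [ln_card_small_sets]. *)
Lemma card_small_sets (R : realFieldType) (T : finType) (V : nat) (y : R) :
  0 < y <= 1 ->
  #|[set S : {set T} | (#|S| <= V)%N]|%:R * y ^+ V <= (1 + y) ^+ #|T|.
Proof.
move=> /andP[y0 y1].
rewrite -sum_expr_card (bigID (fun S : {set T} => (#|S| <= V)%N)) /=.
rewrite -[leLHS]addr0 lerD //; last by apply: sumr_ge0 => S _; rewrite exprn_ge0 // ltW.
have -> : #|[set S : {set T} | (#|S| <= V)%N]|%:R * y ^+ V = \sum_(S : {set T} | (#|S| <= V)%N) y ^+ V.
  by rewrite sumr_const cardsE mulr_natl.
apply: ler_sum => S SV; apply: ler_wiXn2l => //; exact: ltW.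
Qed.

(* If #|S| exceeds the dimension, a linear dependency between the [x i], i in S,
   prevents picking exactly the indices whose coefficient is nonnegative. *)
Lemma halfspace_shattered (R : realFieldType) (r V : nat) (x : 'I_r -> 'rV[R]_V)
    (F : {set {set 'I_r}}) (S : {set 'I_r}) :
  (forall A, A \in F -> exists w : 'cV[R]_V, A = [set i | 0 <= (x i *m w) 0 0]) ->
  shattered F S -> (#|S| <= V)%N.
Proof.
move=> HF /shatteredP sh; rewrite leqNgt; apply/negP => VS.
pose X := \matrix_(i < #|S|) x (enum_val i).
have : kermx X != 0.
  by rewrite -mxrank_eq0 mxrank_ker subn_eq0 -ltnNge; exact: leq_ltn_trans (rank_leq_col X) VS.
case/rowV0Pn => c /sub_kermxP cX c0.
(* Up to a change of sign the dependency has a negative coefficient, which will give one strictly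
   positive term in a sum that must vanish. *)
have [d [d0 dX]] : exists d : 'rV_#|S|, (exists i, d 0 i < 0) /\ d *m X = 0.
  have [i ci] : exists i, c 0 i != 0.
    apply/existsP; apply: contraNT c0; rewrite negb_exists => /forallP H.
    by apply/eqP/rowP => i; rewrite mxE; move: (H i); rewrite negbK => /eqP.
  have [cn|cp|ce] := ltrgt0P (c 0 i).
  - exists (- c); split; last by rewrite mulNmx cX oppr0.
    by exists i; rewrite mxE oppr_lt0.
  - by exists c; split => //; exists i.
  - by rewrite ce eqxx in ci.
pose A := [set enum_val i | i : 'I_#|S| & 0 <= d 0 i].
have AS : A \subset S by apply/subsetP => _ /imsetP[i _ ->]; exact: enum_valP.
have [B /HF[w BE] BS] := sh A AS.
have wA (i : 'I_#|S|) : (0 <= (x (enum_val i) *m w) 0 0) = (0 <= d 0 i).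
  have : (enum_val i \in B :&: S) = (enum_val i \in A) by rewrite BS.
  rewrite inE enum_valP andbT BE inE => ->.
  apply/idP/idP => [/imsetP[k]|di]; last by apply: imset_f; rewrite inE.
  by rewrite inE => dk /enum_val_inj ->.
(* The half-space [w] selects exactly the indices with [d] nonnegative, so [d] and [X *m w] agree in
   sign in every coordinate. *)
suff : (d *m X *m w) 0 0 != 0 by rewrite dX mul0mx mxE eqxx.
rewrite -mulmxA mxE gt_eqF //.
have E i : (X *m w) i 0 = (x (enum_val i) *m w) 0 0.
  by rewrite !mxE; apply: eq_bigr => k _; rewrite !mxE.
have [i0 di0] := d0.
rewrite (bigD1 i0) //= ltr_pwDl //.
  by rewrite nmulr_rgt0 // E ltNge wA -ltNge.
apply: sumr_ge0 => i _; rewrite E.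
have [di|di] := leP 0 (d 0 i); first by rewrite mulr_ge0 // wA.
by rewrite nmulr_rge0 // ltW // ltNge wA -ltNge.
Qed.

Lemma card_halfspace_traces (R : realFieldType) (r V : nat) (x : 'I_r -> 'rV[R]_V)
    (F : {set {set 'I_r}}) (y : R) :
  (forall A, A \in F -> exists w : 'cV[R]_V, A = [set i | 0 <= (x i *m w) 0 0]) ->
  0 < y <= 1 -> #|F|%:R * y ^+ V <= (1 + y) ^+ r.
Proof.
move=> HF /[dup] y01 /andP[y0 y1].
have := card_small_sets 'I_r V y01; rewrite card_ord; apply: le_trans.
apply: ler_wpM2r; first by rewrite exprn_ge0 // ltW.
rewrite ler_nat.
apply: leq_trans (card_le_shattered F) (subset_leq_card _).
by apply/subsetP => S; rewrite !inE; exact: (halfspace_shattered HF).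
Qed.

(** * Chaining and symmetrization over a finite space *)

(** The weights may sum to less than 1; the missing mass is placed at the point 0, where the
    exponential is 1. The proof compares with the tangent line at the mean. *)
Lemma expR_jensen (R : realType) (I : Type) (s : seq I) (P : pred I) (w x : I -> R) :
  (forall i, 0 <= w i) -> \sum_(i <- s | P i) w i <= 1 ->
  expR (\sum_(i <- s | P i) w i * x i) <= \sum_(i <- s | P i) w i * expR (x i) + (1 - \sum_(i <- s | P i) w i).
Proof.
move=> w0 w1; set m := \sum_(i <- s | P i) w i * x i.
have tangent z : expR m * (1 + (z - m)) <= expR z.
  by rewrite -[in leRHS](subrKC m z) expRD ler_wpM2l ?expR_ge0 ?expR_ge1Dx.
apply: (@le_trans _ _ (\sum_(i <- s | P i) w i * (expR m * (1 + (x i - m)))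
   + (1 - \sum_(i <- s | P i) w i) * (expR m * (1 + (0 - m))))).
  rewrite le_eqVlt; apply/orP; left; apply/eqP.
  rewrite (eq_bigr (fun i => expR m * (1 - m) * w i + expR m * (w i * x i))); last by move=> i _; ring.
  by rewrite big_split /= -!mulr_sumr -/m; ring.
apply: lerD; first by apply: ler_sum => i _; rewrite ler_wpM2l.
by have := tangent 0; rewrite expR0 => h; rewrite -[leRHS]mulr1 ler_wpM2l // subr_ge0.
Qed.

(** The exponent 2 x^2 is cruder than the optimal x^2 / 2 but elementary: geometric bounds handle x
    <= 1/2, and beyond that x <= 2 x^2. *)
Lemma expR_cosh_le (R : realType) (x : R) : expR x + expR (- x) <= 2 * expR (2 * x ^+ 2).
Proof.
wlog x0 : x / 0 <= x.
  move=> H; have [/H//|/ltW x0] := leP 0 x.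
  by have := H (- x); rewrite opprK sqrrN addrC oppr_ge0; apply.
have [xh|xh] := leP x (1 / 2).
  have h1 : expR x <= (1 - x)^-1.
    rewrite -[expR x]invrK lef_pV2 ?posrE ?invr_gt0 ?expR_gt0 //; last by lra.
    by rewrite -expRN; apply: le_trans (expR_ge1Dx _).
  have h2 : expR (- x) <= (1 + x)^-1.
    by rewrite expRN lef_pV2 ?posrE ?expR_gt0 ?expR_ge1Dx //; lra.
  apply: le_trans (lerD h1 h2) _.
  have h3 : 1 + 2 * x ^+ 2 <= expR (2 * x ^+ 2) by exact: expR_ge1Dx.
  apply: (@le_trans _ _ (2 * (1 + 2 * x ^+ 2))); last by rewrite ler_wpM2l.
  have -> : (1 - x)^-1 + (1 + x)^-1 = 2 / (1 - x ^+ 2) by field; rewrite !gt_eqF //; nra.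
  rewrite ler_pdivrMr; last by nra.
  have : 0 <= x ^+ 2 * (1 - 2 * x ^+ 2) by apply: mulr_ge0; nra.
  nra.
have hx : expR x <= expR (2 * x ^+ 2) by rewrite ler_expR; nra.
have hn : expR (- x) <= expR x by rewrite ler_expR; lra.
lra.
Qed.

(** * Packing numbers from counts of traces *)

Section Packing.
Variables (R : realType) (n : nat) (D : R) (U : nat).
Implicit Types (F P : {set {set 'I_n}}) (A B : {set 'I_n}).

Definition symdiff A B := (A :\: B) :|: (B :\: A).

(** Sauer-Shelah growth with its free parameter y: [U] acts as the dimension and [D] as the number
    of choices of a support. The factor 4 in the exponent reflects that a region is built from four
    half-spaces. The sample [g] may repeat indices, as random draws do. *)
Definition trace_growth F := forall (r : nat) (g : 'I_r -> 'I_n) (y : R), 0 < y <= 1 ->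
  #|[set g @^-1: (A : {set 'I_n}) | A in F]|%:R * y ^+ U <= D * expR (4 * y * r%:R).

(** The slope of the bound on the log-packing numbers; its constants come from solving the
    self-referential inequality for ln #|P| that ends [card_packing]. *)
Definition entropy : R := 2 * ln D + 4 * U%:R + 1.

(* A uniformly random sample of about 2 (ln #|P|) 4^l indices separates all the members of [P],
   so that #|P| is itself bounded by the number of traces on this sample. *)
Lemma card_packing F P (l : nat) : 1 <= D -> trace_growth F -> P \subset F ->
  (forall A B, A \in P -> B \in P -> A != B -> (n < 4 ^ l * #|symdiff A B|)%N) ->
  #|P|%:R <= expR (entropy * l.+2%:R).
Proof.
move=> D1 grF PF sep.
have lnD : 0 <= ln D by rewrite ln_ge0.
have U0 : 0 <= U%:R :> R by [].
have W0 : 0 <= entropy by rewrite /entropy; lra.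
have [P1|P2] := leqP #|P| 1.
  apply: (@le_trans _ _ 1); first by rewrite (ler_nat _ _ 1).
  by rewrite -[leLHS]expR0 ler_expR mulr_ge0.
have [n0|n0] := posnP n.
  move/card_gt1P: P2 => [A [B [_ _ /eqP[]]]]; by apply/setP => i; suff : (0 < 0)%N by []; rewrite -{2}n0; exact: leq_ltn_trans (leq0n i) (ltn_ord i).
set N := #|P| in P2 *; have N0 : (0 < N)%N by apply: leq_trans P2.
pose L : R := ln N%:R.
have L0 : 0 <= L by rewrite ln_ge0 // ler1n.
have NL : N%:R = expR L by rewrite lnK // posrE ltr0n.
pose q : R := 4 ^- l.
have q0 : 0 < q by rewrite invr_gt0 exprn_gt0.
have q1 : q <= 1 by rewrite invf_le1 ?exprn_gt0 // exprn_ege1 //; lra.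
(* With q r > 2 L, the union bound over at most N^2 pairs gives N^2 exp(- q r) < 1. *)
pose r := (Num.truncn (2 * L / q)).+1.
have rlb : 2 * L / q < r%:R by rewrite /r truncnS_gt.
have rub : r%:R <= 2 * L / q + 1.
  rewrite /r -natr1 lerD2r truncn_le //.
  by rewrite divr_ge0 ?ltW // mulr_gt0 //; rewrite ln_gt0 // ltr1n.
have [g gsep] : exists g : {ffun 'I_r -> 'I_n}, forall A B, A \in P -> B \in P -> A != B ->
    exists i, g i \in symdiff A B.
  (* Union bound in counting form: if every sample missed the symmetric difference of some pair, the
     samples missed by the pairs would number at least n^r. *)
  pose bad (C : {set 'I_n}) := [set g : {ffun 'I_r -> 'I_n} | [forall i, g i \in ~: C]].
  apply: contrapT => nog.
  suff : (\sum_(A in P) \sum_(B in P | A != B) #|bad (symdiff A B)| < #|{: {ffun 'I_r -> 'I_n}}|)%N.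
    apply/negP; rewrite -leqNgt -sum1_card.
    rewrite (eq_bigr (fun A => \sum_g \sum_(B in P | A != B) (g \in bad (symdiff A B) : nat))%N); last first.
      move=> A _; rewrite exchange_big /=; apply: eq_bigr => B _.
      by rewrite -sum1_card big_mkcond /=; apply: eq_bigr => g _; case: (g \in _).
    rewrite exchange_big /=; apply: leq_sum => g _.
    have [A [B [AP BP AB H]]] : exists A B, [/\ A \in P, B \in P, A != B & forall i, g i \notin symdiff A B].
      apply: contrapT => H; apply: nog; exists g => A B AP BP AB.
      by apply/existsP; apply: contra_notT H; rewrite negb_exists => /forallP H; exists A, B.
    rewrite (bigD1 A) //= (bigD1 B) /=; last by rewrite BP.
    suff -> : g \in bad (symdiff A B) by [].
    by rewrite inE; apply/forallP => i; rewrite in_setC.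
  rewrite card_ffun !card_ord.
  (* A draw misses [C] with probability at most 1 - q <= exp(- q), independently r times. *)
  have badle (C : {set 'I_n}) : (n < 4 ^ l * #|C|)%N -> #|bad C|%:R <= n%:R ^+ r * expR (- (q * r%:R)) :> R.
    move=> nC.
    have -> : #|bad C| = ((n - #|C|) ^ r)%N.
      have -> : (n - #|C| = #|~: C|)%N by rewrite [RHS]cardsCs finset.setCK card_ord.
      rewrite -[r in RHS]card_ord -(card_ffun_on 'I_r (mem (~: C))).
      by apply: eq_card => h; rewrite !inE; apply/forallP/ffun_onP => H i; have := H i; rewrite !inE.
    have Cn : (#|C| <= n)%N by rewrite -[X in (_ <= X)%N]card_ord max_card.
    rewrite natrX natrB // -[- (q * r%:R)]mulNr expRM_natr -exprMn.
    apply: lerXn2r; rewrite ?nnegrE ?subr_ge0 ?ler_nat ?mulr_ge0 ?expR_ge0 //.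
    have e1 : 1 - q <= expR (- q) by exact: expR_ge1Dx.
    have : n%:R * q <= #|C|%:R.
      rewrite ler_pdivrMr ?exprn_gt0 // -natrX -natrM ler_nat mulnC; exact: ltnW.
    have : 0 <= n%:R * (expR (- q) - (1 - q)) by rewrite mulr_ge0 ?subr_ge0.
    lra.
  rewrite -(ltr_nat R) natrX.
  have step : (\sum_(A in P) \sum_(B in P | A != B) #|bad (symdiff A B)|)%:R
      <= N%:R * (N%:R * (n%:R ^+ r * expR (- (q * r%:R)))) :> R.
    rewrite natr_sum [in leRHS]mulr_natl -[X in _ *+ X]/(#|P|) -sumr_const.
    apply: ler_sum => A AP; rewrite natr_sum mulr_natl -sumr_const big_mkcondr /=.
    apply: ler_sum => B BP; case: ifP => AB; first by apply: badle; exact: sep.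
    by rewrite mulr_ge0 ?expR_ge0 ?exprn_ge0.
  apply: le_lt_trans step _; rewrite NL !mulrA -expRD mulrAC -expRD.
  rewrite -[ltRHS]mul1r ltr_pM2r ?exprn_gt0 ?ltr0n // -[ltRHS]expR0 ltr_expR.
  by move: rlb; rewrite ltr_pdivrMr // => h; lra.
have NF : (N <= #|[set finfun g @^-1: (A : {set 'I_n}) | A in F]|)%N.
  have inj : {in P &, injective (fun A : {set 'I_n} => g @^-1: A)}.
    move=> A B AP BP /setP E; apply/eqP; apply: contraT => AB.
    have [i] := gsep A B AP BP AB.
    by have := E i; rewrite !inE => ->; case: (_ \in _).
  rewrite /N -(card_in_imset inj); apply: subset_leq_card.
  apply/subsetP => _ /imsetP[A AP ->]; apply/imsetP; exists A; first exact: (subsetP PF).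
  by apply/setP => i; rewrite !inE ffunE.
(* y = q / 16 makes 4 y r at most L / 2 + 1 / 4, so that L on the right carries the factor 1/2 and
   is absorbed on the left. *)
pose y : R := 4 ^- l.+2.
have y0 : 0 < y by rewrite invr_gt0 exprn_gt0.
have y1 : y <= 1 by rewrite invf_le1 ?exprn_gt0 // exprn_ege1 //; lra.
have := grF r (finfun g) y; rewrite y0 y1 => /(_ isT) gr.
have {}gr : N%:R * y ^+ U <= D * expR (4 * y * r%:R).
  by apply: le_trans gr; apply: ler_wpM2r; [rewrite exprn_ge0 // ltW | rewrite ler_nat].
have yE : y = q / 16 by rewrite /y /q !exprS !invfM; field; apply: lt0r_neq0; apply: exprn_gt0; lra.
have ex4 : 4 * y * r%:R <= L / 2 + 1 / 4.
  rewrite yE; have : q * r%:R <= q * (2 * L / q + 1) by rewrite ler_wpM2l // ltW.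
  have -> : q * (2 * L / q + 1) = 2 * L + q by field; rewrite gt_eqF.
  by lra.
(* This uses 4 <= e^2. *)
have ylb : expR (- (2 * (l.+2 * U)%:R)) <= y ^+ U.
  rewrite natrM mulrA -mulNr expRM_natr; apply: lerXn2r; rewrite ?nnegrE ?expR_ge0 ?(ltW y0) //.
  rewrite /y expRN lef_pV2 ?posrE ?expR_gt0 ?exprn_gt0 // expRM_natr; apply: lerXn2r; rewrite ?nnegrE ?expR_ge0 //.
  have -> : 2 = 1 + 1 :> R by lra.
  rewrite expRD; have := expR_ge1Dx (1 : R); nra.
have : expR (L - 2 * (l.+2 * U)%:R) <= expR (ln D + (L / 2 + 1 / 4)).
  rewrite (expRD L) (expRD (ln D)) -NL lnK ?posrE; last by lra.
  apply: (le_trans (y := N%:R * y ^+ U)); first by rewrite ler_wpM2l.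
  apply: le_trans gr _; rewrite ler_wpM2l ?ler_expR //; lra.
rewrite ler_expR => h; rewrite NL ler_expR.
have : L <= 2 * ln D + 4 * (l.+2 * U)%:R + 1 / 2 by lra.
move/le_trans; apply; rewrite /entropy natrM -(natr1 l.+1) -(natr1 l).
have l0 : 0 <= l%:R :> R by [].
have lD : 0 <= l%:R * ln D by rewrite mulr_ge0.
have lU : 0 <= l%:R * U%:R :> R by rewrite mulr_ge0.
lra.
Qed.
End Packing.

(** * Chaining for Rademacher sums *)

Section Chaining.
Variables (R : realType) (n : nat).
Implicit Types (A B : {set 'I_n}) (s : {ffun 'I_n -> bool}).

Definition signed_sum s (c : 'I_n -> R) : R := \sum_i (-1) ^+ s i * c i.

Definition indic_set A (i : 'I_n) : R := (i \in A)%:R.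

Lemma sum_expR_signed (lam : R) (c : 'I_n -> R) :
  \sum_s expR (lam * signed_sum s c) <= 2 ^+ n * expR (2 * lam ^+ 2 * \sum_i c i ^+ 2).
Proof.
have -> : \sum_s expR (lam * signed_sum s c)
    = \prod_(i < n) \sum_(b : bool) expR ((-1) ^+ b * (lam * c i)).
  rewrite bigA_distr_bigA /=; apply: eq_bigr => s _.
  rewrite /signed_sum mulr_sumr expR_sum; apply: eq_bigr => i _.
  by congr expR; ring.
have -> : 2 ^+ n * expR (2 * lam ^+ 2 * \sum_i c i ^+ 2) =
    \prod_(i < n) (2 * expR (2 * (lam * c i) ^+ 2)).
  rewrite big_split /= prodr_const card_ord -expR_sum; congr (_ * expR _).
  by rewrite mulr_sumr; apply: eq_bigr => i _; ring.
apply: ler_prod => i _; rewrite big_bool /= expr1 expr0 mul1r mulN1r addrC.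
by rewrite addr_ge0 ?expR_ge0 //= expR_cosh_le.
Qed.

Lemma sum_sqr_indic_diff A B :
  \sum_i (indic_set A i - indic_set B i) ^+ 2 = #|symdiff A B|%:R :> R.
Proof.
rewrite -sum1_card natr_sum [RHS]big_mkcond /=; apply: eq_bigr => i _.
rewrite /indic_set !inE; case: (i \in A); case: (i \in B) => /=; ring.
Qed.

Lemma symdiff_eq0 A B : #|symdiff A B| = 0%N -> A = B.
Proof.
move=> /cards0_eq /setP H; apply/setP => i; have := H i; rewrite !inE.
by case: (i \in A); case: (i \in B).
Qed.

Variables (D : R) (U : nat).
Local Notation W := (entropy D U).

(** A maximal separated subfamily is a net, since a member far from all its elements could be added
    to it; separation lets [card_packing] bound its size. *)
Lemma net_exists (F : {set {set 'I_n}}) (l : nat) : 1 <= D -> trace_growth D U F ->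
  exists N : {set {set 'I_n}}, [/\ N \subset F,
    forall A, A \in F -> exists2 B, B \in N & (4 ^ l * #|symdiff A B| <= n)%N &
    #|N|%:R <= expR (W * l.+2%:R)].
Proof.
move=> D1 gF.
pose sep (N : {set {set 'I_n}}) := (N \subset F) &&
  [forall A in N, forall B in N, (A != B) ==> (n < 4 ^ l * #|symdiff A B|)%N].
have sep0 : sep set0.
  by rewrite /sep sub0set /=; apply/forall_inP => A; rewrite inE.
have [N maxN _] := maxset_exists sep0.
have sepN := maxsetp maxN; have /andP[NF /forall_inP H] := sepN.
exists N; split => //; last first.
  apply: (card_packing D1 gF NF) => A B AN BN AB.
  by have /forall_inP/(_ _ BN)/implyP := H _ AN; apply.
move=> A AF; have [AN|AN] := boolP (A \in N).
  by exists A; rewrite // /symdiff finset.setDv finset.setU0 cards0 muln0.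
apply: contrapT => far; case/negP: AN.
have far' B : B \in N -> (n < 4 ^ l * #|symdiff A B|)%N.
  by move=> BN; rewrite ltnNge; apply/negP => le; apply: far; exists B.
have symC B C : symdiff B C = symdiff C B by rewrite /symdiff finset.setUC.
suff sepA : sep (A |: N) by rewrite -(maxsetsup maxN sepA (subsetUr _ _)) setU11.
rewrite /sep subUset sub1set AF NF /=; apply/forall_inP => B; rewrite !inE => BA.
apply/forall_inP => C; rewrite !inE => CA; apply/implyP => BC.
case/orP: BA => [/eqP E|BN]; case/orP: CA => [/eqP E'|CN].
- by rewrite E E' eqxx in BC.
- by rewrite E far'.
- by rewrite E' symC far'.
- by have /forall_inP/(_ _ CN)/implyP := H _ BN; apply.
Qed.

(** The weights 2^-(i+1) against the growth i + 3 of the log-cardinals sum to less than 4: this is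
    the factor of W in [rademacher_mgf]. *)
Lemma sum_chain_weights (L : nat) :
  \sum_(i < L) 2 ^- i.+1 * i.+3%:R = 4 - L.+4%:R * 2 ^- L :> R.
Proof.
elim: L => [|L IH]; first by rewrite big_ord0 expr0 invr1 mulr1 subrr.
rewrite big_ord_recr /= IH -![in RHS]natr1 -!natr1 exprS invfM; field.
by apply: lt0r_neq0; apply: exprn_gt0; lra.
Qed.

Lemma sum_half_pow (L : nat) : \sum_(i < L) 2 ^- i.+1 = 1 - 2 ^- L :> R.
Proof.
elim: L => [|L IH]; first by rewrite big_ord0 expr0 invr1 subrr.
by rewrite big_ord_recr /= IH exprS invfM; field; apply: lt0r_neq0; apply: exprn_gt0; lra.
Qed.

(* Chaining: a member of [F] is reached from the empty set through nets at the scales n / 4^i,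
   and Jensen's inequality distributes the exponential over the links with weights 2^-(i+1). *)
Lemma rademacher_mgf (F : {set {set 'I_n}}) (lam : R) : 1 <= D -> trace_growth D U F ->
  \sum_s \big[Num.max/0]_(A in F) expR (lam * signed_sum s (indic_set A))
    <= 2 ^+ n * expR (4 * W + 8 * lam ^+ 2 * n%:R).
Proof.
move=> D1 gF.
have lnD : 0 <= ln D by rewrite ln_ge0.
have W0 : 0 <= W.
  by rewrite /entropy addr_ge0 // addr_ge0 // mulr_ge0.
have [N /all_and3 [NF Ncov Ncard]] := choice (fun l => net_exists l D1 gF).
have [pi0 Hpi] : exists pi : nat -> {set 'I_n} -> {set 'I_n}, forall l A, A \in F ->
    pi l A \in N l /\ (4 ^ l * #|symdiff A (pi l A)| <= n)%N.
  have /choice[f Hf] : forall x : nat * {set 'I_n}, exists B, x.2 \in F ->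
      B \in N x.1 /\ (4 ^ x.1 * #|symdiff x.2 B| <= n)%N.
    move=> [l A] /=; have [AF|_] := boolP (A \in F); last by exists set0.
    by have [B BN HB] := Ncov l A AF; exists B.
  by exists (fun l A => f (l, A)) => l A AF; exact: (Hf (l, A)).
(* At level 0 the projection is the empty set, within distance n of everything and with vanishing
   signed sum, so the chain starts at no cost. *)
pose pi (l : nat) A := if l is 0%N then set0 else pi0 l A.
have pidist l A : A \in F -> (4 ^ l * #|symdiff A (pi l A)| <= n)%N.
  case: l => [_|l AF]; last exact: (Hpi l.+1 A AF).2.
  by rewrite mul1n; have := max_card (mem (symdiff A (pi 0%N A))); rewrite card_ord.
(* [e i] bounds the logarithm of the cardinal of [N i.+1]; subtracting it in [T] pays for replacing
   a maximum over that net by a sum. *)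
pose e (i : nat) : R := W * i.+3%:R.
pose w (i : nat) : R := 2 ^- i.+1.
have w0 i : 0 < w i by rewrite invr_gt0 exprn_gt0.
pose link i A s : R := signed_sum s (fun k => indic_set A k - indic_set (pi i A) k).
pose T i s : R := \sum_(A in N i.+1) expR (lam / w i * link i A s - e i).
have linkE i B s : link i B s = signed_sum s (indic_set B) - signed_sum s (indic_set (pi i B)).
  by rewrite /link /signed_sum -sumrB; apply: eq_bigr => k _; ring.
have s0 s : signed_sum s (indic_set set0) = 0.
  by apply: big1 => i _; rewrite /indic_set inE mulr0.
have Tge i B s : B \in N i.+1 -> expR (lam / w i * link i B s - e i) <= T i s.
  move=> BN; rewrite /T (bigD1 B) //= lerDl; apply: sumr_ge0 => C _; exact: expR_ge0.
have chain l B s : B \in N l.+1 ->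
    lam * signed_sum s (indic_set B) <= \sum_(i < l.+1) w i * (e i + ln (T i s)).
  elim: l B => [|l IH] B BN.
    rewrite big_ord1; have := Tge _ _ s BN.
    rewrite -ler_ln ?posrE ?expR_gt0 //; last by apply: lt_le_trans (Tge _ _ s BN); exact: expR_gt0.
    rewrite expRK linkE s0 subr0 => h.
    have : w 0%N * (lam / w 0%N * signed_sum s (indic_set B)) <= w 0%N * (e 0%N + ln (T 0%N s)).
      by rewrite ler_pM2l //; lra.
    by rewrite mulrA mulrCA divff ?mulr1 // gt_eqF.
  rewrite big_ord_recr /=.
  have BF : B \in F by exact: (subsetP (NF _) _ BN).
  have := IH (pi l.+1 B) (Hpi l.+1 B BF).1.
  have := Tge _ _ s BN.
  rewrite -ler_ln ?posrE ?expR_gt0 //; last by apply: lt_le_trans (Tge _ _ s BN); exact: expR_gt0.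
  rewrite expRK linkE => h h2.
  have : w l.+1 * (lam / w l.+1 * (signed_sum s (indic_set B) - signed_sum s (indic_set (pi l.+1 B))))
      <= w l.+1 * (e l.+1 + ln (T l.+1 s)).
    by rewrite ler_pM2l //; lra.
  rewrite mulrA mulrCA divff ?mulr1 ?gt_eqF // mulrBr; lra.
(* 4^L > n forces distance 0 at level L, so the last net contains all of [F] and the chain ends
   exactly at the given set. *)
pose L := n.+1.
have FN : F \subset N L.
  apply/subsetP => A AF; have [AN le] := Hpi L A AF.
  have L4 : (n < 4 ^ L)%N by apply: ltn_trans (ltnSn n) _; exact: ltn_expl.
  have [/symdiff_eq0 E|d0] := posnP #|symdiff A (pi0 L A)|; first by rewrite E.
  by have := leq_trans L4 (leq_trans (leq_pmulr _ d0) le); rewrite ltnn.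
have ET i : \sum_s T i s <= 2 ^+ n * expR (8 * lam ^+ 2 * n%:R).
  rewrite /T exchange_big /=.
  apply: (@le_trans _ _ (\sum_(A in N i.+1) expR (- e i) * (2 ^+ n * expR (8 * lam ^+ 2 * n%:R)))).
    apply: ler_sum => A AN; under eq_bigr do rewrite expRD mulrC.
    rewrite -mulr_sumr ler_pM2l ?expR_gt0 //.
    apply: le_trans (sum_expR_signed _ _) _; rewrite ler_pM2l ?exprn_gt0 // ler_expR.
    rewrite sum_sqr_indic_diff.
    have := pidist i A (subsetP (NF _) _ AN); rewrite -(ler_nat R) natrM natrX => h.
    (* Dividing by the weight multiplies the variance by 4^(i+1), while the link has at most n / 4^i
       points; the resulting bound 8 lam^2 n is the same at every level. *)
    have -> : 2 * (lam / w i) ^+ 2 * #|symdiff A (pi i A)|%:R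
        = 8 * lam ^+ 2 * (4 ^+ i * #|symdiff A (pi i A)|%:R).
      have w4 : (w i)^-1 ^+ 2 = 4 * 4 ^+ i.
        have e4 : (2 : R) ^+ 2 = 4 by ring.
        by rewrite /w invrK -exprM mulnC exprM e4 exprS.
      by rewrite exprMn w4; ring.
    by rewrite ler_wpM2l // mulr_ge0 // sqr_ge0.
  rewrite sumr_const -[leLHS]mulr_natl mulrA -[leRHS]mul1r ler_wpM2r //.
    by rewrite mulr_ge0 ?expR_ge0 ?exprn_ge0.
  apply: (@le_trans _ _ (expR (e i) * expR (- e i))); first by rewrite ler_wpM2r ?expR_ge0 ?Ncard.
  by rewrite -expRD subrr expR0.
(* Jensen with the weights [w i], whose deficit 2^-L is the extra term. *)
have pt s : \big[Num.max/0]_(A in F) expR (lam * signed_sum s (indic_set A))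
    <= expR (4 * W) * (\sum_(i < L) w i * T i s + 2 ^- L).
  apply: bigmax_le.
    apply: mulr_ge0; first exact: expR_ge0.
    apply: addr_ge0; last by rewrite invr_ge0 exprn_ge0.
    apply: sumr_ge0 => i _; apply: mulr_ge0; first exact: ltW.
    by apply: sumr_ge0 => A _; exact: expR_ge0.
  move=> A AF; have AN := subsetP FN _ AF.
  apply: (@le_trans _ _ (expR (\sum_(i < L) w i * e i + \sum_(i < L) w i * ln (T i s)))).
    rewrite ler_expR; apply: le_trans (chain n A s AN) _.
    by rewrite -big_split /=; apply: ler_sum => i _; rewrite mulrDr.
  rewrite expRD; apply: ler_pM; rewrite ?expR_ge0 //.
    rewrite ler_expR; rewrite (eq_bigr (fun i : 'I_L => W * (2 ^- i.+1 * i.+3%:R))); last first.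
      by move=> i _; rewrite /e /w; ring.
    rewrite -mulr_sumr sum_chain_weights mulrC ler_wpM2r // lerBlDr lerDl.
    by rewrite mulr_ge0 ?invr_ge0 ?exprn_ge0.
  have sw : \sum_(i < L) w i = 1 - 2 ^- L by exact: sum_half_pow.
  apply: le_trans (expR_jensen _ _ _) _; first by move=> i; rewrite ltW.
    by rewrite sw lerBlDr lerDl invr_ge0 exprn_ge0.
  have -> : 1 - \sum_(i < L) w i = 2 ^- L by rewrite sw; ring.
  rewrite lerD2r; apply: ler_sum => i _.
  rewrite ler_pM2l // lnK // posrE.
  by apply: lt_le_trans (Tge i (pi0 i.+1 A) s (Hpi _ _ AF).1); exact: expR_gt0.
apply: le_trans (ler_sum _ (fun s _ => pt s)) _.
rewrite -mulr_sumr big_split /= exchange_big /=.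
apply: (@le_trans _ _ (expR (4 * W) * (\sum_(i < L) w i * (2 ^+ n * expR (8 * lam ^+ 2 * n%:R))
   + 2 ^- L * (2 ^+ n * expR (8 * lam ^+ 2 * n%:R))))).
  rewrite ler_pM2l ?expR_gt0 //; apply: lerD.
    by apply: ler_sum => i _; rewrite -mulr_sumr ler_pM2l.
  rewrite sumr_const card_ffun card_bool card_ord -[_ *+ (2 ^ n)%N]mulr_natr natrX ler_pM2l ?invr_gt0 ?exprn_gt0 //.
  rewrite -[leLHS]mulr1 ler_pM2l ?exprn_gt0 // -[leLHS]expR0 ler_expR.
  by rewrite mulr_ge0 // mulr_ge0 // sqr_ge0.
rewrite -mulr_suml -mulrDl sum_half_pow subrK mul1r expRD mulrCA; exact: lexx.
Qed.

End Chaining.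

(** * Symmetrization with a ghost sample *)

Section Symmetrization.
Variables (R : realType) (Y : finType) (p : Y -> R).
Hypotheses (p_ge0 : forall y, 0 <= p y) (p_sum : \sum_y p y = 1).
Variables (J : finType) (c : J -> {set Y}) (D : R) (U : nat).
Hypothesis D1 : 1 <= D.
Hypothesis growth : forall (r : nat) (x : 'I_r -> Y) (y : R), 0 < y <= 1 ->
  #|[set [set i | x i \in c j] | j : J]|%:R * y ^+ U <= D * expR (4 * y * r%:R).
Variable n : nat.
Implicit Types (x : {ffun 'I_n -> Y}) (z : {ffun 'I_n -> Y * Y}) (s : {ffun 'I_n -> bool}).

Definition weight x : R := \prod_i p (x i).

Definition mass (A : {set Y}) : R := \sum_(y in A) p y.

Lemma weight_ge0 x : 0 <= weight x.
Proof. exact: prodr_ge0. Qed.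

Lemma sum_weight : \sum_x weight x = 1.
Proof.
by rewrite -(bigA_distr_bigA (fun (_ : 'I_n) y => p y)) /= big1 // => i _.
Qed.

Lemma traces_growth x : trace_growth D U [set [set i | x i \in c j] | j : J].
Proof.
move=> r g y y01; have := growth (fun i => x (g i)) y01.
congr (_ <= _); congr (_%:R * _); apply: eq_card => A.
apply/imsetP/imsetP => [[j _ ->]|[_ /imsetP[j _ ->] ->]].
  exists [set i | x i \in c j]; first exact: imset_f.
  by apply/setP => i; rewrite !inE.
by exists j => //; apply/setP => i; rewrite !inE.
Qed.

(** Jensen over the ghost sample: the true mass of [A] is replaced by the count over an independent
    copy. *)
Lemma expR_mean_le (A : {set Y}) (lam : R) :
  expR (- lam * (n%:R * mass A)) <= \sum_x weight x * expR (- lam * \sum_i (x i \in A)%:R).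
Proof.
have -> : \sum_x weight x * expR (- lam * \sum_i (x i \in A)%:R)
   = (\sum_y p y * expR (- lam * (y \in A)%:R)) ^+ n.
  rewrite -[n in RHS]card_ord -prodr_const bigA_distr_bigA /=; apply: eq_bigr => x _.
  by rewrite mulr_sumr expR_sum -big_split.
rewrite mulrCA mulrC expRM_natr; apply: lerXn2r; rewrite ?nnegrE ?expR_ge0 //.
  by apply: sumr_ge0 => y _; rewrite mulr_ge0 ?expR_ge0.
have := @expR_jensen R Y (index_enum Y) xpredT p (fun y => - lam * (y \in A)%:R) p_ge0.
rewrite p_sum subrr addr0 => /(_ (lexx _)); apply: le_trans.
rewrite ler_expR /mass mulr_sumr big_mkcond /= le_eqVlt; apply/orP; left; apply/eqP.
by apply: eq_bigr => y _; case: (y \in A); rewrite ?mulr1 ?mulr0 // mulrC.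
Qed.

Definition weight2 z : R := \prod_i (p (z i).1 * p (z i).2).

Definition swap s z : {ffun 'I_n -> Y * Y} := [ffun i => if s i then ((z i).2, (z i).1) else z i].

Lemma swapK s : involutive (swap s).
Proof. by move=> z; apply/ffunP => i; rewrite !ffunE; case: (s i) => //=; case: (z i). Qed.

Lemma weight2_swap s z : weight2 (swap s z) = weight2 z.
Proof.
by apply: eq_bigr => i _; rewrite ffunE; case: (s i) => //=; rewrite mulrC.
Qed.

Definition split1 z : {ffun 'I_n -> Y} := [ffun i => (z i).1].
Definition split2 z : {ffun 'I_n -> Y} := [ffun i => (z i).2].

Lemma weight2E z : weight2 z = weight (split1 z) * weight (split2 z).
Proof. by rewrite /weight2 big_split /=; congr (_ * _); apply: eq_bigr => i _; rewrite ffunE. Qed.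

Lemma sum_split (f : {ffun 'I_n -> Y} -> {ffun 'I_n -> Y} -> R) :
  \sum_z f (split1 z) (split2 z) = \sum_x \sum_y f x y.
Proof.
pose h (xy : {ffun 'I_n -> Y} * {ffun 'I_n -> Y}) : {ffun 'I_n -> Y * Y} := [ffun i => (xy.1 i, xy.2 i)].
have hE xy : (split1 (h xy), split2 (h xy)) = xy.
  by case: xy => a b; congr (_, _); apply/ffunP => i; rewrite !ffunE.
rewrite (reindex h) /=; last first.
  exists (fun z => (split1 z, split2 z)) => [xy _|z _] //.
  by apply/ffunP => i; rewrite !ffunE; case: (z i).
rewrite pair_big /=; apply: eq_bigr => -[a b] _.
by have [-> ->] := hE (a, b).
Qed.

(* The swapped coordinates realise the Rademacher signs: [z] and [swap s z] have the same weight. *)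
Theorem uniform_deviation (t : R) : 0 <= t ->
  \sum_(x : {ffun 'I_n -> Y} | [exists j, n%:R * (mass (c j) + t) <= \sum_i (x i \in c j)%:R]) weight x
    <= expR (4 * entropy D U - n%:R * t ^+ 2 / 128).
Proof.
(* This value minimizes the final exponent 32 lam^2 n - lam n t, with minimum - n t^2 / 128. *)
move=> t0; pose lam : R := t / 64.
have lam0 : 0 <= lam by rewrite divr_ge0.
pose diff z j : R := \sum_i (((z i).1 \in c j)%:R - ((z i).2 \in c j)%:R).
pose M z : R := \big[Num.max/0]_j expR (lam * diff z j).
have M0 z : 0 <= M z by apply: bigmax_ge_id.
have MA z j : expR (lam * diff z j) <= M z by apply: (@le_bigmax _ _ _ _ (fun j => expR (lam * diff z j))).
(* Markov's inequality for the exponential moment, followed by [expR_mean_le] in the second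
   sample. *)
have step1 : \sum_(x : {ffun 'I_n -> Y} | [exists j, n%:R * (mass (c j) + t) <= \sum_i (x i \in c j)%:R]) weight x
    <= expR (- (lam * n%:R * t)) * \sum_z weight2 z * M z.
  have -> : \sum_z weight2 z * M z = \sum_(x : {ffun 'I_n -> Y}) weight x * \sum_(y : {ffun 'I_n -> Y}) weight y * M [ffun i => (x i, y i)].
    pose f (x y : {ffun 'I_n -> Y}) := weight x * (weight y * M [ffun i => (x i, y i)]).
    rewrite (eq_bigr (fun z => f (split1 z) (split2 z))).
      by rewrite (sum_split f); apply: eq_bigr => x _; rewrite mulr_sumr.
    move=> z _; rewrite /f weight2E mulrA; congr (_ * M _).
    by apply/ffunP => i; rewrite !ffunE; case: (z i).
  rewrite mulr_sumr big_mkcond /=; apply: ler_sum => x _.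
  have i0 : 0 <= \sum_(y : {ffun 'I_n -> Y}) weight y * M [ffun i => (x i, y i)].
    by apply: sumr_ge0 => y _; rewrite mulr_ge0 ?weight_ge0.
  case: ifP => [/existsP[j Hj]|_]; last by rewrite mulr_ge0 ?expR_ge0 // mulr_ge0 ?weight_ge0.
  rewrite mulrCA -[leLHS]mulr1; apply: ler_wpM2l; first exact: weight_ge0.
  rewrite expRN ler_pdivlMl ?expR_gt0 // mulr1.
  apply: (@le_trans _ _ (\sum_(y : {ffun 'I_n -> Y}) weight y * (expR (lam * \sum_i (x i \in c j)%:R)
                     * expR (- lam * \sum_i (y i \in c j)%:R)))).
    rewrite (eq_bigr (fun y : {ffun 'I_n -> Y} => expR (lam * \sum_i (x i \in c j)%:R) *
                     (weight y * expR (- lam * \sum_i (y i \in c j)%:R)))); last by move=> y _; ring.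
    rewrite -mulr_sumr; apply: (@le_trans _ _ (expR (lam * \sum_i (x i \in c j)%:R) * expR (- lam * (n%:R * mass (c j))))).
      rewrite -expRD ler_expR.
      have := ler_wpM2l lam0 Hj; lra.
    by rewrite ler_pM2l ?expR_gt0 // expR_mean_le.
  apply: ler_sum => y _; apply: ler_wpM2l; first exact: weight_ge0.
  rewrite -expRD; apply: le_trans (MA _ j); rewrite ler_expR le_eqVlt; apply/orP; left; apply/eqP.
  by rewrite mulNr -mulrBr -sumrB; congr (_ * _); apply: eq_bigr => i _; rewrite ffunE.
apply: le_trans step1 _.
pose rad mu s x : R := \big[Num.max/0]_(A in [set [set i | x i \in c j] | j : J])
    expR (mu * signed_sum s (indic_set R A)).
have rad0 mu s x : 0 <= rad mu s x by apply: bigmax_ge_id.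
have radj mu s x j : expR (mu * \sum_i (-1) ^+ s i * (x i \in c j)%:R) <= rad mu s x.
  have h : [set i | x i \in c j] \in [set [set i | x i \in c j] | j : J] by exact: imset_f.
  apply: le_trans (le_bigmax_cond _ _ h); rewrite ler_expR /signed_sum le_eqVlt; apply/orP; left; apply/eqP.
  by congr (_ * _); apply: eq_bigr => i _; rewrite /indic_set inE.
have radE mu x : \sum_s rad mu s x <= 2 ^+ n * expR (4 * entropy D U + 8 * mu ^+ 2 * n%:R).
  by apply: rademacher_mgf => //; exact: traces_growth.
(* By the arithmetic-geometric mean inequality, exp(lam (a - b)) is at most the average of exp(2 lam
   a) and exp(- 2 lam b). This decouples the two samples, and doubling lam turns the variance factor
   8 into 32. *)
have Mswap s z : M (swap s z) <= (rad (2 * lam) s (split1 z) + rad (- (2 * lam)) s (split2 z)) / 2.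
  apply: bigmax_le; first by rewrite divr_ge0 ?addr_ge0.
  move=> j _.
  have h1 := radj (2 * lam) s (split1 z) j; have h2 := radj (- (2 * lam)) s (split2 z) j.
  set a := \sum_i _ in h1; set b := \sum_i _ in h2.
  have -> : diff (swap s z) j = a - b.
    rewrite -sumrB; apply: eq_bigr => i _; rewrite !ffunE.
    by case: (s i) => /=; rewrite ?expr1 ?expr0; ring.
  have h3 : expR (lam * (a - b)) <= (expR (2 * lam * a) + expR (- (2 * lam) * b)) / 2.
    have E1 : expR (2 * lam * a) = expR (lam * a) ^+ 2 by rewrite -expRM_natl; congr expR; ring.
    have E2 : expR (- (2 * lam) * b) = expR (- lam * b) ^+ 2 by rewrite -expRM_natl; congr expR; ring.
    have E3 : expR (lam * (a - b)) = expR (lam * a) * expR (- lam * b) by rewrite -expRD; congr expR; ring.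
    have := sqr_ge0 (expR (lam * a) - expR (- lam * b)).
    rewrite E1 E2 E3; nra.
  by apply: le_trans h3 _; rewrite ler_pM2r ?invr_gt0 //; exact: lerD.
have step2 : 2 ^+ n * (\sum_z weight2 z * M z) <= 2 ^+ n * expR (4 * entropy D U + 32 * lam ^+ 2 * n%:R).
  have -> : 2 ^+ n * (\sum_z weight2 z * M z) = \sum_s \sum_z weight2 z * M (swap s z).
    rewrite [RHS](eq_bigr (fun=> \sum_z weight2 z * M z)).
      have cs : #|{: {ffun 'I_n -> bool}}| = (2 ^ n)%N by rewrite card_ffun card_bool card_ord.
      by rewrite sumr_const cs -[RHS]mulr_natl natrX.
    move=> s _; rewrite [RHS](reindex_inj (inv_inj (swapK s))) /=.
    by apply: eq_bigr => z _; rewrite weight2_swap.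
  rewrite exchange_big /=.
  apply: (@le_trans _ _ (\sum_z weight2 z * (2 ^+ n * expR (4 * entropy D U + 32 * lam ^+ 2 * n%:R)))).
    apply: ler_sum => z _; rewrite -mulr_sumr; apply: ler_wpM2l.
      by rewrite weight2E mulr_ge0 ?weight_ge0.
    apply: le_trans (ler_sum _ (fun s _ => Mswap s z)) _.
    rewrite -mulr_suml big_split /=.
    have := radE (2 * lam) (split1 z); have := radE (- (2 * lam)) (split2 z).
    rewrite sqrrN; have -> : 8 * (2 * lam) ^+ 2 = 32 * lam ^+ 2 by ring.
    lra.
  rewrite -mulr_suml.
  have -> : \sum_z weight2 z = 1.
    rewrite (eq_bigr (fun z => weight (split1 z) * weight (split2 z))); last by move=> z _; rewrite weight2E.
    rewrite (sum_split (fun x y => weight x * weight y)).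
    by under eq_bigr do rewrite -mulr_sumr sum_weight mulr1; rewrite sum_weight.
  by rewrite mul1r.
rewrite ler_pM2l ?exprn_gt0 // in step2.
apply: le_trans (ler_wpM2l (expR_ge0 _) step2) _.
rewrite -expRD ler_expR /lam; lra.
Qed.

End Symmetrization.

(** * Traces of sparse affine regions *)

Section AffineTraces.
Variables (R : realType) (p : nat).
Implicit Types (x : p.-tuple R) (S : {set 'I_p}).

Definition affval (f : 'rV[R]_p * R) x : R := dott f.1 x + f.2.

(* [f] encodes the region ({f_00 >= 0} n {f_01 >= 0}) u ({f_10 >= 0} n {f_11 >= 0}). *)
Definition in_region (f : bool * bool -> 'rV[R]_p * R) x : bool :=
  [exists b, [forall b', 0 <= affval (f (b, b')) x]].

Definition supported S (f : bool * bool -> 'rV[R]_p * R) :=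
  forall i l, l \notin S -> (f i).1 0 l = 0.

(** A constant coordinate 1 turns the affine form into a linear one in dimension 1 + #|S|, as the
    half-space bound demands. *)
Lemma affval_lift S (f : 'rV[R]_p * R) x : (forall l, l \notin S -> f.1 0 l = 0) ->
  affval f x = (row_mx 1%:M (\row_(i < #|S|) tnth x (enum_val i)) *m
                col_mx (f.2)%:M (\col_(i < #|S|) f.1 0 (enum_val i))) 0 0.
Proof.
move=> fS; rewrite mul_row_col mul1mx !mxE eqxx mulr1n addrC; congr (_ + _).
rewrite /dott (bigID (mem S)) /= [X in _ + X]big1 ?addr0; last by move=> l /fS->; rewrite mul0r.
rewrite big_enum_val /=; apply: eq_bigr => i _; by rewrite !mxE mulrC.
Qed.

(** A trace is determined by a support and four half-space traces on it. For each support there are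
    at most y^-(k+1) exp(y r) of the latter, and the fourth power gives both factors 4. *)
Lemma card_region_traces (k : nat) (J : finType) (f : J -> bool * bool -> 'rV[R]_p * R)
    (S : J -> {set 'I_p}) (r : nat) (x : 'I_r -> p.-tuple R) (y : R) :
  (forall j, supported (S j) (f j)) -> (forall j, (#|S j| <= k)%N) -> 0 < y <= 1 ->
  #|[set [set i | in_region (f j) (x i)] | j : J]|%:R * y ^+ (4 * k.+1) <=
  #|[set A : {set 'I_p} | (#|A| <= k)%N]|%:R * expR (4 * y * r%:R).
Proof.
move=> fS Sk /[dup] y01 /andP[y0 y1].
pose H (A : {set 'I_p}) : {set {set 'I_r}} := [set B | `[< exists w : 'cV[R]_(1 + #|A|),
   B = [set i | 0 <= (row_mx 1%:M (\row_(l < #|A|) tnth (x i) (enum_val l)) *m w) 0 0] >]].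
have HH (A : {set 'I_p}) : (#|A| <= k)%N -> #|H A|%:R * y ^+ k.+1 <= expR (y * r%:R).
  move=> Ak; apply: (@le_trans _ _ (#|H A|%:R * y ^+ (1 + #|A|))).
    by apply: ler_wpM2l => //; apply: ler_wiXn2l => //; exact: ltW.
  have HHA B : B \in H A -> exists w : 'cV[R]_(1 + #|A|), B = [set i | 0 <=
     ((row_mx 1%:M (\row_(l < #|A|) tnth (x i) (enum_val l)) : 'rV_(1 + #|A|)) *m w) 0 0].
    by rewrite inE => /asboolP.
  apply: le_trans (card_halfspace_traces HHA y01) _.
  rewrite expRM_natr; apply: lerXn2r; rewrite ?nnegrE ?expR_ge0 ?expR_ge1Dx // addr_ge0 // ltW //.
pose comb (t : {ffun bool * bool -> {set 'I_r}}) : {set 'I_r} :=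
  [set i | [exists b, [forall b', i \in t (b, b')]]].
pose pairs := ({set 'I_p} * {ffun bool * bool -> {set 'I_r}})%type.
pose Z : {set pairs} :=
  [set z : pairs | (#|z.1| <= k)%N && (z.2 \in ffun_on (mem (H z.1)))].
have ZE : #|Z| = (\sum_(A : {set 'I_p} | (#|A| <= k)%N) #|H A| ^ 4)%N.
  rewrite -sum1_card (eq_bigl (fun z : pairs => (#|z.1| <= k)%N && (z.2 \in ffun_on (mem (H z.1))))); last first.
    by move=> z; rewrite inE.
  rewrite -(pair_big_dep (fun A : {set 'I_p} => (#|A| <= k)%N) (fun A (t : {ffun bool * bool -> {set 'I_r}}) => t \in ffun_on (mem (H A))) (fun _ _ => 1%N)) /=.
  apply: eq_bigr => A _; rewrite sum1_card card_ffun_on card_prod card_bool.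
  by congr (_ ^ _)%N.
have le : (#|[set [set i | in_region (f j) (x i)] | j : J]| <= #|Z|)%N.
  apply: (leq_trans _ (leq_imset_card (fun z : pairs => comb z.2) Z)); apply: subset_leq_card.
  apply/subsetP => _ /imsetP[j _ ->]; apply/imsetP.
  exists (S j, [ffun b => [set i | 0 <= affval (f j b) (x i)]]).
    rewrite inE /= Sk /=; apply/ffun_onP => b; rewrite ffunE inE; apply/asboolP.
    exists (col_mx (f j b).2%:M (\col_(i < #|S j|) (f j b).1 0 (enum_val i))).
    by apply/setP => i; rewrite !inE (affval_lift _ (fS j b)).
  apply/setP => i; rewrite !inE; apply: eq_existsb => b; apply: eq_forallb => b'.
  by rewrite ffunE inE.
apply: (@le_trans _ _ (#|Z|%:R * y ^+ (4 * k.+1))).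
  by rewrite ler_wpM2r ?ler_nat // exprn_ge0 // ltW.
rewrite ZE natr_sum mulr_suml cardsE -sum1_card natr_sum mulr_suml.
apply: ler_sum => A Ak; rewrite mul1r natrX mulnC exprM -exprMn.
have -> : expR (4 * y * r%:R) = expR (y * r%:R) ^+ 4 by rewrite -expRM_natl; congr expR; ring.
by apply: lerXn2r; rewrite ?nnegrE ?expR_ge0 ?HH // mulr_ge0 // exprn_ge0 // ltW.
Qed.

End AffineTraces.

From mathcomp Require Import all_classical all_reals all_analysis.
From mathcomp Require Import measurable_realfun.
Import numFieldNormedType.Exports.
Local Open Scope classical_set_scope.
Local Open Scope ring_scope.

(** * Uniform deviations over sparse affine regions *)

Lemma measure_finType (d : measure_display) (T : measurableType d) (R : realType)
    (mu : {measure set T -> \bar R}) (I : finType) (Q : pred I) (F : I -> set T) :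
  (forall i, measurable (F i)) -> trivIset [set: I] F ->
  mu (\bigcup_(i in [set i | Q i]) F i) = (\sum_(i | Q i) mu (F i))%E.
Proof.
move=> mF tF; rewrite measure_fin_bigcup //; last exact: sub_trivIset tF.
rewrite (@fsbigE _ _ _ _ _ [seq i <- index_enum I | Q i]) ?filter_uniq ?index_enum_uniq //.
- by rewrite big_filter_cond; apply: eq_bigl => i; rewrite mem_setE /= andbb.
- by move=> i /=; rewrite mem_filter => /andP[].
- by move=> i /= Qi; rewrite mem_filter Qi mem_index_enum.
- exact: finite_finset.
Qed.

Lemma measurable_affval (R : realType) (p : nat) (f : 'rV[R]_p * R) :
  measurable_fun [set: p.-tuple R] (affval f).
Proof.
apply: measurable_funD => //; apply: measurable_sum => k.
apply: measurable_funM => //; exact: measurable_tnth.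
Qed.

Lemma measurable_exists_forall (d : measure_display) (T : measurableType d) (R : realType)
    (g : bool * bool -> T -> R) : (forall b, measurable_fun [set: T] (g b)) ->
  measurable [set x | [exists b, [forall b', 0 <= g (b, b') x]]].
Proof.
move=> mg; have -> : [set x | [exists b, [forall b', 0 <= g (b, b') x]]] =
    \bigcup_(b in [set: bool]) \bigcap_(b' in [set: bool]) [set x | 0 <= g (b, b') x].
  apply/seteqP; split => x.
    by case/existsP => b /forallP H; exists b => // b' _; exact: H.
  by case=> b _ H; apply/existsP; exists b; apply/forallP => b'; exact: H.
apply: fin_bigcup_measurable => // b _; apply: fin_bigcap_measurable => // b' _.
by rewrite -[X in measurable X]setTI; apply: (@measurable_fun_le _ _ R setT (cst 0) (g (b, b'))).
Qed.

Lemma measurable_region (R : realType) (p : nat) (f : bool * bool -> 'rV[R]_p * R) :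
  measurable [set x | in_region f x].
Proof. by apply: (@measurable_exists_forall _ _ _ (fun b => affval (f b))) => b; exact: measurable_affval. Qed.

(** The slack dominates, for every x at once, an error of h in each coefficient and of 2h in the
    constant term. As h tends to 0 the thick regions shrink to the region itself. *)
Definition thick_region (R : realType) (p : nat) (f : bool * bool -> 'rV[R]_p * R) (h : R) :
    set (p.-tuple R) :=
  [set x | [exists b, [forall b', 0 <= affval (f (b, b')) x + h * (2 + \sum_l `|tnth x l|)]]].

Lemma measurable_thick_region (R : realType) (p : nat) (f : bool * bool -> 'rV[R]_p * R) (h : R) :
  measurable (thick_region f h).
Proof.
apply: (@measurable_exists_forall _ _ _
  (fun b (x : p.-tuple R) => affval (f b) x + h * (2 + \sum_l `|tnth x l|))) => b.
apply: measurable_funD; first exact: measurable_affval.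
apply: measurable_funM => //; apply: measurable_funD => //; apply: measurable_sum => l.
by apply: measurableT_comp => //; exact: measurable_tnth.
Qed.

Section UniformDeviation.
Variables (R : realType) (p k n : nat) (d : measure_display) (T : measurableType d).
Variables (P : probability T R) (mu : probability (p.-tuple R) R) (X : 'I_n -> T -> p.-tuple R).
Hypothesis mX : forall i, measurable_fun [set: T] (X i).
Hypothesis HX : forall i A, measurable A -> P (X i @^-1` A) = mu A.
Hypothesis indX : independent P X.
Variable t : R.
Hypothesis t0 : 0 <= t.

Local Notation D := (#|[set A : {set 'I_p} | (#|A| <= k)%N]%SET|%:R : R).

Definition deviation_bound : R := expR (4 * entropy D (4 * k.+1) - n%:R * t ^+ 2 / 128).

Definition region (f : bool * bool -> 'rV[R]_p * R) : set (p.-tuple R) := [set x | in_region f x].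

Definition hits (f : bool * bool -> 'rV[R]_p * R) (w : T) : R := \sum_i (in_region f (X i w))%:R.

(** The regions cut the space into finitely many atoms, indexed by membership patterns. Passing to
    patterns gives an i.i.d. sample in a finite space, to which [uniform_deviation] applies. *)
Lemma finite_class_deviation (J : finType) (f : J -> bool * bool -> 'rV[R]_p * R)
    (S : J -> {set 'I_p}) :
  (forall j, supported (S j) (f j)) -> (forall j, (#|S j| <= k)%N) ->
  let bad := [set w | [exists j, n%:R * (fine (mu (region (f j))) + t) <= hits (f j) w]] in
  measurable bad /\ (P bad <= deviation_bound%:E)%E.
Proof.
move=> fS Sk bad.
pose pat x : {ffun J -> bool} := [ffun j => in_region (f j) x].
pose atom y : set (p.-tuple R) := [set x | pat x = y].
have matom y : measurable (atom y).
  have -> : atom y = \bigcap_(j in [set: J]) [set x | in_region (f j) x = y j].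
    apply/seteqP; split => [x /= <- j _|x H] /=; first by rewrite ffunE.
    by apply/ffunP => j; rewrite ffunE; exact: H.
  apply: fin_bigcap_measurable => // j _; case: (y j); first exact: measurable_region.
  have -> : [set x | in_region (f j) x = false] = ~` region (f j).
    by apply/seteqP; split => x; rewrite /region /=; [move=> -> | move/negP/negbTE].
  by apply: measurableC; exact: measurable_region.
have tatom : trivIset [set: {ffun J -> bool}] atom by move=> y y' _ _ [x [/= <- <-]].
(* Representatives let traces of patterns be read as traces of actual points. An empty atom receives
   an arbitrary point: it has mass 0, and the growth bound holds for all points. *)
have /choice[rep Hrep] : forall y, exists r, forall x, pat x = y -> pat r = y.
  move=> y; have [[x Hx]|nx] := pselect (exists x, pat x = y); first by exists x.
  by exists [tuple 0 | _ < p] => x Hx; case: nx; exists x.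
pose pr y : R := fine (mu (atom y)).
have prE y : mu (atom y) = (pr y)%:E by rewrite fineK // fin_num_measure.
have pr0 y : 0 <= pr y by rewrite fine_ge0.
pose c j : {set {ffun J -> bool}} := [set y | in_region (f j) (rep y)]%SET.
have cE j x : (pat x \in c j) = in_region (f j) x.
  by rewrite inE; have /ffunP/(_ j) := Hrep _ x erefl; rewrite !ffunE.
have massE j : mass pr (c j) = fine (mu (region (f j))).
  have -> : region (f j) = \bigcup_(y in [set y | y \in c j]) atom y.
    apply/seteqP; split => [x /= Hx|x [y /= yc]]; first by exists (pat x); rewrite /= ?cE.
    by rewrite /atom /= => xy; rewrite /region /= -cE xy.
  rewrite measure_finType // (eq_bigr (fun y => (pr y)%:E)); last by move=> y _; exact: prE.
  by rewrite sumEFin.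
have pr1 : \sum_y pr y = 1.
  apply: EFin_inj; rewrite -sumEFin (eq_bigr (fun y => mu (atom y))); last by move=> y _; rewrite prE.
  rewrite -(@measure_finType _ _ _ mu _ predT atom) //; have -> : \bigcup_(y in [set _ | true]) atom y = setT.
    by apply/seteqP; split => // x _; exists (pat x).
  exact: probability_setT.
have D1 : 1 <= D.
  rewrite (ler_nat _ 1) card_gt0; apply/set0Pn; exists finset.set0.
  by rewrite inE cards0.
pose badx (x : {ffun 'I_n -> {ffun J -> bool}}) :=
  [exists j, n%:R * (mass pr (c j) + t) <= \sum_i (x i \in c j)%:R].
pose cyl (x : {ffun 'I_n -> {ffun J -> bool}}) := \bigcap_(i in [set: 'I_n]) (X i @^-1` atom (x i)).
have mcyl x : measurable (cyl x).
  apply: fin_bigcap_measurable => // i _; rewrite -[X in measurable X]setTI; exact: mX.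
have badE : bad = \bigcup_(x in [set x | badx x]) cyl x.
  have hitsE w j : hits (f j) w = \sum_i ([ffun i => pat (X i w)] i \in c j)%:R.
    by apply: eq_bigr => i _; rewrite ffunE cE.
  apply/seteqP; split => [w /existsP[j Hj]|w [x /= /existsP[j Hj] Hx]].
    exists [ffun i => pat (X i w)]; last by move=> i _; rewrite /= /atom /= ffunE.
    by apply/existsP; exists j; rewrite massE -hitsE.
  apply/existsP; exists j; rewrite -massE hitsE; apply: le_trans Hj _.
  by apply: ler_sum => i _; rewrite ffunE (Hx i I).
split; first by rewrite badE; apply: fin_bigcup_measurable.
have tcyl : trivIset [set: {ffun 'I_n -> {ffun J -> bool}}] cyl.
  move=> x x' _ _ [w [Hx Hx']]; apply/ffunP => i.
  by have := Hx i I; have := Hx' i I; rewrite /= /atom /= => <- <-.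
rewrite badE measure_finType //.
rewrite (eq_bigr (fun x => (weight pr x)%:E)); last first.
  move=> x _; transitivity (\prod_(i < n) P (X i @^-1` atom (x i)))%E.
    by apply: (indX (A := fun i => atom (x i))) => i; exact: matom.
  by rewrite /weight -prodEFin; apply: eq_bigr => i _; rewrite HX.
rewrite sumEFin lee_fin.
apply: (@uniform_deviation R _ pr pr0 pr1 _ c D (4 * k.+1) D1 _ n t t0).
move=> r x y y01; have := card_region_traces (fun i => rep (x i)) fS Sk y01.
congr (_ <= _); congr (_%:R * _); apply: eq_card => A.
by apply/imsetP/imsetP => -[j _ ->]; exists j => //; apply/setP => i; rewrite !inE.
Qed.

(** The bad events of the initial segments increase and share one bound, which passes to their union
    by continuity from below. *)
Lemma countable_class_deviation (f : nat -> bool * bool -> 'rV[R]_p * R) (S : nat -> {set 'I_p}) :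
  (forall j, supported (S j) (f j)) -> (forall j, (#|S j| <= k)%N) ->
  exists2 B : set T, measurable B & ((P (~` B) <= deviation_bound%:E)%E /\
    forall w j, B w -> hits (f j) w <= n%:R * (fine (mu (region (f j))) + t)).
Proof.
move=> fS Sk.
pose bad N := [set w | [exists j : 'I_N, n%:R * (fine (mu (region (f j))) + t) <= hits (f j) w]].
have badP N : measurable (bad N) /\ (P (bad N) <= deviation_bound%:E)%E.
  exact: (@finite_class_deviation _ (fun j : 'I_N => f j) (fun j : 'I_N => S j)).
have mU : measurable (\bigcup_N bad N) by apply: bigcup_measurable => N _; exact: (badP N).1.
exists (~` \bigcup_N bad N); first exact: measurableC.
split.
  rewrite setCK.
  have ndbad : {homo bad : a b / (a <= b)%N >-> (a <= b)%O}.
    move=> a b ab; rewrite subsetEset => w /existsP[j Hj].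
    by apply/existsP; exists (widen_ord ab j).
  have cv := nondecreasing_cvg_mu (mu := P) (fun N => (badP N).1) mU ndbad.
  rewrite -(cvg_lim (@ereal_hausdorff R) cv); apply: lime_le; first exact: cvgP cv.
  by apply: nearW => N; exact: (badP N).2.
move=> w j nB; rewrite leNgt; apply/negP => lt; apply: nB; exists j.+1 => //.
by apply/existsP; exists ord_max => /=; exact: ltW.
Qed.

(** The approximant must be nonnegative at the sample points wherever [f] is, so that no hit is
    lost, and must stay below [f] plus the slack of [thick_region] everywhere. *)
Lemma rational_approx (f : bool * bool -> 'rV[R]_p * R) (S : {set 'I_p}) (x : 'I_n -> p.-tuple R) (h : R) :
  supported S f -> 0 < h ->
  exists g : bool * bool -> 'rV[rat]_p * rat,
    [/\ supported S (fun b => (map_mx (@ratr R) (g b).1, @ratr R (g b).2)),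
        forall b i, 0 <= affval (f b) (x i) -> 0 <= affval (map_mx (@ratr R) (g b).1, @ratr R (g b).2) (x i) &
        forall b z, affval (map_mx (@ratr R) (g b).1, @ratr R (g b).2) z <=
                    affval (f b) z + h * (2 + \sum_l `|tnth z l|)].
Proof.
move=> fS h0.
(* A coefficient error h / K costs at most h at any sample point, which is repaid by raising the
   constant term by between h and 2h. *)
pose K : R := 1 + \sum_i \sum_l `|tnth (x i) l|.
have s0 : 0 <= \sum_i \sum_l `|tnth (x i) l| by apply: sumr_ge0 => i _; apply: sumr_ge0.
have K1 : 1 <= K by rewrite /K; lra.
have K0 : 0 < K by apply: lt_le_trans K1.
pose e := h / K; have e0 : 0 < e by rewrite divr_gt0.
have eh : e <= h by rewrite /e ler_pdivrMr // -[leLHS]mulr1 ler_pM2l.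
have eK : e * K = h by rewrite /e divfK // gt_eqF.
have ex (y : R) (z : R) : 0 < z -> exists q : rat, y < ratr q < y + z.
  move=> z0; have [q] := @rat_in_itvoo R y (y + z) (ltac:(lra)).
  by rewrite in_itv /=; exists q.
have /choice[g Hg] : forall b, exists g : 'rV[rat]_p * rat,
   [/\ forall l, l \notin S -> g.1 0 l = 0, forall l, `|ratr (g.1 0 l) - (f b).1 0 l| <= e &
       (f b).2 + h < ratr g.2 < (f b).2 + h + h].
  move=> b; have [c Hc] := ex ((f b).2 + h) h h0.
  have /choice[a Ha] : forall l, exists q : rat, (l \notin S -> q = 0) /\ `|ratr q - (f b).1 0 l| <= e.
    move=> l; have [lS|lS] := boolP (l \in S).
      have [q Hq] := ex ((f b).1 0 l) e e0; exists q; split => //.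
      by rewrite ler_norml; lra.
    by exists 0; split => //; rewrite fS // rmorph0 subrr normr0 ltW.
  by exists (\row_l a l, c); split => //= l; rewrite mxE; have [] := Ha l.
exists g.
have diff b z : `|(affval (map_mx (@ratr R) (g b).1, @ratr R (g b).2) z - @ratr R (g b).2) - (affval (f b) z - (f b).2)|
    <= e * \sum_l `|tnth z l|.
  rewrite /affval /= !addrK /dott -sumrB mulr_sumr; apply: le_trans (ler_norm_sum _ _ _) _.
  apply: ler_sum => l _; rewrite -mulrBl normrM mxE ler_wpM2r //.
  by have [_ + _] := Hg b; apply.
split.
- by move=> b l /=; rewrite mxE => lS; have [-> // _ _] := Hg b; rewrite rmorph0.
- move=> b i f0; have := diff b (x i); rewrite ler_norml => /andP[d1 _].
  have [_ _ /andP[c1 _]] := Hg b.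
  have : e * \sum_l `|tnth (x i) l| <= e * K.
    rewrite ler_pM2l // /K (bigD1 i) //=; rewrite addrCA lerDl.
    by rewrite addr_ge0 // sumr_ge0 // => j _; rewrite sumr_ge0.
  by rewrite eK; lra.
- move=> b z; have := diff b z; rewrite ler_norml => /andP[_ d2].
  have [_ _ /andP[_ c2]] := Hg b.
  have : e * \sum_l `|tnth z l| <= h * \sum_l `|tnth z l|.
    by rewrite ler_wpM2r // sumr_ge0.
  by rewrite mulrDr; lra.
Qed.

(** Continuity from above along h = 1 / (N + 1). *)
Lemma measure_region_le (f : bool * bool -> 'rV[R]_p * R) (a : R) :
  (forall h, 0 < h -> (a%:E <= mu (thick_region f h))%E) ->
  (a%:E <= mu (region f))%E.
Proof.
move=> Ha.
pose G (N : nat) := thick_region f N.+1%:R^-1.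
have s0 (x : p.-tuple R) : 0 <= \sum_l `|tnth x l| by apply: sumr_ge0.
have GE : \bigcap_N G N = region f.
  apply/seteqP; split => [x Gx|x /existsP[b /forallP H] N _]; last first.
    apply/existsP; exists b; apply/forallP => b'; apply: addr_ge0 => //.
    by rewrite mulr_ge0 ?invr_ge0 // addr_ge0.
  apply: contrapT => /negP; rewrite /= /in_region negb_exists => /forallP nx.
  (* Outside the region each of the two conjunctions has a form that is negative by a margin, and
     the slack at x eventually drops below the smaller margin. *)
  have [e e0 He] : exists2 e, 0 < e & forall b, exists b', affval (f (b, b')) x < - e.
    have /existsP[b0 H0] : [exists b', affval (f (false, b')) x < 0].
      by have := nx false; rewrite negb_forall => /existsP[b' H]; apply/existsP; exists b'; rewrite ltNge.
    have /existsP[b1 H1] : [exists b', affval (f (true, b')) x < 0].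
      by have := nx true; rewrite negb_forall => /existsP[b' H]; apply/existsP; exists b'; rewrite ltNge.
    exists (Num.min (- affval (f (false, b0)) x / 2) (- affval (f (true, b1)) x / 2)).
      by rewrite lt_min; apply/andP; split; lra.
    by case; [exists b1|exists b0]; rewrite ltrNr gt_min; apply/orP; [right|left]; lra.
  pose N := Num.truncn ((2 + \sum_l `|tnth x l|) / e).
  have HN : N.+1%:R^-1 * (2 + \sum_l `|tnth x l|) < e.
    rewrite mulrC ltr_pdivrMr // mulrC -ltr_pdivrMr //; exact: truncnS_gt.
  have /existsP[b /forallP H] := Gx N I.
  have [b' Hb'] := He b; have := ltrD Hb' HN; rewrite addNr ltNge.
  by move=> /negP; apply; exact: H.
have mG N : measurable (G N) by exact: measurable_thick_region.
have niG : {homo G : a b / (a <= b)%N >-> (b <= a)%O}.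
  move=> N1 N2 N12; rewrite subsetEset => x /existsP[b /forallP H].
  apply/existsP; exists b; apply/forallP => b'; apply: le_trans (H b') _.
  rewrite lerD2l ler_wpM2r ?addr_ge0 // lef_pV2 ?posrE ?ltr0n // ler_nat ltnS //.
have mI : measurable (\bigcap_N G N) by rewrite GE; exact: measurable_region.
have lty : (mu (G 0%N) < +oo)%E by apply: le_lt_trans (probability_le1 mu (mG 0%N)) _; rewrite ltry.
have cv := nonincreasing_cvg_mu (mu := mu) lty mG mI niG.
rewrite -GE -(cvg_lim (@ereal_hausdorff R) cv); apply: lime_ge; first exact: cvgP cv.
by apply: nearW => N; apply: Ha.
Qed.

Theorem region_uniform_deviation :
  exists2 B : set T, measurable B & ((P (~` B) <= deviation_bound%:E)%E /\
    forall w (f : bool * bool -> 'rV[R]_p * R) (S : {set 'I_p}), B w ->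
      supported S f -> (#|S| <= k)%N ->
      hits f w <= n%:R * (fine (mu (region f)) + t)).
Proof.
pose code : countType := ({ffun bool * bool -> 'rV[rat]_p * rat} * {set 'I_p})%type.
pose rf (q : code) (b : bool * bool) : 'rV[R]_p * R := (map_mx (@ratr R) (q.1 b).1, @ratr R (q.1 b).2).
pose valid (q : code) := (#|q.2| <= k)%N /\ supported q.2 (rf q).
pose c0 : code := ([ffun=> (0, 0)], finset.set0).
have valid0 : valid c0.
  by split => [|b l _]; rewrite /= ?cards0 // /rf /= ffunE /= map_mx0 mxE.
(* Invalid codes are replaced by the zero form with empty support, so that every index gives a
   member of the class. *)
pose fam j : code := if @unpickle code j is Some q then (if pselect (valid q) then q else c0) else c0.
have famP j : valid (fam j) by rewrite /fam; case: unpickle => // q; case: pselect.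
have [B mB [PB HB]] := @countable_class_deviation (rf \o fam) (fun j => (fam j).2)
   (fun j => (famP j).2) (fun j => (famP j).1).
exists B => //; split => // w f S Bw fS Sk.
have [n0|n0] := posnP n.
  have -> : hits f w = 0 by apply: big1 => i _; have := ltn_ord i; rewrite {2}n0.
  by rewrite n0 mul0r.
suff : ((hits f w / n%:R - t)%:E <= mu (region f))%E.
  rewrite -[mu (region f)]fineK ?fin_num_measure //; last exact: measurable_region.
  rewrite lee_fin lerBlDr ler_pdivrMr ?ltr0n // mulrC //.
(* For each h the rational approximant has at least as many hits as [f], and its region lies inside
   the thick region of [f]. It may depend on the sample, because the good event serves all codes at
   once. *)
apply: measure_region_le => h h0.
have [g [gS g1 g2]] := rational_approx (fun i => X i w) fS h0.
pose q : code := (finfun g, S).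
have qg : rf q = (fun b => (map_mx (@ratr R) (g b).1, @ratr R (g b).2)) by apply: funext => b; rewrite /rf /= ffunE.
have vq : valid q by split => //; rewrite qg.
have famq : fam (pickle q) = q by rewrite /fam pickleK; case: pselect.
have := HB w (pickle q) Bw; rewrite /= famq => le.
have hle : hits f w <= hits (rf q) w.
  apply: ler_sum => i _; rewrite ler_nat.
  case E : (in_region f (X i w)) => //; rewrite lt0b /=.
  case/existsP: E => b /forallP H; apply/existsP; exists b; apply/forallP => b'.
  by rewrite qg; apply: g1; exact: H.
have {le hle} le : hits f w / n%:R - t <= fine (mu (region (rf q))).
  by rewrite lerBlDr ler_pdivrMr ?ltr0n // mulrC; exact: le_trans hle le.
apply: (@le_trans _ _ (mu (region (rf q)))).
  by rewrite -[mu _]fineK ?fin_num_measure ?lee_fin //; exact: measurable_region.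
apply: le_measure; rewrite ?inE.
- exact: measurable_region.
- exact: measurable_thick_region.
- move=> x /existsP[b /forallP H]; apply/existsP; exists b; apply/forallP => b'.
  by apply: le_trans (H b') _; rewrite qg; exact: g2.
Qed.

End UniformDeviation.

(** * Signs of Gaussian projections *)

Section TrigonometricPolynomials.
Variable R : realType.

Definition trig (s : seq (R * R * R * R)) (x y : R) : R :=
  \sum_(k <- s) k.1.1.1 * cos (k.1.1.2 * x + k.1.2 * y + k.2).

Definition is_trig (F : R -> R -> R) := exists s, F = trig s.

Lemma is_trigD F G : is_trig F -> is_trig G -> is_trig (fun x y => F x y + G x y).
Proof.
move=> [s ->] [s' ->]; exists (s ++ s'); apply: funext => x; apply: funext => y.
by rewrite /trig big_cat.
Qed.

Lemma is_trigZ c F : is_trig F -> is_trig (fun x y => c * F x y).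
Proof.
move=> [s ->]; exists [seq (c * k.1.1.1, k.1.1.2, k.1.2, k.2) | k <- s].
apply: funext => x; apply: funext => y; rewrite /trig big_map mulr_sumr.
by apply: eq_bigr => k _ /=; rewrite mulrA.
Qed.

Lemma is_trigM F G : is_trig F -> is_trig G -> is_trig (fun x y => F x y * G x y).
Proof.
move=> [s ->] [s' ->].
exists ([seq (k.1.1.1 * l.1.1.1 / 2, k.1.1.2 + l.1.1.2, k.1.2 + l.1.2, k.2 + l.2) | k <- s, l <- s'] ++
        [seq (k.1.1.1 * l.1.1.1 / 2, k.1.1.2 - l.1.1.2, k.1.2 - l.1.2, k.2 - l.2) | k <- s, l <- s']).
apply: funext => x; apply: funext => y; rewrite /trig big_cat /= !big_allpairs_dep /= -big_split /=.
rewrite mulr_suml; apply: eq_bigr => k _; rewrite mulr_sumr -big_split /=; apply: eq_bigr => l _.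
set A := k.1.1.2 * x + k.1.2 * y + k.2; set B := l.1.1.2 * x + l.1.2 * y + l.2.
have -> : (k.1.1.2 + l.1.1.2) * x + (k.1.2 + l.1.2) * y + (k.2 + l.2) = A + B by rewrite /A /B; ring.
have -> : (k.1.1.2 - l.1.1.2) * x + (k.1.2 - l.1.2) * y + (k.2 - l.2) = A - B by rewrite /A /B; ring.
by rewrite (cosD A B) (cosB A B); field.
Qed.

Lemma trig_bounded s x y : `|trig s x y| <= \sum_(k <- s) `|k.1.1.1|.
Proof.
apply: le_trans (ler_norm_sum _ _ _) _; apply: ler_sum => k _.
by rewrite normrM -[leRHS]mulr1 ler_wpM2l // cos_max.
Qed.

Lemma measurable_trig d (T : measurableType d) s (f g : T -> R) :
  measurable_fun [set: T] f -> measurable_fun [set: T] g ->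
  measurable_fun [set: T] (fun x => trig s (f x) (g x)).
Proof.
move=> mf mg; apply: measurable_sum => k; apply: measurable_funM => //.
apply: (measurableT_comp (f := cos)).
  by apply: continuous_measurable_fun; exact: continuous_cos.
apply: measurable_funD => //; apply: measurable_funD; apply: measurable_funM => //.
Qed.

(* Its iterates on [-1, 1] converge to the sign function. *)
Definition sharpen (y : R) : R := (3 * y - y ^+ 3) / 2.

Lemma sharpen_itv y : `|y| <= 1 -> `|sharpen y| <= 1.
Proof.
rewrite !ler_norml /sharpen => /andP[h1 h2].
have : 0 <= (1 - y) ^+ 2 * (2 + y) by rewrite mulr_ge0 ?sqr_ge0 //; lra.
have : 0 <= (1 + y) ^+ 2 * (2 - y) by rewrite mulr_ge0 ?sqr_ge0 //; lra.
by move=> h3 h4; apply/andP; split; lra.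
Qed.

Lemma sharpenN y : sharpen (- y) = - sharpen y.
Proof. by rewrite /sharpen; field. Qed.

Lemma iter_sharpen_itv K y : `|y| <= 1 -> `|iter K sharpen y| <= 1.
Proof. by move=> y1; elim: K => //= K IH; exact: sharpen_itv. Qed.

(** One step multiplies 1 - z by (2 - z - z^2) / 2 <= 1 - z / 2, and z never falls below its
    starting point y. *)
Lemma iter_sharpen_pos K y : 0 < y <= 1 ->
  y <= iter K sharpen y <= 1 /\ 1 - iter K sharpen y <= (1 - y / 2) ^+ K.
Proof.
move=> /andP[y0 y1]; elim: K => [|K [/andP[IH1 IH2] IH3]] /=.
  by rewrite lexx y1 expr0; split => //; lra.
set z := iter K sharpen y in IH1 IH2 IH3 *.
have z0 : 0 < z by lra.
have e : 1 - sharpen z = (1 - z) * ((2 - z - z ^+ 2) / 2) by rewrite /sharpen; field.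
have e2 : 0 <= 1 - sharpen z.
  by rewrite e; apply: mulr_ge0; [lra|nra].
have e3 : z <= sharpen z.
  have -> : sharpen z = z + z * (1 - z ^+ 2) / 2 by rewrite /sharpen; field.
  rewrite lerDl; apply: divr_ge0 => //; apply: mulr_ge0; nra.
split; first by apply/andP; split; lra.
rewrite e [leRHS]exprSr; apply: ler_pM; [lra|nra|exact: IH3|nra].
Qed.

Lemma cvg_iter_sharpen y : `|y| <= 1 -> iter K sharpen y @[K --> \oo] --> Num.sg y.
Proof.
wlog y0 : y / 0 <= y.
  move=> H y1; have [/H/(_ y1)//|yn] := leP 0 y.
  have := H (- y); rewrite oppr_ge0 normrN ltW // => /(_ isT y1) cv.
  rewrite -[y]opprK sgrN.
  have -> : (fun K => iter K sharpen (- - y)) = (fun K => - iter K sharpen (- y)).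
    by apply: funext => K; elim: K => //= K ->; rewrite sharpenN.
  exact: cvgN.
rewrite ger0_norm // => y1.
have [->|yn0] := eqVneq y 0.
  rewrite sgr0; have -> : (fun K => iter K sharpen 0) = cst 0.
    by apply: funext => K; elim: K => //= K ->; rewrite /sharpen mulr0 expr0n subr0 mul0r.
  exact: cvg_cst.
have {y0}y0 : 0 < y by rewrite lt_neqAle eq_sym yn0.
rewrite gtr0_sg //.
have q : geometric 1 (1 - y / 2) n @[n --> \oo] --> (0 : R).
  by apply: cvg_geometric; rewrite ger0_norm; lra.
have lower : (1 - geometric 1 (1 - y / 2) n) @[n --> \oo] --> (1 : R).
  by rewrite -[X in _ --> X](subr0 1); apply: cvgB => //; exact: cvg_cst.
have upper : cst 1 n @[n --> \oo] --> (1 : R) by exact: cvg_cst.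
have sq : \forall n \near \oo, 1 - geometric 1 (1 - y / 2) n <= iter n sharpen y <= cst 1 n.
  apply: nearW => n; rewrite /geometric /= mul1r.
  have [/andP[_ h1] h2] := @iter_sharpen_pos n y (introT andP (conj y0 y1)).
  by rewrite h1 andbT; lra.
exact: (squeeze_cvgr sq lower upper).
Qed.

Lemma is_trig_iter_sharpen K F : is_trig F -> is_trig (fun x y => iter K sharpen (F x y)).
Proof.
move=> tF; elim: K => //= K IH.
have -> : (fun x y => sharpen (iter K sharpen (F x y))) =
  (fun x y => 3 / 2 * iter K sharpen (F x y) + (- 1 / 2) *
       (iter K sharpen (F x y) * (iter K sharpen (F x y) * iter K sharpen (F x y)))).
  by apply: funext => x; apply: funext => y; rewrite /sharpen; field.
by apply: is_trigD; apply: is_trigZ => //; apply: is_trigM => //; apply: is_trigM.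
Qed.

Lemma is_trig_sinl c : is_trig (fun x _ => sin (x * c)).
Proof.
exists [:: (1, c, 0, - (pi / 2))]; apply: funext => x; apply: funext => y.
by rewrite /trig big_seq1 /= mul1r mul0r addr0 cosBpihalf mulrC.
Qed.

Lemma is_trig_sinr c : is_trig (fun _ y => sin (y * c)).
Proof.
exists [:: (1, 0, c, - (pi / 2))]; apply: funext => x; apply: funext => y.
by rewrite /trig big_seq1 /= mul1r mul0r add0r cosBpihalf mulrC.
Qed.

(** The sequence is eventually constant: once x / (n + 1) lies in (-2, 2), the sine has the sign of
    x. *)
Lemma cvg_sg_sin (x : R) : Num.sg (sin (x * n.+1%:R^-1)) @[n --> \oo] --> Num.sg x.
Proof.
apply: cvg_near_cst; near=> n.
have n0 : 0 < n.+1%:R^-1 :> R by rewrite invr_gt0.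
have xn : `|x| * n.+1%:R^-1 < 2.
  rewrite ltr_pdivrMr // -ltr_pdivrMl //; apply: lt_trans (_ : n%:R < _); last by rewrite ltr_nat.
  near: n; exact: nbhs_infty_gtr.
have [x0|x0|->] := ltrgt0P x; last by rewrite mul0r sin0.
  rewrite (gtr0_sg x0) gtr0_sg //; apply: sin2_gt0; rewrite mulr_gt0 //=.
  by rewrite gtr0_norm in xn.
rewrite (ltr0_sg x0) ltr0_sg // -oppr_gt0 -sinN -mulNr; apply: sin2_gt0.
by rewrite mulr_gt0 ?oppr_gt0 //=; rewrite ltr0_norm in xn.
Unshelve. all: by end_near. Qed.

End TrigonometricPolynomials.

Lemma sin_le_id (R : realType) (x : R) : 0 <= x -> sin x <= x.
Proof.
move=> x0; have [c _] := @MVT_segment _ sin cos 0 x x0 (fun y _ => is_derive_sin y)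
   (continuous_subspaceT (@continuous_sin R)).
by rewrite sin0 !subr0 => ->; rewrite -[leRHS]mul1r ler_wpM2r ?cos_le1.
Qed.

Lemma cos_ge_quad (R : realType) (x : R) : 0 <= x <= 2 -> 1 - x ^+ 2 / 2 <= cos x.
Proof.
move=> /andP[x0 x2]; have xh : x = (x / 2) *+ 2 by rewrite mulr2n; field.
have -> : cos x = 1 - 2 * sin (x / 2) ^+ 2 by rewrite {1}xh cos_mulr2n cos2sin2; ring.
have h1 : sin (x / 2) <= x / 2 by apply: sin_le_id; lra.
have h2 : 0 <= sin (x / 2).
  by apply: sin_ge0_pi; have := pi_ge2 R; lra.
have h3 : sin (x / 2) ^+ 2 <= (x / 2) ^+ 2.
  by apply: lerXn2r => //; rewrite nnegrE; lra.
lra.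
Qed.

Section GramForm.
Variables (R : comNzRingType) (p : nat).
Implicit Types (S : 'M[R]_p) (u v w : 'rV[R]_p).

Definition gram S u v : R := (u *m S *m v^T) 0 0.

Lemma gramDl S u v w : gram S (u + v) w = gram S u w + gram S v w.
Proof. by rewrite /gram !mulmxDl mxE. Qed.

Lemma gramDr S u v w : gram S w (u + v) = gram S w u + gram S w v.
Proof. by rewrite /gram linearD mulmxDr mxE. Qed.

Lemma gramZl S c u w : gram S (c *: u) w = c * gram S u w.
Proof. by rewrite /gram -!scalemxAl mxE. Qed.

Lemma gramZr S c u w : gram S w (c *: u) = c * gram S w u.
Proof. by rewrite /gram linearZ -scalemxAr mxE. Qed.

Lemma gramC S : S^T = S -> forall u v, gram S u v = gram S v u.
Proof.
move=> symS u v; rewrite /gram; have -> : v *m S *m u^T = (u *m S *m v^T)^T.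
  by rewrite !trmx_mul trmxK symS mulmxA.
by rewrite [RHS]mxE.
Qed.

End GramForm.

Section GaussianSigns.
Variables (R : realType) (p : nat) (Sigma : 'M[R]_p) (nu : probability (p.-tuple R) R).
Hypothesis symS : Sigma^T = Sigma.
Hypothesis posS : forall u : 'rV[R]_p, u != 0 -> 0 < (u *m Sigma *m u^T) 0 0.
Hypothesis gauss : gaussian Sigma nu.
Implicit Types u v : 'rV[R]_p.

Lemma gram_eq0 u : (gram Sigma u u == 0) = (u == 0).
Proof.
have [->|u0] := eqVneq u 0; first by rewrite /gram !mul0mx mxE eqxx.
by rewrite gt_eqF ?posS.
Qed.

Lemma dottDl u v x : dott (u + v) x = dott u x + dott v x.
Proof. by rewrite /dott -big_split; apply: eq_bigr => i _; rewrite mxE mulrDl. Qed.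

Lemma dottZl c u x : dott (c *: u) x = c * dott u x.
Proof. by rewrite /dott mulr_sumr; apply: eq_bigr => i _; rewrite mxE mulrA. Qed.

Lemma measurable_dott u : measurable_fun [set: p.-tuple R] (dott u).
Proof.
apply: measurable_sum => k; apply: measurable_funM => //; exact: measurable_tnth.
Qed.

Lemma integral_bounded_le d (T : measurableType d) (P : probability T R) (f : T -> R) (C : R) :
  measurable_fun [set: T] f -> (forall x, `|f x| <= C) -> P.-integrable [set: T] (EFin \o f).
Proof.
move=> mf fC; apply: measurable_bounded_integrable => //.
  exact: (le_lt_trans (probability_le1 P measurableT) (ltry 1)).
exists C; split; first exact: num_real.
by move=> y Cy x _; apply: le_trans (fC x) (ltW Cy).
Qed.

(** Both forms have the same law N(0, variance). The zero form is treated apart, as [gaussian]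
    speaks of nonzero directions only. *)
Lemma integral_form_eq (f : R -> R) (C : R) u v : measurable_fun [set: R] f -> (forall x, `|f x| <= C) ->
  gram Sigma u u = gram Sigma v v ->
  (\int[nu]_x (f (dott u x))%:E = \int[nu]_x (f (dott v x))%:E)%E.
Proof.
move=> mf fC uv; have [u0|u0] := eqVneq u 0.
  have v0 : v == 0 by rewrite -gram_eq0 -uv gram_eq0 u0.
  by rewrite u0 (eqP v0).
have v0 : v != 0 by rewrite -gram_eq0 -uv gram_eq0.
have E w : (\int[pushforward nu (dott w)]_y (f y)%:E = \int[nu]_x (f (dott w x))%:E)%E.
  rewrite (integral_pushforward (measurable_dott w)) //; first exact/measurable_EFinP.
  rewrite preimage_setT; apply: (@integral_bounded_le _ _ nu _ C) => //.
  exact: (measurableT_comp mf (measurable_dott w)).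
rewrite -!E; apply: eq_measure_integral; try exact: measurable_dott.
move=> mv mu A mA _.
rewrite /pushforward /=; transitivity (normal_prob 0 (Num.sqrt (gram Sigma u u)) A).
  exact: gauss.
by rewrite uv; symmetry; apply: gauss.
Qed.

Section SameGram.
Variables u1 u2 v1 v2 : 'rV[R]_p.
Hypotheses (g11 : gram Sigma u1 u1 = gram Sigma v1 v1) (g12 : gram Sigma u1 u2 = gram Sigma v1 v2)
  (g22 : gram Sigma u2 u2 = gram Sigma v2 v2).

Let mean (w w' : 'rV[R]_p) (F : R -> R -> R) := (\int[nu]_x (F (dott w x) (dott w' x))%:E)%E.

Let invariant (F : R -> R -> R) :=
  [/\ measurable_fun [set: p.-tuple R] (fun x => F (dott u1 x) (dott u2 x)),
      measurable_fun [set: p.-tuple R] (fun x => F (dott v1 x) (dott v2 x)) &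
      mean u1 u2 F = mean v1 v2 F].

(** Each term is a function of the single form a u1 + b u2, whose variance is determined by the
    three Gram entries. *)
Let invariant_trig s : invariant (trig s).
Proof.
split; [exact: measurable_trig (measurable_dott _) (measurable_dott _) ..|].
elim: s => [|[[[e a] b] c] s IH].
  rewrite /mean /trig; under eq_integral do rewrite big_nil.
  by under [in RHS]eq_integral do rewrite big_nil.
have mc w : measurable_fun [set: p.-tuple R] (fun x => e * cos (dott w x + c)).
  apply: measurable_funM => //; apply: (measurableT_comp (f := cos)).
    by apply: continuous_measurable_fun; exact: continuous_cos.
  by apply: measurable_funD => //; exact: measurable_dott.
have bc x : `|e * cos (x + c)| <= `|e| by rewrite normrM -[leRHS]mulr1 ler_wpM2l // cos_max.
have E w w' : mean w w' (trig ((e, a, b, c) :: s)) =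
    (\int[nu]_x (e * cos (dott (a *: w + b *: w') x + c))%:E + mean w w' (trig s))%E.
  rewrite /mean -integralD //.
  - by apply: eq_integral => x _; rewrite /trig big_cons /= dottDl !dottZl EFinD.
  - by apply: (@integral_bounded_le _ _ nu _ `|e|) => //; exact: mc.
  - apply: (@integral_bounded_le _ _ nu _ (\sum_(k <- s) `|k.1.1.1|)).
      exact: measurable_trig (measurable_dott _) (measurable_dott _).
    by move=> x; exact: trig_bounded.
rewrite (E u1 u2) (E v1 v2) IH; congr (_ + _)%E.
apply: (@integral_form_eq (fun y => e * cos (y + c)) `|e|) => //.
  apply: measurable_funM => //; apply: (measurableT_comp (f := cos)).
    by apply: continuous_measurable_fun; exact: continuous_cos.
  by apply: measurable_funD.
by rewrite !(gramDl, gramDr, gramZl, gramZr) (gramC symS u2) (gramC symS v2) g11 g12 g22.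
Qed.

Let invariant_lim (F_ : nat -> R -> R -> R) F :
  (forall n, invariant (F_ n)) -> (forall n x y, `|F_ n x y| <= 1) ->
  (forall x y, F_ n x y @[n --> \oo] --> F x y) -> invariant F.
Proof.
move=> iF bF cF.
have mF w w' : (forall n, measurable_fun [set: p.-tuple R] (fun x => F_ n (dott w x) (dott w' x))) ->
    measurable_fun [set: p.-tuple R] (fun x => F (dott w x) (dott w' x)).
  by move=> H; apply: (measurable_fun_cvg H) => x _; exact: cF.
have mu1 := mF u1 u2 (fun n => let: And3 h _ _ := iF n in h).
have mv1 := mF v1 v2 (fun n => let: And3 _ h _ := iF n in h).
split => //.
have cvg w w' : (forall n, measurable_fun [set: p.-tuple R] (fun x => F_ n (dott w x) (dott w' x))) ->
    mean w w' (F_ n) @[n --> \oo] --> mean w w' F.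
  move=> H.
  have [] := @dominated_convergence _ _ R nu [set: p.-tuple R] measurableT
    (fun n x => (F_ n (dott w x) (dott w' x))%:E) (fun x => (F (dott w x) (dott w' x))%:E) (cst 1%E) => //.
  - by move=> n; exact/measurable_EFinP.
  - by apply/measurable_EFinP; exact: mF.
  - by apply: aeW => x _; apply: cvg_EFin; [exact: nearW | exact: cF].
  - by apply: finite_measure_integrable_cst.
  - by apply: aeW => x n _; rewrite abse_EFin lee_fin.
have cu := cvg u1 u2 (fun n => let: And3 h _ _ := iF n in h).
have cv := cvg v1 v2 (fun n => let: And3 _ h _ := iF n in h).
have E : (fun n => mean u1 u2 (F_ n)) = (fun n => mean v1 v2 (F_ n)).
  by apply: funext => n; case: (iF n).
rewrite E in cu; exact: cvg_unique cu cv.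
Qed.

Lemma mean_sg_invariant :
  (\int[nu]_x (Num.sg (dott u1 x) * Num.sg (dott u2 x))%:E =
   \int[nu]_x (Num.sg (dott v1 x) * Num.sg (dott v2 x))%:E)%E.
Proof.
suff [] : invariant (fun s t => Num.sg s * Num.sg t) by [].
(* Two nested limits: for fixed n the iterates of [sharpen] turn the sine into its sign, and then n
   tends to infinity. Every stage is bounded by 1, so dominated convergence applies. *)
apply: (invariant_lim (F_ := fun n s t => Num.sg (sin (s * n.+1%:R^-1)) * Num.sg (sin (t * n.+1%:R^-1)))).
- move=> n.
  apply: (invariant_lim (F_ := fun K s t =>
     iter K (@sharpen R) (sin (s * n.+1%:R^-1)) * iter K (@sharpen R) (sin (t * n.+1%:R^-1)))).
  + move=> K.
    have [s ->] : is_trig (fun s t : R => iter K (@sharpen R) (sin (s * n.+1%:R^-1)) * iter K (@sharpen R) (sin (t * n.+1%:R^-1))).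
      by apply: is_trigM; apply: is_trig_iter_sharpen; [exact: is_trig_sinl|exact: is_trig_sinr].
    exact: invariant_trig.
  + by move=> K s t; rewrite normrM mulr_ile1 ?iter_sharpen_itv ?sin_max.
  + by move=> s t; apply: cvgM; apply: cvg_iter_sharpen; exact: sin_max.
- move=> n s t; by rewrite normrM mulr_ile1 // normr_sg lern1 leq_b1.
- by move=> s t; apply: cvgM; exact: cvg_sg_sin.
Qed.

End SameGram.

Lemma dott_null u : u != 0 -> nu [set x | dott u x = 0] = 0%E.
Proof.
move=> u0; rewrite (gauss u0 (A := [set 0])) //.
by rewrite /normal_prob integral_set1.
Qed.

Definition neg_prob u v : R := fine (nu [set x | dott u x * dott v x < 0]).

Lemma measurable_neg u v : measurable [set x : p.-tuple R | dott u x * dott v x < 0].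
Proof.
have m : measurable_fun [set: p.-tuple R] (fun x => dott u x * dott v x).
  by apply: measurable_funM; exact: measurable_dott.
have := m measurableT _ (measurable_itv `]-oo, (0 : R)[); rewrite setTI.
by congr measurable; apply/seteqP; split => x /=; rewrite in_itv.
Qed.

Lemma neg_probE u v : nu [set x | dott u x * dott v x < 0] = (neg_prob u v)%:E.
Proof. by rewrite /neg_prob fineK // fin_num_measure //; exact: measurable_neg. Qed.

Lemma neg_probNE u v : nu [set x | 0 < dott u x * dott v x] = (neg_prob (- u) v)%:E.
Proof.
rewrite -neg_probE; congr (nu _); apply/seteqP; split => x /=;
by rewrite -scaleN1r dottZl mulN1r mulNr oppr_lt0.
Qed.

Lemma neg_prob_sum u v : u != 0 -> v != 0 -> neg_prob u v + neg_prob (- u) v = 1.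
Proof.
move=> u0 v0; apply: EFin_inj; rewrite EFinD -neg_probE -neg_probNE.
have mp : measurable [set x : p.-tuple R | 0 < dott u x * dott v x].
  have := measurable_neg (- u) v; congr measurable; apply/seteqP; split => x /=;
  by rewrite -scaleN1r dottZl mulN1r mulNr oppr_lt0.
have mu0 (w : 'rV[R]_p) : measurable [set x : p.-tuple R | dott w x = 0].
  have := measurable_dott w measurableT (measurable_set1 0); rewrite setTI.
  by congr measurable; apply/seteqP; split.
rewrite -measureU //; last 2 first.
- exact: measurable_neg.
- by apply/seteqP; split => x //= [h1 h2]; have := lt_trans h1 h2; rewrite ltxx.
set AB := _ `|` _; pose Z := [set x : p.-tuple R | dott u x = 0] `|` [set x | dott v x = 0].
have mAB : measurable AB by apply: measurableU => //; exact: measurable_neg.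
have mZ : measurable Z by exact: measurableU.
have nZ : nu Z = 0%E by apply: null_set_setU => //; exact: dott_null.
transitivity (nu (AB `|` Z)); first by symmetry; exact: measureU0.
rewrite -[RHS](@probability_setT _ _ _ nu); congr (nu _); apply/seteqP; split => // x _ /=.
have [h|h|/eqP] := ltrgt0P (dott u x * dott v x); [by left; right|by left; left|].
by rewrite mulf_eq0 => /orP[/eqP h|/eqP h]; right; [left|right].
Qed.

Lemma mean_sgE u v : u != 0 -> v != 0 ->
  (\int[nu]_x (Num.sg (dott u x) * Num.sg (dott v x))%:E = (1 - 2 * neg_prob u v)%:E)%E.
Proof.
move=> u0 v0.
have mp : measurable [set x : p.-tuple R | 0 < dott u x * dott v x].
  have := measurable_neg (- u) v; congr measurable; apply/seteqP; split => x /=;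
  by rewrite -scaleN1r dottZl mulN1r mulNr oppr_lt0.
have mn := measurable_neg u v.
pose A := [set x : p.-tuple R | 0 < dott u x * dott v x].
pose B := [set x : p.-tuple R | dott u x * dott v x < 0].
have -> : (\int[nu]_x (Num.sg (dott u x) * Num.sg (dott v x))%:E =
           \int[nu]_x ((\1_A x)%:E - (\1_B x)%:E))%E.
  apply: eq_integral => x _; rewrite -EFinB -sgrM; congr EFin.
  rewrite !indicE; have [h|h|h] := ltrgt0P (dott u x * dott v x).
  - by rewrite gtr0_sg // mem_set // memNset ?subr0 //= => h'; have := lt_trans h h'; rewrite ltxx.
  - by rewrite ltr0_sg // memNset ?mem_set ?sub0r //= => h'; have := lt_trans h h'; rewrite ltxx.
  - by rewrite h sgr0 !memNset ?subrr // /A /B /= h ltxx.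
rewrite integralB //.
- transitivity (nu A - nu B)%E; first by rewrite !integral_indic // !setIT.
  have -> : nu A = (neg_prob (- u) v)%:E by exact: neg_probNE.
  have -> : nu B = (neg_prob u v)%:E by exact: neg_probE.
  by rewrite -EFinB; congr EFin; have := neg_prob_sum u0 v0; lra.
- apply: (@integral_bounded_le _ _ nu (\1_A) 1) => // x.
  by rewrite indicE ger0_norm // lern1 leq_b1.
- apply: (@integral_bounded_le _ _ nu (\1_B) 1) => // x.
  by rewrite indicE ger0_norm // lern1 leq_b1.
Qed.

Lemma neg_prob_gram u1 u2 v1 v2 : u1 != 0 -> u2 != 0 ->
  gram Sigma u1 u1 = gram Sigma v1 v1 -> gram Sigma u1 u2 = gram Sigma v1 v2 -> gram Sigma u2 u2 = gram Sigma v2 v2 ->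
  neg_prob u1 u2 = neg_prob v1 v2.
Proof.
move=> u10 u20 g11 g12 g22.
have v10 : v1 != 0 by rewrite -gram_eq0 -g11 gram_eq0.
have v20 : v2 != 0 by rewrite -gram_eq0 -g22 gram_eq0.
have := mean_sg_invariant g11 g12 g22; rewrite !mean_sgE // => -[].
by lra.
Qed.

(** For orthogonal forms, replacing u by - u preserves the Gram matrix, so both signs of the product
    are equally likely. *)
Lemma neg_prob_orth u v : u != 0 -> v != 0 -> gram Sigma u v = 0 -> neg_prob u v = 1 / 2.
Proof.
move=> u0 v0 uv; have := neg_prob_sum u0 v0.
rewrite -(@neg_prob_gram u v (- u) v) //; first by lra.
- by rewrite -scaleN1r gramZl gramZr; ring.
- by rewrite -scaleN1r gramZl uv mulr0.
Qed.

(* The directions at angles 0, pi/N, ..., pi form a chain from [e2] to [- e2], along which the sign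
   must change; by rotation invariance all the links have the same probability of a sign change. *)
Lemma neg_prob_rotation (e1 e2 : 'rV[R]_p) (N : nat) : (0 < N)%N ->
  gram Sigma e1 e1 = 1 -> gram Sigma e2 e2 = 1 -> gram Sigma e1 e2 = 0 ->
  N.+1%:R^-1 <= neg_prob e2 (cos (pi / N%:R) *: e2 - sin (pi / N%:R) *: e1).
Proof.
move=> N0 g11 g22 g12; pose a : R := pi / N%:R.
pose l (k : nat) := cos (a * k%:R) *: e2 - sin (a * k%:R) *: e1.
have gl j k : gram Sigma (l j) (l k) = cos (a * j%:R - a * k%:R).
  rewrite /l cosB -!scaleNr !(gramDl, gramDr, gramZl, gramZr) (gramC symS e2) g11 g22 g12; ring.
have l0 k : l k != 0 by rewrite -gram_eq0 gl subrr cos0 oner_eq0.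
have step k : neg_prob (l k) (l k.+1) = neg_prob e2 (cos a *: e2 - sin a *: e1).
  have E2 : e2 = l 0%N by rewrite /l mulr0 cos0 sin0 scale1r scale0r subr0.
  have E1 : cos a *: e2 - sin a *: e1 = l 1%N by rewrite /l mulr1.
  rewrite {1}E2 E1; apply: neg_prob_gram => //; rewrite !gl ?subrr //.
  by rewrite -!mulrBr -natr1; congr (cos (a * _)); ring.
have lN : l N = - e2.
  by rewrite /l /a divfK ?pnatr_eq0 -?lt0n // cospi sinpi scaleN1r scale0r subr0.
have lE0 : l 0%N = e2 by rewrite /l mulr0 cos0 sin0 scale1r scale0r subr0.
pose A k : set (p.-tuple R) := [set x | dott (l k) x * dott (l k.+1) x < 0].
pose Z k : set (p.-tuple R) := [set x | dott (l k) x = 0].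
have mA k : measurable (A k) by exact: measurable_neg.
have mZ k : measurable (Z k).
  have := measurable_dott (l k) measurableT (measurable_set1 0); rewrite setTI.
  by congr measurable; apply/seteqP; split.
(* Off these sets no [l k] vanishes for k <= N and the sign never changes, contradicting [l N] = -
   [l 0]. The index runs up to N included so that [l N] is known to be nonzero too, whence N + 1 in
   the bound. *)
have cover : setT `<=` \bigcup_(k in [set: 'I_N.+1]) (A k `|` Z k).
  move=> x _; apply: contrapT => nx.
  have nAZ k : (k <= N)%N -> 0 <= dott (l k) x * dott (l k.+1) x /\ dott (l k) x != 0.
    move=> kN; split.
      rewrite leNgt; apply/negP => h; apply: nx; exists (Ordinal (kN : (k < N.+1)%N)) => //; by left.
    apply/eqP => h; apply: nx; exists (Ordinal (kN : (k < N.+1)%N)) => //; by right.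
  have same k : (k <= N)%N -> 0 < dott (l 0%N) x * dott (l k) x.
    elim: k => [_|k IH kN].
      by rewrite -expr2 exprn_even_gt0 //=; have [_] := nAZ 0%N isT.
    have {}IH := IH (ltnW kN); have [h1 h2] := nAZ k (ltnW kN); have [_ h3] := nAZ k.+1 kN.
    have h4 : 0 < dott (l k) x * dott (l k.+1) x by rewrite lt_neqAle h1 andbT eq_sym mulf_neq0.
    have : 0 < (dott (l 0%N) x * dott (l k) x) * (dott (l k) x * dott (l k.+1) x) by exact: mulr_gt0.
    have -> : (dott (l 0%N) x * dott (l k) x) * (dott (l k) x * dott (l k.+1) x) =
      dott (l k) x ^+ 2 * (dott (l 0%N) x * dott (l k.+1) x) by ring.
    by rewrite pmulr_rgt0 // exprn_even_gt0.
  have := same N (leqnn N); rewrite lN lE0 -scaleN1r dottZl mulN1r mulrN -expr2 oppr_gt0.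
  by rewrite ltNge sqr_ge0.
have : (nu setT <= \sum_(k \in [set: 'I_N.+1]) nu (A k `|` Z k))%E.
  apply: content_sub_fsum => //; first exact: finite_finset.
  by move=> k _; exact: measurableU.
rewrite (@fsbigE _ _ _ _ _ (index_enum 'I_N.+1)) ?index_enum_uniq //; last first.
  by move=> i _; rewrite mem_index_enum.
rewrite (eq_bigl xpredT); last by move=> i; rewrite in_setT.
rewrite (eq_bigr (fun=> (neg_prob e2 (cos a *: e2 - sin a *: e1))%:E)); last first.
  move=> k _; rewrite -(step k) -neg_probE; apply: measureU0 => //; exact: dott_null.
rewrite sumEFin sumr_const card_ord probability_setT lee_fin => h.
by rewrite -(@ler_pM2l _ N.+1%:R) ?ltr0n // mulfV ?pnatr_eq0 // mulr_natl.
Qed.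

Definition nonneg_prob u v : R := fine (nu [set x | 0 <= dott u x * dott v x]).

Lemma nonneg_probE u v : nonneg_prob u v = 1 - neg_prob u v.
Proof.
have mn := measurable_neg u v.
have E : [set x : p.-tuple R | 0 <= dott u x * dott v x] = ~` [set x | dott u x * dott v x < 0].
  by apply/seteqP; split => x /=; rewrite leNgt => /negP.
by rewrite /nonneg_prob E probability_setC // neg_probE -EFinB.
Qed.

(* Inside {0 <= a.x b.x}, of probability 1/2, the event {0 <= a.x (b - a).x} misses the wedge where b.x
   is small compared with a.x; this wedge has at least the angle pi/N in the normalized coordinates. *)
Lemma nonneg_prob_shift (a b : 'rV[R]_p) (N : nat) : (8 <= N)%N ->
  a != 0 -> b != 0 -> gram Sigma a b = 0 ->
  8 / N%:R * Num.sqrt (gram Sigma b b) <= Num.sqrt (gram Sigma a a) ->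
  nonneg_prob a (b - a) <= 1 / 2 - N.+1%:R^-1.
Proof.
move=> N3 a0 b0 ab hN.
have N0 : 0 < N%:R :> R by rewrite ltr0n; exact: leq_trans N3.
have gp w : w != 0 -> 0 < gram Sigma w w by move=> w0; exact: posS.
set va := Num.sqrt (gram Sigma a a) in hN; set vb := Num.sqrt (gram Sigma b b) in hN.
have va0 : 0 < va by rewrite sqrtr_gt0 gp.
have vb0 : 0 < vb by rewrite sqrtr_gt0 gp.
have sa : gram Sigma a a = va ^+ 2 by rewrite sqr_sqrtr // ltW // gp.
have sb : gram Sigma b b = vb ^+ 2 by rewrite sqr_sqrtr // ltW // gp.
pose e1 := va^-1 *: a; pose e2 := vb^-1 *: b.
have g11 : gram Sigma e1 e1 = 1 by rewrite gramZl gramZr sa; field; rewrite gt_eqF.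
have g22 : gram Sigma e2 e2 = 1 by rewrite gramZl gramZr sb; field; rewrite gt_eqF.
have g12 : gram Sigma e1 e2 = 0 by rewrite gramZl gramZr ab !mulr0.
pose psi : R := pi / N%:R.
have psi0 : 0 <= psi by rewrite divr_ge0 ?pi_ge0.
have pi4 : pi <= 4 :> R by have := @pihalf_lt2 R; lra.
have psi1 : psi <= 1 / 2.
  rewrite /psi ler_pdivrMr //; have : (8 : R) <= N%:R by rewrite (ler_nat _ 8).
  by lra.
have cosge : 1 / 2 <= cos psi.
  have : 1 - psi ^+ 2 / 2 <= cos psi by apply: cos_ge_quad; lra.
  nra.
have sinle : sin psi <= 4 / N%:R.
  apply: le_trans (sin_le_id psi0) _; rewrite /psi ler_pM2r ?invr_gt0 //.
have singe : 0 <= sin psi by apply: sin_ge0_pi; have := pi_ge2 R; lra.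
have := @neg_prob_rotation e1 e2 N (leq_trans (isT : (0 < 8)%N) N3) g11 g22 g12.
rewrite -/psi; set l := cos psi *: e2 - sin psi *: e1 => hl.
(* Here sin psi <= pi / N <= 4 / N and cos psi >= 1 / 2, which explains the 8 / N in the
   hypothesis. *)
have kappa : sin psi * vb <= cos psi * va.
  have : sin psi * vb <= 4 / N%:R * vb by rewrite ler_wpM2r // ltW.
  have : 1 / 2 * va <= cos psi * va by rewrite ler_wpM2r // ltW.
  lra.
(* The event and the wedge are disjoint subsets of {0 <= a.x b.x}. *)
suff : nonneg_prob a (b - a) + neg_prob e2 l <= nonneg_prob a b.
  rewrite [nonneg_prob a b]nonneg_probE (neg_prob_orth a0 b0 ab).
  by move: hl; move: N.+1%:R^-1 (neg_prob e2 l) (nonneg_prob _ _) => r y z; lra.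
rewrite -lee_fin EFinD -neg_probE.
have mn (u v : 'rV[R]_p) : measurable [set x : p.-tuple R | 0 <= dott u x * dott v x].
  have := measurableC (measurable_neg u v); congr measurable.
  by apply/seteqP; split => x /=; rewrite leNgt => /negP.
have nE (u v : 'rV[R]_p) : (nonneg_prob u v)%:E = nu [set x | 0 <= dott u x * dott v x].
  by rewrite /nonneg_prob fineK // fin_num_measure.
have wedge x : dott e2 x * dott l x < 0 ->
    cos psi * va * dott b x ^+ 2 < sin psi * vb * (dott a x * dott b x).
  rewrite /l /e1 /e2 -scaleNr dottDl !dottZl => h.
  have : vb ^+ 2 * va * (vb^-1 * dott b x *
     (cos psi * (vb^-1 * dott b x) + - sin psi * (va^-1 * dott a x))) < 0.
    by rewrite pmulr_rlt0 // mulr_gt0 // exprn_gt0.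
  have -> : vb ^+ 2 * va * (vb^-1 * dott b x *
     (cos psi * (vb^-1 * dott b x) + - sin psi * (va^-1 * dott a x))) =
     cos psi * va * dott b x ^+ 2 - sin psi * vb * (dott a x * dott b x).
    by field; rewrite !gt_eqF.
  by rewrite subr_lt0.
have s0 : 0 <= sin psi * vb by rewrite mulr_ge0 // ltW.
have shift x : 0 <= dott a x * dott (b - a) x -> dott a x ^+ 2 <= dott a x * dott b x.
  rewrite -[- a]scaleN1r dottDl dottZl; lra.
rewrite !nE -measureU //; last 2 first.
- exact: measurable_neg.
(* On the intersection (a.x)^2 <= a.x b.x and (b.x)^2 < a.x b.x, so (a.x - b.x)^2 would be
   negative. *)
- apply/seteqP; split => x //= [/shift h1 /wedge h2].
  have k0 : 0 < cos psi * va by rewrite mulr_gt0 //; lra.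
  have ab0 : 0 <= dott a x * dott b x by apply: le_trans h1; exact: sqr_ge0.
  have h3 : sin psi * vb * (dott a x * dott b x) <= cos psi * va * (dott a x * dott b x).
    by rewrite ler_wpM2r.
  have : dott b x ^+ 2 < dott a x * dott b x.
    by rewrite -(ltr_pM2l k0); exact: lt_le_trans h2 h3.
  have := sqr_ge0 (dott a x - dott b x); rewrite sqrrB; lra.
apply: le_measure; rewrite ?inE //.
- by apply: measurableU => //; exact: measurable_neg.
move=> x /= [/shift h|/wedge h]; first by apply: le_trans h; exact: sqr_ge0.
rewrite leNgt; apply/negP => n0.
have : sin psi * vb * (dott a x * dott b x) <= 0 by rewrite mulr_ge0_le0 // ltW.
have : 0 <= cos psi * va * dott b x ^+ 2.
  by rewrite mulr_ge0 ?sqr_ge0 // mulr_ge0 ?(ltW va0) //; lra.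
lra.
Qed.

End GaussianSigns.

(** * Eigenvalue bounds for the precision matrix *)

Lemma continuous_sumr (R : realType) (T : topologicalType) (I : Type) (r : seq I) (F : I -> T -> R) :
  (forall i, continuous (F i)) -> continuous (fun x => \sum_(i <- r) F i x).
Proof.
move=> cF; elim: r => [|i r IH].
  by under eq_fun do rewrite big_nil; exact: cst_continuous.
by under eq_fun do rewrite big_cons; move=> x; apply: cvgD; [exact: cF|exact: IH].
Qed.

Lemma continuous_mulr (R : realType) (T : topologicalType) (f g : T -> R) :
  continuous f -> continuous g -> continuous (fun x => f x * g x).
Proof. by move=> cf cg x; apply: cvgM; [exact: cf|exact: cg]. Qed.

Section Rayleigh.
Variables (R : realType) (p : nat).
Implicit Types (S : 'M[R]_p) (u v w : 'rV[R]_p).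

Definition sqnorm u : R := \sum_l u 0 l ^+ 2.

Lemma sqnorm_ge0 u : 0 <= sqnorm u.
Proof. by apply: sumr_ge0 => l _; exact: sqr_ge0. Qed.

Lemma sqnorm_eq0 u : (sqnorm u == 0) = (u == 0).
Proof.
apply/eqP/eqP => [/eqP|->]; last by apply: big1 => l _; rewrite mxE expr0n.
rewrite psumr_eq0; last by move=> l _; exact: sqr_ge0.
move/allP => H; apply/rowP => l; apply/eqP.
by have := H l (mem_index_enum _); rewrite sqrf_eq0 mxE.
Qed.

Lemma gram1 u : gram 1%:M u u = sqnorm u.
Proof. by rewrite /gram mulmx1 mxE; apply: eq_bigr => l _; rewrite mxE expr2. Qed.

(** A null vector minimizes the form, so the first-order term in every coordinate direction must
    vanish. *)
Lemma psd_kernel S u : S^T = S -> (forall v, 0 <= gram S v v) -> gram S u u = 0 -> u *m S = 0.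
Proof.
move=> symS psd u0; apply/rowP => l; rewrite [RHS]mxE; apply/eqP.
pose w : 'rV[R]_p := delta_mx 0 l.
have wE : gram S u w = (u *m S) 0 l.
  rewrite /gram trmx_delta mxE (bigD1 l) //= big1 ?addr0; first by rewrite [delta_mx _ _ _ _]mxE !eqxx mulr1.
  by move=> i il; rewrite [delta_mx _ _ _ _]mxE (negPf il) mulr0.
rewrite -wE; set b := gram S u w.
have c0 := psd w; set c := gram S w w in c0.
(* Nearly the minimizer - b / c of t -> 2 t b + t^2 c; the shift by 1 avoids dividing by 0 and still
   makes the value negative unless b = 0. *)
pose t := - b / (c + 1).
have := psd (u + t *: w).
rewrite !(gramDl, gramDr, gramZl, gramZr) u0 (gramC symS w u) -/b -/c add0r => h.
have c1 : c + 1 != 0 by rewrite gt_eqF // ltr_wpDl.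
have e : t * b + t * b + t * (t * c) = - (b ^+ 2 * (c + 2)) / (c + 1) ^+ 2 by rewrite /t; field.
have {}h : 0 <= - (b ^+ 2 * (c + 2)) / (c + 1) ^+ 2 by rewrite -e; lra.
have c2 : 0 < (c + 1) ^+ 2 by rewrite exprn_gt0 // ltr_wpDl.
rewrite mulNr oppr_ge0 pmulr_lle0 ?invr_gt0 // pmulr_lle0 in h; last by lra.
by rewrite -sqrf_eq0 eq_le h sqr_ge0.
Qed.

(** Rayleigh's principle without diagonalization: a maximizer v of the form on the unit sphere, with
    value lam, is a null vector of the positive semidefinite matrix lam I - S, hence an
    eigenvector. *)
Lemma gram_eigenvalue_le S (M : R) : S^T = S -> (forall a, eigenvalue S a -> a <= M) ->
  forall u, gram S u u <= M * sqnorm u.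
Proof.
move=> symS HM u.
have [->|u0] := eqVneq u 0.
  by rewrite /gram !mul0mx mxE (eqP (_ : sqnorm 0 == 0)) ?mulr0 ?sqnorm_eq0.
pose A : set 'rV[R]_p := [set v | sqnorm v = 1].
have nz v : v != 0 -> 0 < sqnorm v by move=> v0; rewrite lt_neqAle sqnorm_ge0 andbT eq_sym sqnorm_eq0.
have unit v : v != 0 -> A ((Num.sqrt (sqnorm v))^-1 *: v).
  move=> v0; rewrite /A /= -gram1 gramZl gramZr gram1 mulrA -expr2 exprVn sqr_sqrtr ?sqnorm_ge0 //.
  by rewrite mulVf // gt_eqF // nz.
have cc l : continuous (fun v : 'rV[R]_p => v 0 l) by exact: coord_continuous.
have csq : continuous (sqnorm : 'rV[R]_p -> R).
  have -> : (sqnorm : 'rV[R]_p -> R) = (fun v => \sum_l v 0 l * v 0 l).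
    by apply: funext => v; apply: eq_bigr => l _; rewrite expr2.
  by apply: continuous_sumr => l; apply: continuous_mulr; exact: cc.
have cq : continuous (fun v => gram S v v).
  have -> : (fun v => gram S v v) = (fun v : 'rV[R]_p => \sum_j \sum_i v 0 i * S i j * v 0 j).
    apply: funext => v; rewrite /gram mxE; apply: eq_bigr => j _.
    by rewrite mxE mulr_suml; apply: eq_bigr => i _; rewrite mxE.
  apply: continuous_sumr => j; apply: continuous_sumr => i.
  by apply: continuous_mulr; [apply: continuous_mulr; [exact: cc|exact: cst_continuous]|exact: cc].
have cA : compact A.
  apply: (subclosed_compact (B := [set v : 'rV[R]_p | forall i, `[-1, 1]%classic (v ord0 i)])).
  - have -> : A = sqnorm @^-1` [set 1] by [].
    by apply: preimage_closed => //; exact: closed_eq.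
  - by apply: (@rV_compact R p (fun=> `[-1, 1]%classic)) => i; exact: segment_compact.
  - move=> v /= v1 i; rewrite in_itv /= -ler_norml -(@ler_sqr _ _ 1) ?nnegrE // expr1n real_normK ?num_real //.
    by rewrite -v1 /sqnorm (bigD1 i) //= lerDl sumr_ge0 // => l _; exact: sqr_ge0.
have A0 : A !=set0 by exists ((Num.sqrt (sqnorm u))^-1 *: u); exact: unit.
have [v vA vmax] := @compact_EVT_max _ R _ A A0 cA (continuous_subspaceT cq).
rewrite inE in vA; pose lam := gram S v v.
have v0 : v != 0 by rewrite -sqnorm_eq0 vA oner_eq0.
have bound w : gram S w w <= lam * sqnorm w.
  have [->|w0] := eqVneq w 0.
    by rewrite /gram !mul0mx mxE (eqP (_ : sqnorm 0 == 0)) ?mulr0 ?sqnorm_eq0.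
  have := vmax _ (mem_set (unit w w0)).
  rewrite gramZl gramZr mulrA -expr2 exprVn sqr_sqrtr ?sqnorm_ge0 //.
  by rewrite -ler_pdivrMr ?nz // mulrC.
have TE w z : gram (lam *: 1%:M - S) w z = lam * gram 1%:M w z - gram S w z.
  by rewrite /gram mulmxBr mulmxBl -scalemxAr -scalemxAl !mxE.
have vT : v *m (lam *: 1%:M - S) = 0.
  apply: psd_kernel.
  - by rewrite linearB linearZ /= trmx1 symS.
  - by move=> w; rewrite TE gram1 subr_ge0.
  - by rewrite TE gram1 vA mulr1 subrr.
have eig : eigenvalue S lam.
  apply/eigenvalueP; exists v => //; apply/eqP; rewrite -subr_eq0 -opprB oppr_eq0.
  by rewrite -vT mulmxBr -scalemxAr mulmx1.
by apply: le_trans (bound u) _; rewrite ler_wpM2r ?sqnorm_ge0 // HM.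
Qed.

Lemma gram_eigenvalue_ge S (M : R) : S^T = S -> (forall a, eigenvalue S a -> M <= a) ->
  forall u, M * sqnorm u <= gram S u u.
Proof.
move=> symS HM u.
have := @gram_eigenvalue_le (- S) (- M) _ _ u.
rewrite /gram mulmxN mulNmx mxE mulNr lerN2; apply; first by rewrite linearN /= symS.
move=> a /eigenvalueP[v vS v0]; rewrite lerNr; apply: HM; apply/eigenvalueP; exists v => //.
by rewrite scaleNr -vS mulmxN opprK.
Qed.

End Rayleigh.

Section PrecisionMatrix.
Variables (R : realType) (p : nat) (Om : 'M[R]_p) (M : R).
Hypotheses (M1 : 1 <= M) (symO : Om^T = Om).
Hypothesis eigO : forall a, eigenvalue Om a -> M^-1 <= a <= M.
Local Notation S := (invmx Om).

Let M0 : 0 < M. Proof. exact: lt_le_trans M1. Qed.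

Lemma precision_unit : Om \in unitmx.
Proof.
rewrite -row_free_unit -kermx_eq0; apply/eqP/row_matrixP => i; rewrite row0; apply/eqP.
set v := row i _; have vO : v *m Om = 0 by rewrite -row_mul mulmx_ker row0.
rewrite -sqnorm_eq0 eq_le sqnorm_ge0 andbT.
have := @gram_eigenvalue_ge _ _ Om M^-1 symO (fun a h => proj1 (andP (eigO h))) v.
by rewrite /gram vO mul0mx mxE pmulr_rle0 ?invr_gt0.
Qed.

Lemma covariance_sym : S^T = S.
Proof. by rewrite trmx_inv symO. Qed.

Lemma covariance_eigen a : eigenvalue S a -> M^-1 <= a <= M.
Proof.
move=> /eigenvalueP[v vS v0].
have vE : v = a *: (v *m Om) by rewrite scalemxAl -vS mulmxKV // precision_unit.
have a0 : a != 0 by apply: contra_neq v0 => a0; rewrite vE a0 scale0r.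
have /andP[h1 h2] : M^-1 <= a^-1 <= M.
  apply: eigO; apply/eigenvalueP; exists v => //.
  by rewrite {2}vE scalerA mulVf // scale1r.
have ai0 : 0 < a^-1 by apply: lt_le_trans h1; rewrite invr_gt0.
have ap : 0 < a by rewrite -invr_gt0.
apply/andP; split; first by rewrite -(invrK a) lef_pV2 ?posrE.
by rewrite -(invrK a) -(invrK M) lef_pV2 ?posrE ?invr_gt0.
Qed.

Lemma covariance_ge u : M^-1 * sqnorm u <= gram S u u.
Proof.
by apply: (gram_eigenvalue_ge covariance_sym) => a /covariance_eigen /andP[].
Qed.

Lemma covariance_pos u : u != 0 -> 0 < gram S u u.
Proof.
move=> u0; apply: lt_le_trans (covariance_ge u); rewrite mulr_gt0 ?invr_gt0 //.
by rewrite lt_neqAle sqnorm_ge0 andbT eq_sym sqnorm_eq0.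
Qed.

Lemma precision_diag j : M^-1 <= Om j j <= M.
Proof.
have e1 : sqnorm (delta_mx 0 j : 'rV[R]_p) = 1.
  rewrite /sqnorm (bigD1 j) //= big1 ?addr0; first by rewrite mxE !eqxx expr1n.
  by move=> i ij; rewrite mxE (negPf ij) andbF expr0n.
have eO : gram Om (delta_mx 0 j) (delta_mx 0 j) = Om j j.
  by rewrite /gram trmx_delta -rowE -colE !mxE.
have h1 := @gram_eigenvalue_ge _ _ Om M^-1 symO (fun a h => proj1 (andP (eigO h))) (delta_mx 0 j).
have h2 := @gram_eigenvalue_le _ _ Om M symO (fun a h => proj2 (andP (eigO h))) (delta_mx 0 j).
rewrite eO e1 mulr1 in h1; rewrite eO e1 mulr1 in h2; by rewrite h1 h2.
Qed.

(** The residual X_j - beta . X_{-j} as a linear form: coefficient 1 at j, and - beta elsewhere. *)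
Definition regression_row j : 'rV[R]_p := (Om j j)^-1 *: row j Om.

(** It contains both facts used about the residual: it is uncorrelated with every form vanishing at
    j, and its variance is 1 / Omega_jj. *)
Lemma gram_regression_row j u : gram S (regression_row j) u = u 0 j / Om j j.
Proof.
rewrite gramZl /gram -row_mul mulmxV ?precision_unit // mulrC; congr (_ * _).
by rewrite row1 -rowE !mxE.
Qed.

Lemma sqnorm_row j : sqnorm (row j Om) <= M ^+ 2.
Proof.
have h := covariance_ge (row j Om).
have E : gram S (row j Om) (row j Om) = Om j j.
  by rewrite /gram -row_mul mulmxV ?precision_unit // row1 -rowE !mxE.
rewrite E ler_pdivrMl // in h.
have /andP[_ h2] := precision_diag j.
by apply: le_trans h _; rewrite expr2 ler_pM2l.
Qed.

End PrecisionMatrix.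

(** * The median of the absolute value of a standard normal variable *)

Section StandardNormal.
Variable R : realType.
Local Notation mu := (normal_prob (0 : R) 1).
Implicit Types (a b q x : R).

Lemma std_normal_oppr (A : set R) : measurable A -> mu (-%R @^-1` A) = mu A.
Proof.
move=> mA; have mf : measurable_fun [set: R] (fun x : R => (normal_pdf 0 1 x)%:E).
  by apply/measurable_EFinP; exact: measurable_normal_pdf.
symmetry; transitivity (\int[pushforward (@lebesgue_measure R) (-%R : R -> measurableTypeR R)]_(y in A)
    (normal_pdf 0 1 y)%:E)%E.
  by apply: eq_measure_integral => //= B mB _; exact/esym/lebesgue_measureN.
rewrite ge0_integral_pushforward //=.
- apply: eq_integral => x _ /=; congr EFin.
  by rewrite /normal_pdf oner_eq0 /normal_fun !subr0 sqrrN.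
- exact: measurable_funS mf.
- by move=> y _; rewrite lee_fin normal_pdf_ge0.
Qed.

Lemma std_normal_fin (A : set R) : measurable A -> mu A = (fine (mu A))%:E.
Proof. by move=> mA; rewrite fineK // fin_num_measure. Qed.

(** On [-K, K] the density is at least its value at K. *)
Lemma std_normal_itv_ge (K : R) : exists2 c : R, 0 < c &
  forall a b, - K <= a -> a <= b -> b <= K -> c * (b - a) <= fine (mu `]a, b[%classic).
Proof.
exists (normal_pdf 0 1 K).
  rewrite lt_neqAle normal_pdf_ge0 andbT eq_sym /normal_pdf oner_eq0.
  by rewrite gt_eqF // mulr_gt0 ?expR_gt0 // normal_peak_gt0 // oner_eq0.
move=> a b Ka ab bK; rewrite -lee_fin -std_normal_fin //.
apply: (@le_trans _ _ (\int[lebesgue_measure]_(x in `]a, b[) (normal_pdf 0 1 K)%:E)%E).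
  rewrite integral_cst //= lebesgue_measure_itv /= lte_fin.
  case: ltP => [_|ba]; first by rewrite -EFinB -EFinM.
  have -> : b = a by apply/le_anti/andP.
  by rewrite subrr mulr0 mule0.
apply: ge0_le_integral => //.
- by move=> x _; rewrite lee_fin normal_pdf_ge0.
- by apply/measurable_EFinP; apply: measurable_funTS; exact: measurable_normal_pdf.
- move=> x /=; rewrite in_itv /= => /andP[ax xb].
  rewrite lee_fin /normal_pdf oner_eq0 ler_wpM2l ?normal_peak_ge0 // /normal_fun ler_expR !subr0.
  rewrite expr1n; have : x ^+ 2 <= K ^+ 2; nra.
Qed.

Lemma std_normal_set1 a : mu [set a] = 0%E.
Proof. by rewrite /normal_prob integral_set1. Qed.

Let muC (A : set R) : measurable A -> mu (~` A) = (1 - mu A)%E.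
Proof. exact: (@probability_setC _ _ R (normal_prob (0 : R) 1)). Qed.

Let muU (A B : set R) : measurable A -> measurable B -> A `&` B = set0 ->
  mu (A `|` B) = (mu A + mu B)%E.
Proof. exact: (@measureU _ _ _ (normal_prob (0 : R) 1)). Qed.

Let muS (A B : set R) : measurable A -> measurable B -> A `<=` B -> (mu A <= mu B)%E.
Proof. by move=> mA mB; apply: (@le_measure _ _ _ (normal_prob (0 : R) 1)); rewrite inE. Qed.

Variable q : R.
Hypothesis hq : Phi q = 3 / 4.

Lemma std_normal_tails :
  [/\ mu `]q, +oo[%classic = (1 / 4)%:E, mu `]-oo, - q[%classic = (1 / 4)%:E,
      mu `[q, +oo[%classic = (1 / 4)%:E & mu `]-oo, - q]%classic = (1 / 4)%:E].
Proof.
have h1 : mu `]q, +oo[%classic = (1 / 4)%:E.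
  have -> : `]q, +oo[%classic = ~` `]-oo, q]%classic.
    by apply/seteqP; split => x /=; rewrite !in_itv /= andbT; [move=> h; apply/negP|move/negP]; rewrite -ltNge.
  rewrite muC // std_normal_fin // -/(Phi q) hq -EFinB; congr EFin; lra.
have h3 : mu `[q, +oo[%classic = (1 / 4)%:E.
  have -> : `[q, +oo[%classic = ([set q] `|` `]q, +oo[)%classic.
    apply/seteqP; split => x /=; rewrite !in_itv /= !andbT.
      by rewrite le_eqVlt => /orP[/eqP ->|]; [left|right].
    by case=> [->|/ltW].
  rewrite muU //; first by rewrite h1 std_normal_set1 add0e.
  by apply/seteqP; split => x //= [->]; rewrite in_itv /= ltxx.
split => //.
- rewrite -h1 -[RHS]std_normal_oppr //; congr (mu _); apply/seteqP; split => x /=; rewrite !in_itv /= ?andbT; lra.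
- rewrite -h3 -[RHS]std_normal_oppr //; congr (mu _); apply/seteqP; split => x /=; rewrite !in_itv /= ?andbT; lra.
Qed.

Lemma quantile_gt0 : 0 < q.
Proof.
rewrite ltNge; apply/negP => q0; have [_ _ _ h] := std_normal_tails.
have : `]-oo, q]%classic `<=` `]-oo, - q]%classic by move=> x /=; rewrite !in_itv /=; lra.
move/(muS (measurable_itv _) (measurable_itv _)).
by rewrite h std_normal_fin // -/(Phi q) hq lee_fin; lra.
Qed.

(** At a = q both events have probability 1/2, so under the two hypotheses the interval between a
    and q has mass at most rho; a lower bound on the density converts this into a length. *)
Lemma std_normal_median : exists2 c : R, 0 < c & forall (a rho : R), 0 <= a -> rho < c ->
   1 / 2 - rho <= fine (mu [set y | `|y| <= a]) ->
   1 / 2 - rho <= fine (mu [set y | a <= `|y|]) -> `|a - q| <= rho / c.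
Proof.
have q0 := quantile_gt0; have [t1 t2 t3 t4] := std_normal_tails.
have [c c0 Hc] := std_normal_itv_ge (q + 1).
exists c => // a rho a0 rc.
have mle (z : R) : measurable [set y : R | `|y| <= z].
  by have := measurable_itv `[- z, z]; congr measurable; apply/seteqP; split => x /=; rewrite in_itv /= ler_norml.
have mge (z : R) : measurable [set y : R | z <= `|y|].
  have := measurableC (measurable_itv `](- z), z[); congr measurable; apply/seteqP; split => x /=;
  by rewrite in_itv /= -ltr_norml leNgt => /negP.
have mleq : mu [set y | `|y| <= q] = (1 / 2)%:E.
  have -> : [set y : R | `|y| <= q] = ~` (`]-oo, - q[ `|` `]q, +oo[)%classic.
    apply/seteqP; split => x /=; rewrite !in_itv /= ?andbT ler_norml.
      by move=> /andP[h1 h2] [h|h]; lra.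
    by move=> h; apply/andP; split; rewrite leNgt; apply/negP => h'; apply: h; [left|right].
  rewrite muC; last exact: measurableU.
  rewrite muU //; last first.
    by apply/seteqP; split => x //= []; rewrite !in_itv /=; lra.
  rewrite t1 t2; have -> : ((1 / 4 : R)%:E + (1 / 4 : R)%:E = (1 / 2)%:E)%E by rewrite -EFinD; congr EFin; lra.
  by rewrite -EFinB; congr EFin; lra.
have mgeq : mu [set y | q <= `|y|] = (1 / 2)%:E.
  have -> : [set y : R | q <= `|y|] = (`]-oo, - q] `|` `[q, +oo[)%classic.
    apply/seteqP; split => x /=; rewrite !in_itv /= ?andbT ler_normr.
      by move=> /orP[h|h]; [right|left]; lra.
    by move=> [h|h]; apply/orP; [right|left]; lra.
  rewrite muU //; last first.
    by apply/seteqP; split => x //= []; rewrite !in_itv /=; lra.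
  by rewrite t3 t4 -EFinD; congr EFin; lra.
move=> H1 H2; rewrite ler_pdivlMr //.
have [aq|qa] := leP a q.
  rewrite ler0_norm ?subr_le0 // opprB mulrC.
  have h := Hc a q (ltac:(lra)) aq (ltac:(lra)).
  set A := [set y : R | `|y| <= a] in H1 *; pose B : set R := `]a, q[%classic.
  have mA : measurable A by exact: mle.
  have mB : measurable B by exact: measurable_itv.
  have : (mu A + mu B <= (1 / 2)%:E)%E.
    rewrite -mleq -muU //; last first.
      apply/seteqP; split => x //; rewrite /A /B /= in_itv /= ler_norml => -[]; lra.
    apply: muS => //; first exact: measurableU.
    by move=> x; rewrite /A /B /= in_itv /= !ler_norml => -[]; lra.
  rewrite (@std_normal_fin A) // (@std_normal_fin B) // -EFinD lee_fin /B; lra.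
rewrite gtr0_norm ?subr_gt0 // mulrC.
(* The density bound is available only up to q + 1. If a lay beyond, the interval ]q, q + 1[ would
   already have mass at least c > rho. *)
pose b := Num.min a (q + 1).
have ba : b <= a by rewrite ge_min lexx.
have bq1 : b <= q + 1 by rewrite ge_min lexx orbT.
have qb : q <= b by rewrite le_min (ltW qa) /=; lra.
have h := Hc q b (ltac:(lra)) qb bq1.
set A := [set y : R | a <= `|y|] in H2 *; pose B : set R := `]q, b[%classic.
have mA : measurable A by exact: mge.
have mB : measurable B by exact: measurable_itv.
have : (mu A + mu B <= (1 / 2)%:E)%E.
  rewrite -mgeq -muU //; last first.
    apply/seteqP; split => x //; rewrite /A /B /= in_itv /= => -[h1 /andP[h2 h3]].
    by move: h1; rewrite ger0_norm; lra.
  apply: muS => //; first exact: measurableU.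
  move=> x; rewrite /A /B /= in_itv /= => -[]; first by move=> h1; apply: le_trans h1; exact: ltW.
  by move=> /andP[h2 h3]; rewrite ger0_norm; lra.
rewrite (@std_normal_fin A) // (@std_normal_fin B) // -EFinD lee_fin /B => h'.
have {}h : c * (b - q) <= rho by lra.
suff ab : b = a by rewrite -ab.
rewrite /b; apply/min_idPl; rewrite leNgt; apply/negP => aq1.
have bE : b = q + 1 by apply/min_idPr; exact: ltW.
by move: h; rewrite bE; nra.
Qed.

End StandardNormal.

(** * Error of one column *)

Lemma sqr_sum_le (R : realFieldType) (I : finType) (A : {set I}) (x : I -> R) :
  (\sum_(i in A) x i) ^+ 2 <= #|A|%:R * \sum_(i in A) x i ^+ 2.
Proof.
have [A0|A0] := posnP #|A|.
  by rewrite (cards0_eq A0) !big_set0 expr0n /= mulr0.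
set s := \sum_(i in A) x i; pose c := s / #|A|%:R.
have n0 : 0 < #|A|%:R :> R by rewrite ltr0n.
have : \sum_(i in A) (2 * c * x i - c ^+ 2) <= \sum_(i in A) x i ^+ 2.
  by apply: ler_sum => i _; have := sqr_ge0 (x i - c); lra.
have -> : \sum_(i in A) (2 * c * x i - c ^+ 2) = s ^+ 2 / #|A|%:R.
  rewrite sumrB -mulr_sumr sumr_const -/s -[_ *+ #|_|]mulr_natl /c; field.
  by rewrite gt_eqF.
by rewrite ler_pdivrMr // mulrC.
Qed.

Section Encoding.
Variables (R : realType) (p : nat).
Implicit Types (u v : 'rV[R]_p) (x : p.-tuple R) (j : 'I_p).

Definition supp u : {set 'I_p} := [set l | u 0 l != 0]%SET.

Lemma notin_supp u l : l \notin supp u -> u 0 l = 0.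
Proof. by rewrite inE negbK => /eqP. Qed.

Lemma l1_le_sqnorm (u : 'rV[R]_p) (k : nat) : (#|supp u| <= k)%N ->
  (\sum_l `|u 0 l|) ^+ 2 <= k%:R * sqnorm u.
Proof.
move=> uk.
have -> : \sum_l `|u 0 l| = \sum_(l in supp u) `|u 0 l|.
  rewrite (bigID (mem (supp u))) /= [X in _ + X]big1 ?addr0 // => l lS.
  by rewrite notin_supp ?normr0.
apply: le_trans (sqr_sum_le _ _) _; apply: ler_pM => //; first by apply: sumr_ge0 => l _; exact: sqr_ge0.
  by rewrite ler_nat.
have -> : \sum_(l in supp u) `|u 0 l| ^+ 2 = \sum_(l in supp u) u 0 l ^+ 2.
  by apply: eq_bigr => l _; rewrite real_normK ?num_real.
rewrite /sqnorm [leRHS](bigID (mem (supp u))) /= lerDl.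
by apply: sumr_ge0 => l _; exact: sqr_ge0.
Qed.

(** Regression vectors omit coordinate j; inserting a 0 there makes them forms on the whole space,
    comparable with [regression_row]. *)
Definition emb j (b : 'rV[R]_p.-1) : 'rV[R]_p := \row_i (if unlift j i is Some l then b 0 l else 0).

Lemma emb_lift j b l : emb j b 0 (lift j l) = b 0 l.
Proof. by rewrite mxE liftK. Qed.

Lemma emb_diag j b : emb j b 0 j = 0.
Proof. by rewrite mxE unlift_none. Qed.

Definition others j x : 'rV[R]_p.-1 := \row_(l < p.-1) tnth x (lift j l).

Lemma dott_emb j b x : dott (emb j b) x = dotv b (others j x).
Proof.
rewrite /dott (bigD1_ord j) //= emb_diag mul0r add0r; apply: eq_bigr => l _.
by rewrite emb_lift mxE.
Qed.

Lemma emb_eq0 j b : (emb j b == 0) = (b == 0).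
Proof.
apply/eqP/eqP => [/rowP H|->].
  by apply/rowP => l; have := H (lift j l); rewrite emb_lift !mxE.
by apply/rowP => i; rewrite !mxE; case: unlift => // l; rewrite mxE.
Qed.

Lemma embB j b b' : emb j (b - b') = emb j b - emb j b'.
Proof. by apply/rowP => i; rewrite !mxE; case: unlift => [l|]; rewrite ?mxE ?subr0. Qed.

Lemma card_supp_emb j b : (#|supp (emb j b)| = #|[pred l : 'I_p.-1 | b ord0 l != 0%R]|)%N.
Proof.
rewrite -(fintype.card_image (@lift_inj p j)); apply: eq_card => i; rewrite inE mxE.
apply/idP/fintype.imageP => [|[l lb ->]]; last by rewrite liftK.
by case: unliftP => [l ->|->]; rewrite ?eqxx // => bl; exists l.
Qed.

(** The first bit is the common sign of the two factors, the second selects the factor. *)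
Definition prod_code u v (b : bool * bool) : 'rV[R]_p * R :=
  ((-1) ^+ b.1 *: (if b.2 then u else v), 0).

Lemma affvalE (f : 'rV[R]_p * R) x : affval f x = dott f.1 x + f.2. Proof. by []. Qed.

Lemma in_region_prod u v x : in_region (prod_code u v) x = (0 <= dott u x * dott v x).
Proof.
have E b : affval (prod_code u v b) x = (-1) ^+ b.1 * dott (if b.2 then u else v) x.
  by rewrite affvalE addr0 dottZl.
apply/existsP/idP => [[b /forallP H]|H].
  have := H true; have := H false; rewrite !E /=; case: (b) => /=.
    by rewrite expr1 !mulN1r !oppr_ge0 => h1 h2; exact: mulr_le0.
  by rewrite expr0 !mul1r => h1 h2; exact: mulr_ge0.
have [u0|u0|u0] := ltrgt0P (dott u x).
- exists false; apply/forallP => -[]; rewrite E /= mul1r; [exact: ltW|].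
  by move: H; rewrite pmulr_rge0.
- exists true; apply/forallP => -[]; rewrite E /= expr1 mulN1r oppr_ge0; [exact: ltW|].
  by move: H; rewrite nmulr_rge0.
- have [v0|v0] := leP 0 (dott v x).
    by exists false; apply/forallP => -[]; rewrite E /= mul1r ?u0.
  exists true; apply/forallP => -[]; rewrite E /= expr1 mulN1r oppr_ge0 ?u0 //; exact: ltW.
Qed.

Lemma supported_prod u v (S : {set 'I_p}) : supp u \subset S -> supp v \subset S ->
  supported S (prod_code u v).
Proof.
move=> /fintype.subsetP uS /fintype.subsetP vS b l lS; rewrite mxE.
by case: (b.2); rewrite notin_supp ?mulr0 //; apply: contra lS; do [exact: uS | exact: vS].
Qed.

(** The sign is indexed by the conjunction, since both one-sided bounds are required; the two
    alternatives of the disjunction coincide. *)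
Definition inner_code v (a : R) (b : bool * bool) : 'rV[R]_p * R := ((-1) ^+ b.2 *: v, a).

Lemma in_region_inner v a x : in_region (inner_code v a) x = (`|dott v x| <= a).
Proof.
have E b : affval (inner_code v a b) x = (-1) ^+ b.2 * dott v x + a by rewrite affvalE dottZl.
rewrite ler_norml; apply/existsP/idP => [[b /forallP H]|/andP[h1 h2]].
  by have := H true; have := H false; rewrite !E /= expr1 expr0; lra.
by exists true; apply/forallP => -[]; rewrite E /= ?expr1 ?expr0; lra.
Qed.

Lemma supported_inner v a (S : {set 'I_p}) : supp v \subset S -> supported S (inner_code v a).
Proof.
by move=> /fintype.subsetP vS b l lS; rewrite mxE notin_supp ?mulr0 //; apply: contra lS => /vS.
Qed.

(** The sign is indexed by the disjunction here, and the two conjuncts coincide. *)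
Definition outer_code v (a : R) (b : bool * bool) : 'rV[R]_p * R := ((-1) ^+ b.1 *: v, - a).

Lemma in_region_outer v a x : in_region (outer_code v a) x = (a <= `|dott v x|).
Proof.
have E b : affval (outer_code v a b) x = (-1) ^+ b.1 * dott v x - a by rewrite affvalE dottZl.
rewrite ler_normr; apply/existsP/idP => [[b /forallP H]|/orP[h|h]].
- by have := H true; rewrite E /=; case: (b); rewrite /= ?expr1 ?expr0 => h; apply/orP; [right|left]; lra.
- by exists false; apply/forallP => b'; rewrite E /= expr0; lra.
- by exists true; apply/forallP => b'; rewrite E /= expr1; lra.
Qed.

Lemma supported_outer v a (S : {set 'I_p}) : supp v \subset S -> supported S (outer_code v a).
Proof.
by move=> /fintype.subsetP vS b l lS; rewrite mxE notin_supp ?mulr0 //; apply: contra lS => /vS.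
Qed.

Variable Om : 'M[R]_p.

Definition coef j : 'rV[R]_p.-1 := \row_l (- (Om j (lift j l) / Om j j)).

Lemma rowBE u v l : (u - v) 0 l = u 0 l - v 0 l.
Proof. by rewrite !mxE. Qed.

Lemma dottB u v x : dott (u - v) x = dott u x - dott v x.
Proof. by rewrite dottDl -[- v]scaleN1r dottZl mulN1r. Qed.

Lemma residual_dott j b x : Om j j != 0 ->
  tnth x j - dotv b (others j x) = dott (regression_row Om j - emb j (b - coef j)) x.
Proof.
move=> Oj; rewrite embB !dottB -(dott_emb j b).
suff : tnth x j = dott (regression_row Om j) x + dott (emb j (coef j)) x by lra.
rewrite /dott -big_split /= (bigD1_ord j) //= emb_diag mul0r addr0.
rewrite [regression_row Om j 0 j]mxE [row j Om 0 j]mxE mulVf // mul1r big1 ?addr0 // => l _.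
rewrite emb_lift [regression_row Om j 0 _]mxE [row j Om 0 _]mxE [coef j 0 l]mxE.
by rewrite -mulrDl [_^-1 * _]mulrC subrr mul0r.
Qed.

End Encoding.

(** Used with o = Omega_jj and z the ratio of the rescaled median to the true residual variance 1 /
    o. *)
Lemma inv_close (R : realFieldType) (o z k : R) : 0 < o -> `|z - 1| <= k -> k <= 1 / 2 ->
  `|(z / o)^-1 - o| <= 2 * k * o /\ 0 <= (z / o)^-1 <= 2 * o.
Proof.
move=> o0; rewrite ler_norml => /andP[h1 h2] k2.
have z2 : 1 / 2 <= z by lra.
have z0 : 0 < z by lra.
have zi : z^-1 <= 2 by rewrite invf_ple ?posrE //; lra.
have zi0 : 0 < z^-1 by rewrite invr_gt0.
have -> : (z / o)^-1 = z^-1 * o by field; rewrite !gt_eqF.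
split; last by rewrite mulr_ge0 ?(ltW zi0) ?(ltW o0) //= ler_pM2r.
have -> : z^-1 * o - o = (z^-1 * (1 - z)) * o by field; rewrite gt_eqF.
rewrite normrM (gtr0_norm o0) ler_pM2r // normrM gtr0_norm //.
by apply: ler_pM => //; rewrite ?(ltW zi0) // ler_norml; lra.
Qed.

(** w is the relative excess variance caused by the error in beta, and d is the relative error of
    the scale read off the median. *)
Lemma scale_close (R : realFieldType) (w d e r : R) : 0 <= w <= r -> r <= 1 -> `|d| <= e -> e <= 1 / 2 ->
  `|(1 + w) * (1 + d) ^+ 2 - 1| <= 6 * e + r.
Proof.
move=> /andP[w0 wr] r1 de e2.
have d2 : `|2 * d + d ^+ 2| <= 3 * e.
  have -> : 2 * d + d ^+ 2 = d * (2 + d) by ring.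
  rewrite normrM mulrC; apply: ler_pM => //.
  by move: de; rewrite !ler_norml; lra.
have -> : (1 + w) * (1 + d) ^+ 2 - 1 = (1 + w) * (2 * d + d ^+ 2) + w by ring.
apply: le_trans (ler_normD _ _) _; rewrite normrM (ger0_norm w0) (@ger0_norm _ (1 + w)); last by lra.
apply: lerD => //; have e0 : 0 <= e by exact: le_trans de.
by apply: le_trans (ler_pM _ _ (_ : 1 + w <= 2) d2) _ => //; lra.
Qed.

Section Column.
Variables (R : realType) (p s m : nat) (M rho : R) (Om : 'M[R]_p) (nu : probability (p.-tuple R) R).
Hypotheses (M1 : 1 <= M) (symO : Om^T = Om) (eigO : forall a, eigenvalue Om a -> M^-1 <= a <= M).
Hypothesis sparseO : forall i : 'I_p, (#|[pred j : 'I_p | Om i j != 0%R]| <= s)%N.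
Hypothesis gauss : gaussian (invmx Om) nu.
Hypotheses (m0 : (0 < m)%N) (rho0 : 0 <= rho) (rho1 : rho <= 1 / 40).

(** The good event seen from one sample. All that follows for a column is deterministic once both
    halves satisfy it. *)
Definition deviates (x : 'I_m -> p.-tuple R) := forall (f : bool * bool -> 'rV[R]_p * R) (S : {set 'I_p}),
  supported S f -> (#|S| <= minn (4 * s) p)%N ->
  \sum_k (in_region f (x k))%:R <= m%:R * (fine (nu (region f)) + rho).

Variable j : 'I_p.
Local Notation S := (invmx Om).
Local Notation beta := (coef Om j).
Local Notation xi := (regression_row Om j).

Let symS := covariance_sym symO.
Let posS : forall u : 'rV[R]_p, u != 0 -> 0 < (u *m S *m u^T) 0 0.
Proof. by move=> u u0; exact: (covariance_pos M1 symO eigO u0). Qed.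

Let Ojj0 : 0 < Om j j.
Proof.
have /andP[h _] := precision_diag symO eigO j; apply: lt_le_trans h.
by rewrite invr_gt0; exact: lt_le_trans M1.
Qed.

Let xi_diag : xi 0 j = 1.
Proof. by rewrite 2!mxE mulVf // gt_eqF. Qed.

Let xi0 : xi != 0.
Proof. by apply: contra_neq (@oner_neq0 R) => x0; rewrite -xi_diag x0 mxE. Qed.

Let gram_xi u : gram S xi u = u 0 j / Om j j.
Proof. exact: (gram_regression_row M1 symO eigO). Qed.

Let gram_xi_emb b : gram S xi (emb j b) = 0.
Proof. by rewrite gram_xi emb_diag mul0r. Qed.

Let card_supp_xi : (#|supp xi| <= s)%N.
Proof.
apply: leq_trans (sparseO j); apply: subset_leq_card; apply/fintype.subsetP => l.
by rewrite !inE 2!mxE; apply: contraNN => /eqP ->; rewrite mulr0.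
Qed.

Lemma card_supp_le (A B : {set 'I_p}) (a b : nat) : (#|A| <= a)%N -> (#|B| <= b)%N ->
  (a + b <= 4 * s)%N -> (#|A :|: B| <= minn (4 * s) p)%N.
Proof.
move=> Aa Bb ab; rewrite leq_min -[X in (_ && (_ <= X))%N](card_ord p) max_card andbT.
by apply: leq_trans ab; apply: leq_trans (leq_add Aa Bb); rewrite cardsU leq_subr.
Qed.

Lemma prod_deviation (x : 'I_m -> p.-tuple R) u v (A : {set 'I_p}) : deviates x ->
  supp u \subset A -> supp v \subset A -> (#|A| <= minn (4 * s) p)%N ->
  #|[pred k : 'I_m | 0 <= dott u (x k) * dott v (x k)]|%:R <= m%:R * (nonneg_prob nu u v + rho).
Proof.
move=> dev uA vA cA; have := dev _ _ (supported_prod uA vA) cA.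
have -> : region (prod_code u v) = [set x | 0 <= dott u x * dott v x].
  by apply/seteqP; split => y; rewrite /region /= in_region_prod.
congr (_ <= _); rewrite -sum1_card natr_sum [RHS]big_mkcond /=; apply: eq_bigr => k _.
by rewrite in_region_prod inE; case: ifP.
Qed.

(* If beta = 0, which [Theta] excludes, it is replaced by a multiple of a basis vector that is too
   small to flip the sign of any residual of the sample. *)
Lemma depth_ge (x : 'I_m -> p.-tuple R) (bh : 'rV[R]_p.-1) : deviates x -> Theta s bh ->
  (forall b, Theta s b ->
     depth (Theta (s.*2)) b (fun k => others j (x k)) (fun k => tnth (x k) j) <=
     depth (Theta (s.*2)) bh (fun k => others j (x k)) (fun k => tnth (x k) j)) ->
  1 / 2 - rho <= depth (Theta (s.*2)) bh (fun k => others j (x k)) (fun k => tnth (x k) j).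
Proof.
move=> dev [bh0 bhs] hmax.
have s0 : (0 < s)%N.
  have [s0|//] := posnP s; move: bhs; rewrite s0 leqn0 => /eqP/card0_eq H.
  by case/eqP: bh0; apply/rowP => l; have := H l; rewrite !inE mxE => /negbFE/eqP.
have mp : 0 < m%:R :> R by rewrite ltr0n.
(* It is enough to find an admissible b whose residuals keep the sign of the true ones at every
   sample point. *)
suff [b tb Hb] : exists2 b, Theta s b & forall k a, 0 < a * dott xi (x k) ->
    0 <= a * (tnth (x k) j - dotv b (others j (x k))).
  apply: le_trans (hmax b tb); apply: lb_le_inf.
    exists ((m%:R)^-1 * #|[pred k : 'I_m | 0 <= dotv bh (others j (x k)) *
       (tnth (x k) j - dotv b (others j (x k)))]|%:R); exists bh => //.
    by split => //; apply: leq_trans bhs _; rewrite -addnn leq_addr.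
  move=> _ [u [u0 us] <-].
  (* The one-sided bound is applied to - u: the sample points with (- u).X xi >= 0 number at most m
     (1/2 + rho), and at all the others u.X xi > 0. *)
  have Euv := @neg_prob_orth _ _ _ _ symS posS gauss (- emb j u) xi.
  have nu0 : - emb j u != 0 by rewrite oppr_eq0 emb_eq0.
  have orth : gram S (- emb j u) xi = 0.
    by rewrite gramC // -scaleN1r gramZr // gram_xi_emb mulr0.
  have {}Euv := Euv nu0 xi0 orth.
  have npE : nonneg_prob nu (- emb j u) xi = 1 / 2 by rewrite nonneg_probE Euv; lra.
  have sN : supp (- emb j u) \subset supp (emb j u) :|: supp xi.
    by apply/fintype.subsetP => l; rewrite !inE mxE oppr_eq0 => ->.
  have cS : (#|supp (emb j u) :|: supp xi| <= minn (4 * s) p)%N.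
    apply: (@card_supp_le _ _ s.*2 s) => //; first by rewrite card_supp_emb.
    by rewrite -mul2n -mulSnr leq_mul2r orbT.
  have := prod_deviation dev sN (finset.subsetUr _ _) cS; rewrite npE => h.
  rewrite [leRHS]mulrC ler_pdivlMr //.
  pose A := [pred k : 'I_m | 0 <= dott (- emb j u) (x k) * dott xi (x k)].
  pose B := [pred k : 'I_m | 0 <= dotv u (others j (x k)) * (tnth (x k) j - dotv b (others j (x k)))].
  have : (#|predC A| <= #|B|)%N.
    apply: subset_leq_card; apply/fintype.subsetP => k; rewrite !inE -ltNge => hk.
    by apply: Hb; rewrite -dott_emb; move: hk; rewrite -scaleN1r dottZl mulN1r mulNr oppr_lt0.
  rewrite -(ler_nat R); apply: le_trans.
  have : #|A|%:R + #|predC A|%:R = m%:R :> R by rewrite -natrD cardC card_ord.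
  rewrite -/A in h; lra.
have [beta0|beta0] := eqVneq beta 0; last first.
  exists beta.
    split => //; rewrite -(card_supp_emb j); apply: leq_trans card_supp_xi.
    apply: subset_leq_card; apply/fintype.subsetP => i; rewrite !inE mxE.
    case: unliftP => [l ->|->]; last by rewrite eqxx.
    by rewrite !mxE oppr_eq0 mulrC.
  move=> k a; rewrite (@residual_dott _ _ Om j _ _ (lt0r_neq0 Ojj0)) subrr.
  have -> : emb j (0 : 'rV[R]_p.-1) = 0 by apply/eqP; rewrite emb_eq0.
  by rewrite subr0 => /ltW.
have [l _] : exists l : 'I_p.-1, bh 0 l != 0.
  by apply/existsP; apply: contraNT bh0; rewrite negb_exists => /forallP H;
     apply/eqP/rowP => l; rewrite mxE; apply/eqP; have := H l; rewrite negbK.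
pose w k := dott xi (x k); pose z k := others j (x k) 0 l.
(* K exceeds |z k| / |w k| whenever [w k] is nonzero, so the perturbation z / K stays below the
   residual in absolute value; terms with [w k] = 0 are 0 by convention. *)
pose K : R := 1 + \sum_k (1 + `|z k|) / `|w k|.
have K0 k : 0 <= (1 + `|z k|) / `|w k| by rewrite divr_ge0 // addr_ge0.
have K1 : 0 < K by rewrite ltr_pwDl // sumr_ge0.
have wE k : tnth (x k) j = w k.
  have := @residual_dott _ _ Om j 0 (x k) (lt0r_neq0 Ojj0).
  rewrite beta0 subrr; have -> : emb j (0 : 'rV[R]_p.-1) = 0 by apply/eqP; rewrite emb_eq0.
  rewrite subr0 /w => <-.
  by rewrite /dotv big1 ?subr0 // => i _; rewrite mxE mul0r.
exists (K^-1 *: delta_mx 0 l).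
  split.
    apply/eqP => /rowP/(_ l); rewrite !mxE !eqxx mulr1 => /eqP.
    by rewrite invr_eq0 gt_eqF.
  apply: leq_trans s0; apply: (@leq_trans #|pred1 l|); last by rewrite card1.
  apply: subset_leq_card; apply/fintype.subsetP => i.
  by rewrite !inE !mxE eqxx /= mulf_eq0 negb_or => /andP[_]; case: (i == l) => //=; rewrite eqxx.
move=> k a ha; rewrite wE; set D := dotv _ _.
have DE : D = K^-1 * z k.
  rewrite /D /dotv (bigD1 l) //= big1 ?addr0; first by rewrite /z !mxE !eqxx mulr1.
  by move=> i il; rewrite !mxE (negPf il) andbF mulr0 mul0r.
have w0 : w k != 0 by apply/eqP => w0; move: ha; rewrite -/(w k) w0 mulr0 ltxx.
have Dle : `|D| <= `|w k|.
  rewrite DE normrM gtr0_norm ?invr_gt0 // ler_pdivrMl //.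
  have : (1 + `|z k|) / `|w k| <= K.
    by rewrite /K (bigD1 k) //= addrCA lerDl addr_ge0 // sumr_ge0.
  rewrite ler_pdivrMr ?normr_gt0 //; lra.
have : 0 <= w k * (w k - D).
  have := ler_wpM2l (normr_ge0 (w k)) Dle; rewrite -!normrM -expr2 => h.
  have : w k * D <= `|w k * D| by exact: ler_norm.
  have : `|w k ^+ 2| = w k ^+ 2 by rewrite ger0_norm // sqr_ge0.
  rewrite mulrBr -expr2; lra.
have w2 : 0 < w k ^+ 2 by rewrite exprn_even_gt0.
rewrite -/(w k) in ha => h.
rewrite -(pmulr_rge0 _ w2); have -> : w k ^+ 2 * (a * (w k - D)) = (a * w k) * (w k * (w k - D)) by ring.
by rewrite mulr_ge0 // ltW.
Qed.

Lemma depth_le (x : 'I_m -> p.-tuple R) (b u : 'rV[R]_p.-1) :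
  Theta (s.*2) u ->
  depth (Theta (s.*2)) b (fun k => others j (x k)) (fun k => tnth (x k) j) <=
  (m%:R)^-1 * #|[pred k : 'I_m | 0 <= dotv u (others j (x k)) *
       (tnth (x k) j - dotv b (others j (x k)))]|%:R.
Proof.
move=> tu; apply: ge_inf; last by exists u.
by exists 0 => _ [v _ <-]; rewrite mulr_ge0 ?invr_ge0.
Qed.

Lemma card_supp_diff (bh : 'rV[R]_p.-1) : Theta s bh ->
  (#|supp (emb j bh) :|: supp xi| <= minn (4 * s) p)%N /\ supp (emb j (bh - beta)) \subset supp (emb j bh) :|: supp xi.
Proof.
move=> [bh0 bhs]; split.
  by apply: (@card_supp_le _ _ s s) => //; [rewrite card_supp_emb | lia].
apply/fintype.subsetP => i; rewrite embB !inE.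
rewrite rowBE; have [->|//] := eqVneq (emb j bh 0 i) 0.
rewrite sub0r oppr_eq0 mxE /=; case: unliftP => [l ->|->]; last by rewrite eqxx.
by rewrite !mxE oppr_eq0 mulrC.
Qed.

Lemma supp_residual (bh : 'rV[R]_p.-1) : Theta s bh ->
  supp (xi - emb j (bh - beta)) \subset supp (emb j bh) :|: supp xi.
Proof.
move=> tb; have [_ sA] := card_supp_diff tb; apply/fintype.subsetP => i hi.
have h : xi 0 i - emb j (bh - beta) 0 i != 0 by move: hi; rewrite inE rowBE.
have [xi_i|xi_i] := eqVneq (xi 0 i) 0; last by rewrite finset.in_setU [_ \in supp xi]inE xi_i orbT.
by apply: (fintype.subsetP sA); rewrite inE; move: h; rewrite xi_i sub0r oppr_eq0.
Qed.

Lemma estimation_error_gram (x : 'I_m -> p.-tuple R) (bh : 'rV[R]_p.-1) : deviates x -> Theta s bh ->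
  (forall b, Theta s b ->
     depth (Theta (s.*2)) b (fun k => others j (x k)) (fun k => tnth (x k) j) <=
     depth (Theta (s.*2)) bh (fun k => others j (x k)) (fun k => tnth (x k) j)) ->
  gram S (emb j (bh - beta)) (emb j (bh - beta)) <= (32 * rho) ^+ 2 / Om j j.
Proof.
move=> dev tb hmax; have lo := depth_ge dev tb hmax.
have [cA sA] := card_supp_diff tb.
set a := emb j (bh - beta) in sA *.
have [a0|a0] := eqVneq a 0.
  by rewrite a0 /gram !mul0mx mxE divr_ge0 ?sqr_ge0 // ltW.
have tu : Theta (s.*2) (bh - beta).
  split; first by rewrite -(emb_eq0 j).
  rewrite -(card_supp_emb j) -/a -addnn; apply: leq_trans (subset_leq_card sA) _.
  have [_ bhs] := tb; rewrite -(card_supp_emb j) in bhs.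
  by apply: leq_trans (leq_add bhs card_supp_xi); rewrite cardsU leq_subr.
have up := depth_le x bh tu.
have sr := supp_residual tb; rewrite -/a in sr.
have cnt := prod_deviation dev sA sr cA.
have mp : 0 < m%:R :> R by rewrite ltr0n.
have {cnt} cnt : 1 / 2 - rho <= nonneg_prob nu a (xi - a) + rho.
  apply: le_trans lo _; apply: le_trans up _; rewrite ler_pdivrMl //.
  apply: le_trans cnt; rewrite ler_nat; apply: subset_leq_card; apply/fintype.subsetP => k.
  by rewrite !inE -dott_emb (@residual_dott _ _ Om j _ _ (lt0r_neq0 Ojj0)).
have orth : gram S a xi = 0 by rewrite gramC // gram_xi_emb.
set va := Num.sqrt (gram S a a); set vb := Num.sqrt (gram S xi xi).
have ga : 0 < gram S a a by exact: posS.
have gb : gram S xi xi = (Om j j)^-1 by rewrite gram_xi xi_diag div1r.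
have va0 : 0 < va by rewrite sqrtr_gt0.
have vb0 : 0 < vb by rewrite sqrtr_gt0 gb invr_gt0.
(* An N that meets both requirements of [nonneg_prob_shift], N >= 8 and 8 vb / N <= va, while N + 1
   <= 10 + 8 vb / va. *)
pose N := (8 + (Num.truncn (8 * vb / va)).+1)%N.
have tr : 8 * vb / va < (Num.truncn (8 * vb / va)).+1%:R by exact: truncnS_gt.
have NE : N%:R = 8 + (Num.truncn (8 * vb / va)).+1%:R :> R by rewrite natrD.
have N0 : 0 < N%:R :> R by rewrite ltr0n.
have hN : 8 / N%:R * vb <= va.
  rewrite mulrAC ler_pdivrMr // NE; move: (tr); rewrite ltr_pdivrMr //.
  by move: ((Num.truncn _).+1%:R) => t; lra.
have := nonneg_prob_shift symS posS gauss (leq_addr _ _ : (8 <= N)%N) a0 xi0 orth hN.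
(* One rho is lost in the lower bound on the depth, the other in the count along the direction
   [a]. *)
move=> sh; have Nr : N.+1%:R^-1 <= 2 * rho.
  by move: sh cnt; move: (N.+1%:R^-1) (nonneg_prob _ _ _) => r y; lra.
have tru : (Num.truncn (8 * vb / va)).+1%:R <= 8 * vb / va + 1.
  by rewrite -natr1 lerD2r truncn_le // divr_ge0 ?mulr_ge0 // ltW.
have NU : N.+1%:R <= 10 + 8 * vb / va by rewrite -natr1 NE; lra.
have one : 1 <= 2 * rho * (10 + 8 * vb / va).
  apply: le_trans (_ : 2 * rho * N.+1%:R <= _); last by rewrite ler_wpM2l // mulr_ge0.
  by rewrite -ler_pdivrMr ?ltr0n // div1r.
(* Since rho <= 1 / 40, the term 20 rho takes at most half of the left side, which leaves va <= 32
   rho vb. *)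
have half : 1 / 2 <= 16 * rho * (vb / va).
  have lin (r y : R) : r <= 1 / 40 -> 1 <= 2 * r * (10 + 8 * y) -> 1 / 2 <= 16 * r * y by lra.
  by apply: lin => //; rewrite mulrA.
have vavb : va <= 32 * rho * vb.
  have := ler_wpM2r (ltW va0) half.
  have -> : 16 * rho * (vb / va) * va = 16 * rho * vb by field; rewrite gt_eqF.
  by lra.
have -> : gram S a a = va ^+ 2 by rewrite sqr_sqrtr // ltW.
have -> : (32 * rho) ^+ 2 / Om j j = (32 * rho * vb) ^+ 2.
  by rewrite [RHS]exprMn sqr_sqrtr gb // invr_ge0 ltW.
by apply: lerXn2r => //; rewrite nnegrE ?(ltW va0) // mulr_ge0 ?(ltW vb0) // mulr_ge0.
Qed.

Variables (q c : R).
Hypotheses (q0 : 0 < q) (c0 : 0 < c) (rhoc : rho < c) (rhocq : rho / (c * q) <= 1 / 2).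
Hypothesis quantile : forall a r : R, 0 <= a -> r < c ->
  1 / 2 - r <= fine (normal_prob (0 : R) 1 [set y | `|y| <= a]) ->
  1 / 2 - r <= fine (normal_prob (0 : R) 1 [set y | a <= `|y|]) -> `|a - q| <= r / c.

(** The residual form divided by its standard deviation is standard normal. At least half of the
    sample lies on each side of the median, so the deviation bound gives both events probability at
    least 1/2 - rho, as [quantile] requires. *)
Lemma median_close (x : 'I_m -> p.-tuple R) (bh : 'rV[R]_p.-1) (md : R) : deviates x -> Theta s bh ->
  is_median (fun k => (tnth (x k) j - dotv bh (others j (x k))) ^+ 2) md ->
  0 <= md /\ `|Num.sqrt md / Num.sqrt (gram S (xi - emb j (bh - beta)) (xi - emb j (bh - beta))) - q| <= rho / c.
Proof.
move=> dev tb [med1 med2]; have [cA sA] := card_supp_diff tb; have sr := supp_residual tb.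
set v := xi - emb j (bh - beta) in sr *.
have resid k : tnth (x k) j - dotv bh (others j (x k)) = dott v (x k).
  exact: (@residual_dott _ _ Om j _ _ (lt0r_neq0 Ojj0)).
have mp : 0 < m%:R :> R by rewrite ltr0n.
have mh : 0 < m%:R / 2 :> R by rewrite divr_gt0.
have md0 : 0 <= md.
  have : 0 < (#|[pred k : 'I_m | (tnth (x k) j - dotv bh (others j (x k))) ^+ 2 <= md]|)%:R :> R.
    exact: lt_le_trans mh med1.
  rewrite ltr0n => /card_gt0P[k]; rewrite inE; apply: le_trans; exact: sqr_ge0.
split => //.
have gv : 0 < gram S v v.
  have vj : v 0 j = 1 by rewrite rowBE xi_diag emb_diag subr0.
  by apply: posS; apply: contra_neq (@oner_neq0 R) => v0; rewrite -vj v0 mxE.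
set sg := Num.sqrt (gram S v v); have sg0 : 0 < sg by rewrite sqrtr_gt0.
have law (A : set R) : measurable A -> nu [set y | A (dott (sg^-1 *: v) y)] = normal_prob 0 1 A.
  move=> mA; have u0 : sg^-1 *: v != 0.
    rewrite scaler_eq0 invr_eq0 gt_eqF //=; apply: contraTneq gv => ->.
    by rewrite /gram !mul0mx mxE ltxx.
  rewrite (gauss u0 mA); congr (normal_prob 0 _ A); rewrite -/(gram S _ _) gramZl gramZr //.
  by rewrite mulrA -expr2 exprVn sqr_sqrtr ?(ltW gv) // mulVf ?gt_eqF // sqrtr1.
set a := Num.sqrt md; have a0 : 0 <= a by exact: sqrtr_ge0.
have mle (z : R) : measurable [set y : R | `|y| <= z].
  by have := measurable_itv `[- z, z]; congr measurable; apply/seteqP; split => y /=; rewrite in_itv /= ler_norml.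
have mge (z : R) : measurable [set y : R | z <= `|y|].
  have := measurableC (measurable_itv `](- z), z[); congr measurable; apply/seteqP; split => y /=;
  by rewrite in_itv /= -ltr_norml leNgt => /negP.
have sgi (y : R) : `|sg^-1 * y| = `|y| / sg by rewrite normrM gtr0_norm ?invr_gt0 // mulrC.
have sq k : Num.sqrt (dott v (x k) ^+ 2) = `|dott v (x k)| by exact: sqrtr_sqr.
apply: quantile => //; first by rewrite divr_ge0 // ltW.
- have -> : normal_prob (0 : R) 1 [set y | `|y| <= a / sg] = nu (region (inner_code v a)).
    rewrite -law //; congr (nu _); apply/seteqP; split => y /=; rewrite /region /= in_region_inner dottZl sgi;
    by rewrite ler_pM2r ?invr_gt0.
  rewrite lerBlDr -(ler_pM2l mp); apply: le_trans (dev _ _ (supported_inner a sr) cA).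
  rewrite mulrA mulr1; apply: le_trans med1 _.
  rewrite -sum1_card natr_sum big_mkcond /= le_eqVlt; apply/orP; left; apply/eqP.
  apply: eq_bigr => k _; rewrite inE resid in_region_inner -sq ler_sqrt //; by case: ifP.
- have -> : normal_prob (0 : R) 1 [set y | a / sg <= `|y|] = nu (region (outer_code v a)).
    rewrite -law //; congr (nu _); apply/seteqP; split => y /=; rewrite /region /= in_region_outer dottZl sgi;
    by rewrite ler_pM2r ?invr_gt0.
  rewrite lerBlDr -(ler_pM2l mp); apply: le_trans (dev _ _ (supported_outer a sr) cA).
  rewrite mulrA mulr1; apply: le_trans med2 _.
  rewrite -sum1_card natr_sum big_mkcond /= le_eqVlt; apply/orP; left; apply/eqP.
  apply: eq_bigr => k _; rewrite inE resid in_region_outer -sq ler_sqrt ?sqr_ge0 //; by case: ifP.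
Qed.

(** 6 / (c q) comes from squaring the scale in [scale_close], and 32 from the excess variance. *)
Definition kappa : R := 6 / (c * q) + 32.

Hypothesis kappa_small : kappa * rho <= 1 / 2.

Lemma diagonal_error (x1 x2 : 'I_m -> p.-tuple R) (bh : 'rV[R]_p.-1) (md : R) :
  deviates x1 -> deviates x2 -> Theta s bh ->
  (forall b, Theta s b ->
     depth (Theta (s.*2)) b (fun k => others j (x1 k)) (fun k => tnth (x1 k) j) <=
     depth (Theta (s.*2)) bh (fun k => others j (x1 k)) (fun k => tnth (x1 k) j)) ->
  is_median (fun k => (tnth (x2 k) j - dotv bh (others j (x2 k))) ^+ 2) md ->
  `|(md / q ^+ 2)^-1 - Om j j| <= 2 * (kappa * rho) * Om j j /\ 0 <= (md / q ^+ 2)^-1 <= 2 * Om j j.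
Proof.
move=> dev1 dev2 tb hmax med.
have [md0 mc] := median_close dev2 tb med.
have ge := estimation_error_gram dev1 tb hmax.
set a := emb j (bh - beta) in mc ge.
have gv : gram S (xi - a) (xi - a) = (Om j j)^-1 + gram S a a.
  have xia : gram S xi a = 0 by exact: gram_xi_emb.
  have gB (u v : 'rV[R]_p) : gram S (u - v) (u - v) = gram S u u - 2 * gram S u v + gram S v v.
    by rewrite -scaleN1r !(gramDl, gramDr, gramZl, gramZr) // (gramC symS v u); ring.
  by rewrite gB xia gram_xi xi_diag mulr0 subr0 div1r.
have ga : 0 <= gram S a a.
  have [->|a0] := eqVneq a 0; first by rewrite /gram !mul0mx mxE.
  by apply: ltW; exact: posS.
(* The residual variance is (1 + w) / Omega_jj by orthogonality; w <= (32 rho)^2 is weakened to 32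
   rho, using 32 rho <= 1. *)
pose w := gram S a a * Om j j.
have w32 : 0 <= w <= 32 * rho.
  rewrite mulr_ge0 ?(ltW Ojj0) //=.
  have : w <= (32 * rho) ^+ 2 by rewrite /w -ler_pdivlMr.
  move/le_trans; apply; rewrite expr2 -[leRHS]mulr1 ler_wpM2l ?mulr_ge0 //.
  by have := rho1; lra.
have gp : 0 < gram S (xi - a) (xi - a) by rewrite gv ltr_pwDl ?invr_gt0.
set sg := Num.sqrt (gram S _ _) in mc; have sg0 : 0 < sg by rewrite sqrtr_gt0.
pose d := (Num.sqrt md / sg - q) / q.
have dE : `|d| <= rho / (c * q).
  rewrite /d normrM [`|q^-1|]gtr0_norm ?invr_gt0 // invfM mulrA ler_pM2r ?invr_gt0 //.
have mdE : md / q ^+ 2 = ((1 + w) * (1 + d) ^+ 2) / Om j j.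
  have -> : (1 + w) * (1 + d) ^+ 2 / Om j j = gram S (xi - a) (xi - a) * (1 + d) ^+ 2.
    by rewrite gv /w; field; rewrite gt_eqF.
  have -> : gram S (xi - a) (xi - a) = sg ^+ 2 by rewrite sqr_sqrtr // ltW.
  have -> : 1 + d = Num.sqrt md / sg / q by rewrite /d; field; rewrite !gt_eqF.
  rewrite -{1}(sqr_sqrtr md0); field; by rewrite !gt_eqF.
rewrite mdE; apply: inv_close => //.
apply: le_trans (scale_close w32 _ dE rhocq) _; first by have := rho1; lra.
by rewrite /kappa; lra.
Qed.

Lemma column_error (x1 x2 : 'I_m -> p.-tuple R) (bh : 'rV[R]_p.-1) (md : R) (Oh : 'M[R]_p) :
  deviates x1 -> deviates x2 -> Theta s bh ->
  (forall b, Theta s b ->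
     depth (Theta (s.*2)) b (fun k => others j (x1 k)) (fun k => tnth (x1 k) j) <=
     depth (Theta (s.*2)) bh (fun k => others j (x1 k)) (fun k => tnth (x1 k) j)) ->
  is_median (fun k => (tnth (x2 k) j - dotv bh (others j (x2 k))) ^+ 2) md ->
  Oh j j = (md / q ^+ 2)^-1 -> (forall l, Oh (lift j l) j = - (Oh j j * bh 0 l)) ->
  \sum_i `|(Oh - Om) i j| <= Num.sqrt s%:R * rho * (2 * kappa * M + 128 * M ^+ 2).
Proof.
move=> dev1 dev2 tb hmax med OE Olift.
have [e1 e2] := diagonal_error dev1 dev2 tb hmax med; rewrite -OE in e1 e2.
have ge := estimation_error_gram dev1 tb hmax.
have /andP[d1 d2] := precision_diag symO eigO j.
have Mp : 0 < M by exact: lt_le_trans M1.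
set a := emb j (bh - beta) in ge.
have [cA sA] := card_supp_diff tb; rewrite -/a in sA.
have ca : (#|supp a| <= 2 * s)%N.
  apply: leq_trans (subset_leq_card sA) _; have [_ bhs] := tb; rewrite -(card_supp_emb j) in bhs.
  by rewrite mul2n -addnn; apply: leq_trans (leq_add bhs card_supp_xi); rewrite cardsU leq_subr.
have sqa : sqnorm a <= (32 * M * rho) ^+ 2.
  have := covariance_ge M1 symO eigO a; rewrite -/(gram S a a) ler_pdivrMl // => h.
  apply: le_trans h _; apply: (@le_trans _ _ (M * ((32 * rho) ^+ 2 / Om j j))); first by rewrite ler_pM2l.
  have : (Om j j)^-1 <= M by rewrite -[leRHS]invrK lef_pV2 ?posrE ?invr_gt0.
  move=> h2; have -> : (32 * M * rho) ^+ 2 = M * ((32 * rho) ^+ 2 * M) by ring.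
  by rewrite ler_pM2l // ler_wpM2l // sqr_ge0.
(* A support of size 2s would give a factor sqrt 2; it is rounded up to 2. *)
have l1a : \sum_l `|a 0 l| <= 2 * Num.sqrt s%:R * (32 * M * rho).
  have r0 : 0 <= 2 * Num.sqrt s%:R * (32 * M * rho) by rewrite !mulr_ge0 ?sqrtr_ge0 // ltW.
  rewrite -(@ler_sqr _ (\sum_l _)) ?nnegrE ?sumr_ge0 //.
  apply: le_trans (l1_le_sqnorm ca) _; rewrite !exprMn sqr_sqrtr // natrM.
  rewrite -!exprMn; apply: ler_pM => //; first exact: sqnorm_ge0.
  by rewrite ler_wpM2r // expr2; lra.
have l1r : \sum_l `|row j Om 0 l| <= Num.sqrt s%:R * M.
  rewrite -(@ler_sqr _ (\sum_l _)) ?nnegrE ?sumr_ge0 ?mulr_ge0 ?sqrtr_ge0 ?(ltW Mp) //.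
  apply: (le_trans (@l1_le_sqnorm _ _ _ s _)).
    apply: leq_trans (sparseO j); apply: subset_leq_card; apply/fintype.subsetP => l.
    by rewrite !inE mxE.
  rewrite exprMn sqr_sqrtr // ler_wpM2l //; exact: sqnorm_row.
(* Off the diagonal the error splits into the relative error of Omega_jj times the true column and
   the estimated diagonal entry, at most 2M, times the error in beta. *)
have step : \sum_i `|(Oh - Om) i j| <= 2 * (kappa * rho) * \sum_l `|row j Om 0 l| + 2 * M * \sum_l `|a 0 l|.
  rewrite !mulr_sumr -big_split /=; apply: ler_sum => i _.
  have [l ->|->] := unliftP j i; last first.
    rewrite [(Oh - Om) j j]mxE [(- Om) j j]mxE emb_diag normr0 mulr0 addr0 [row j Om 0 j]mxE.
    by rewrite (gtr0_norm Ojj0).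
  rewrite [(Oh - Om) _ j]mxE [(- Om) _ j]mxE Olift emb_lift rowBE [row j Om 0 _]mxE [beta 0 l]mxE.
  have -> : Om (lift j l) j = Om j (lift j l) by rewrite -[in LHS]symO mxE.
  set o := Om j (lift j l).
  have -> : - (Oh j j * bh 0 l) - o = (Oh j j - Om j j) * (o / Om j j) - Oh j j * (bh 0 l - - (o / Om j j)).
    by field; rewrite gt_eqF.
  apply: le_trans (ler_normB _ _) _; apply: lerD; rewrite normrM.
    rewrite normf_div (gtr0_norm Ojj0) mulrCA mulrC; apply: ler_wpM2r => //.
    by rewrite ler_pdivrMr.
  apply: ler_wpM2r => //; have /andP[e3 e4] := e2; rewrite ger0_norm //.
  by apply: le_trans e4 _; rewrite ler_pM2l.
apply: le_trans step _.
have k0 : 0 <= 2 * (kappa * rho).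
  have cq0 : 0 <= c * q by rewrite mulr_ge0 // ltW.
  have kp : 0 <= kappa by rewrite /kappa addr_ge0 // divr_ge0.
  by rewrite mulr_ge0 // mulr_ge0.
have s0 : 0 <= 2 * M by rewrite mulr_ge0 // ltW.
have := ler_wpM2l k0 l1r; have := ler_wpM2l s0 l1a.
move: (\sum_l _) (\sum_l _) (Num.sqrt s%:R) => X Y Z h1 h2.
have -> : Z * rho * (2 * kappa * M + 128 * M ^+ 2) = 2 * (kappa * rho) * (Z * M) + 2 * M * (2 * Z * (32 * M * rho)) by ring.
exact: lerD.
Qed.

End Column.

(** * The good event *)

Section Complexity.
Variables (R : realType) (s p : nat).
Hypotheses (s0 : (0 < s)%N) (sp : (s <= p)%N).

Definition log_size : R := s%:R * ln (expR 1 * p%:R / s%:R).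

Let sR : 0 < s%:R :> R. Proof. by rewrite ltr0n. Qed.
Let pR : 0 < p%:R :> R. Proof. by rewrite ltr0n; exact: leq_trans sp. Qed.

Lemma log_sizeE : log_size = s%:R * (1 + (ln p%:R - ln s%:R)).
Proof. by rewrite /log_size lnM ?lnM ?posrE ?mulr_gt0 ?invr_gt0 ?expR_gt0 // lnV ?posrE // expRK addrA. Qed.

Lemma log_size_ge : s%:R <= log_size.
Proof.
rewrite log_sizeE -[leLHS]mulr1 ler_pM2l // lerDl subr_ge0 ler_ln ?posrE // ler_nat //.
Qed.

Local Notation k := (minn (4 * s) p).

(** Take y = 4s / p if this is at most 1. Otherwise y = 1 yields the bound p < 4s, and s <=
    [log_size]. *)
Lemma ln_card_small_sets :
  ln #|[set A : {set 'I_p} | (#|A| <= k)%N]%SET|%:R <= 4 * log_size :> R.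
Proof.
set D := #|_|.
have D0 : 0 < D%:R :> R.
  rewrite ltr0n card_gt0; apply/set0Pn; exists finset.set0; by rewrite inE cards0.
have bound (y : R) : 0 < y <= 1 -> ln D%:R <= p%:R * y - k%:R * ln y.
  move=> /[dup] y01 /andP[y0 y1].
  have := @card_small_sets R 'I_p k y y01; rewrite card_ord -/D => h.
  have : D%:R * y ^+ k <= expR (p%:R * y).
    apply: le_trans h _; rewrite mulrC expRM_natr; apply: lerXn2r; rewrite ?nnegrE ?expR_ge0 ?expR_ge1Dx //.
    by rewrite addr_ge0 // ltW.
  rewrite -ler_ln ?posrE ?expR_gt0 ?mulr_gt0 ?exprn_gt0 // expRK lnM ?posrE ?exprn_gt0 // lnXn // -mulr_natl.
  lra.
have ge := log_size_ge.
have [sp4|ps4] := leqP (4 * s) p.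
  have y01 : 0 < (4 * s%:R / p%:R : R) <= 1.
    rewrite divr_gt0 ?mulr_gt0 //= ler_pdivrMr // mul1r.
    by move: sp4; rewrite -(ler_nat R) natrM.
  apply: le_trans (bound _ y01) _; rewrite (minn_idPl sp4) natrM.
  rewrite lnM ?posrE ?mulr_gt0 ?invr_gt0 // lnM ?posrE // lnV ?posrE // log_sizeE.
  have l4 : 0 <= ln 4 :> R by rewrite ln_ge0 //; lra.
  have : 0 <= s%:R * ln 4 :> R by rewrite mulr_ge0.
  have -> : p%:R * (4 * s%:R / p%:R) = 4 * s%:R :> R by field; rewrite gt_eqF.
  lra.
have y01 : 0 < (1 : R) <= 1 by rewrite ltr01 lexx.
apply: le_trans (bound _ y01) _; rewrite ln1 mulr0 subr0 mulr1.
have : p%:R <= 4 * s%:R :> R by rewrite -natrM ler_nat ltnW.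
lra.
Qed.

(** 356 = 32 + 256 + 68: the supports contribute 32 L, the dimension 64 k <= 256 s, and the
    constants 64 + 4, with 1 <= s <= L. *)
Lemma entropy_le :
  4 * entropy (#|[set A : {set 'I_p} | (#|A| <= k)%N]%SET|%:R : R) (4 * k.+1) <= 356 * log_size.
Proof.
rewrite /entropy; have h1 := ln_card_small_sets; have h2 := log_size_ge.
have s1 : 1 <= s%:R :> R by rewrite ler1n.
have h3 : k%:R <= 4 * s%:R :> R by rewrite -natrM ler_nat geq_minl.
rewrite natrM -natr1; lra.
Qed.

End Complexity.

Section Halves.
Variables (R : realType) (d : measure_display) (T : measurableType d) (P : probability T R).
Variables (d' : measure_display) (T' : measurableType d') (m m' : nat) (X : 'I_(m + m') -> T -> T').
Hypothesis indX : independent P X.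

Let ext (A : 'I_m -> set T') (B : 'I_m' -> set T') (i : 'I_(m + m')) : set T' :=
  match fintype.split i with inl k => A k | inr k => B k end.

Let extl A B k : ext A B (lshift m' k) = A k.
Proof. by rewrite /ext (unsplitK (inl k)). Qed.

Let extr A B k : ext A B (rshift m k) = B k.
Proof. by rewrite /ext (unsplitK (inr k)). Qed.

Let prob_ext A B : (forall k, measurable (A k)) -> (forall k, measurable (B k)) ->
  P (\bigcap_(i in [set: 'I_(m + m')]) (X i @^-1` ext A B i)) =
  ((\prod_(k < m) P (X (lshift m' k) @^-1` A k)) * (\prod_(k < m') P (X (rshift m k) @^-1` B k)))%E.
Proof.
move=> mA mB; rewrite indX; last by move=> i; rewrite /ext; case: fintype.split.
rewrite big_split_ord /=; congr (_ * _)%E; apply: eq_bigr => k _; first by rewrite extl.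
by rewrite extr.
Qed.

(** The sets prescribed for one half are completed by the full space on the other half, whose
    factors are 1. *)
Lemma independent_lshift : independent P (fun k => X (lshift m' k)).
Proof.
move=> A mA; have := prob_ext mA (fun _ : 'I_m' => @measurableT _ T').
rewrite [X in (_ * X)%E]big1 ?mule1; last by move=> k _; rewrite preimage_setT probability_setT.
move=> <-; congr (P _); apply/seteqP; split => w H i _.
  rewrite /ext; case: fintype.splitP => [k ik|//]; have -> : i = lshift m' k by exact: val_inj.
  exact: H.
by have := H (lshift m' i) I; rewrite extl.
Qed.

Lemma independent_rshift : independent P (fun k => X (rshift m k)).
Proof.
move=> A mA; have := prob_ext (fun _ : 'I_m => @measurableT _ T') mA.
rewrite [X in (X * _)%E]big1 ?mul1e; last by move=> k _; rewrite preimage_setT probability_setT.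
move=> <-; congr (P _); apply/seteqP; split => w H i _.
  rewrite /ext; case: fintype.splitP => [//|k ik]; have -> : i = rshift m k by exact: val_inj.
  exact: H.
by have := H (rshift m i) I; rewrite extr.
Qed.

End Halves.

Lemma sample_deviation (R : realType) (p s m : nat) (eps t : R) (d : measure_display)
    (T : measurableType d) (P : probability T R) (nu Q : probability (p.-tuple R) R)
    (X : 'I_m -> T -> p.-tuple R) :
  (0 < m)%N -> 0 <= eps < 1 -> 0 <= t ->
  (forall i, measurable_fun [set: T] (X i)) ->
  (forall i A, measurable A -> P (X i @^-1` A) = ((1 - eps)%:E * nu A + eps%:E * Q A)%E) ->
  independent P X ->
  exists2 B : set T, measurable B &
    (P (~` B) <= (deviation_bound p (minn (4 * s) p) m t)%:E)%E /\
    forall w, B w -> deviates s (t + eps) nu (fun k => X k w).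
Proof.
move=> m0 /andP[e0 e1] t0 mX HX indX.
pose X0 : {mfun T >-> p.-tuple R} := mfun_Sub (mem_set (mX (Ordinal m0))).
(* The contaminated law is realized as the law of the first observation; m > 0 provides one. *)
pose mu : probability (p.-tuple R) R := distribution P X0.
have muE A : measurable A -> mu A = ((1 - eps)%:E * nu A + eps%:E * Q A)%E by move=> mA; exact: HX.
have HX' i A : measurable A -> P (X i @^-1` A) = mu A by move=> mA; rewrite muE // HX.
have [B mB [PB HB]] := @region_uniform_deviation R p (minn (4 * s) p) m d T P mu X mX HX' indX t t0.
exists B => //; split => // w Bw f S fS cS.
apply: le_trans (HB w f S Bw fS cS) _.
rewrite ler_wpM2l // addrCA [leRHS]addrC lerD2r.
have mf : measurable (region f) by exact: measurable_region.
have nf : (nu (region f) = (fine (nu (region f)))%:E)%E by rewrite fineK // fin_num_measure.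
have Qf : (Q (region f) = (fine (Q (region f)))%:E)%E by rewrite fineK // fin_num_measure.
rewrite muE // nf Qf -!EFinM -EFinD /=.
have n0 : 0 <= fine (nu (region f)) by rewrite fine_ge0.
have Q1 : fine (Q (region f)) <= 1 by rewrite -lee_fin -Qf probability_le1.
nra.
Qed.

Theorem theorem4 (R : realType) (q : R) (hq : Phi q = 3 / 4)
    (M : R) (hM : 0 < M) :
  exists c0 C C' : R, [/\ 0 < c0, 0 < C & 0 < C'] /\
  forall (p s m : nat) (eps : R) (Om : 'M[R]_p)
    (d : measure_display) (T : measurableType d) (P : probability T R)
    (nu Q : probability (p.-tuple R) R) (X : 'I_(m + m) -> T -> p.-tuple R),
    (0 < s)%N -> (s <= p)%N -> (0 < m)%N -> 0 <= eps < 1 ->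
    in_Fs M s Om ->
    gaussian (invmx Om) nu ->
    (forall i, measurable_fun [set: T] (X i)) ->
    (forall i A, measurable A ->
       P (X i @^-1` A) = ((1 - eps)%:E * nu A + eps%:E * Q A)%E) ->
    independent P X ->
    eps ^+ 2 + s%:R * ln (expR 1 * p%:R / s%:R) / (m + m)%:R <= c0 ->
    exists B : set T,
      [/\ measurable B,
          B `<=` [set w | forall Oh : 'M[R]_p,
                    estimator s q (fun i => X i w) Oh ->
                    l1norm (Oh - Om) ^+ 2 <=
                    C * Num.max (s%:R ^+ 2 * ln (expR 1 * p%:R / s%:R) / (m + m)%:R)
                                (s%:R * eps ^+ 2)] &
          ((1 - expR (- (C' * (s%:R * ln (expR 1 * p%:R / s%:R)
                                + (m + m)%:R * eps ^+ 2))))%:E <= P B)%E].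
Proof.
have q0 := quantile_gt0 hq; have [c c0 Hc] := std_normal_median hq.
(* The column bounds assume 1 <= M; enlarging M only widens the interval allowed for the
   eigenvalues. *)
pose M' := Num.max M 1; have M'1 : 1 <= M' by rewrite le_max lexx orbT.
have cq0 : 0 < c * q by rewrite mulr_gt0.
have k0 : 0 < kappa q c by rewrite /kappa addr_gt0 // divr_gt0.
(* The four smallness conditions on rho in the column bounds; c / 2 turns the strict one into a weak
   one. *)
pose rho0 := Num.min (Num.min (1 / 40) (c / 2)) (Num.min (c * q / 2) (1 / (2 * kappa q c))).
have r00 : 0 < rho0 by rewrite !lt_min !divr_gt0 ?mulr_gt0.
pose C3 := 2 * kappa q c * M' + 128 * M' ^+ 2.
have C30 : 0 < C3 by rewrite addr_gt0 // !mulr_gt0 ?exprn_gt0 //; exact: lt_le_trans M'1.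
(* 321 = 320 + 1: a deviation of 320 r makes the exponent 400 Lam beat the entropy 356 Lam below,
   and the contamination adds eps <= r. *)
have [K KE] : exists K : R, K = 321 by exists 321.
have K0 : 0 < K by rewrite KE; lra.
(* The first constant gives K r <= rho0; the factor 2 in the second pays for bounding a sum of two
   rates by their maximum. *)
exists ((rho0 / K) ^+ 2), (2 * (K * C3) ^+ 2), 1; split.
  split; first by apply: exprn_gt0; exact: divr_gt0.
    by apply: mulr_gt0 => //; apply: exprn_gt0; exact: mulr_gt0.
  exact: ltr01.
move=> p s m eps Om d T P nu Q X s0 sp m0 /[dup] e01 /andP[e0 e1] [symO eigO sparseO] gauss mX HX indX small.
have eigO' a : eigenvalue Om a -> M'^-1 <= a <= M'.
  move=> /eigO /andP[h1 h2]; rewrite le_max h2 andbT; apply: le_trans h1.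
  by rewrite lef_pV2 ?posrE ?le_max ?lexx //; exact: lt_le_trans M'1.
rewrite -/(log_size R s p) in small *; set L := log_size R s p in small *.
have Ls : s%:R <= L by exact: log_size_ge.
have s1 : 1 <= s%:R :> R by rewrite ler1n.
have mm0 : 0 < (m + m)%:R :> R by rewrite ltr0n addn_gt0 m0.
set r2 := eps ^+ 2 + L / (m + m)%:R in small.
have Lm0 : 0 <= L / (m + m)%:R by rewrite divr_ge0 //; lra.
have r20 : 0 <= r2 by rewrite addr_ge0 // sqr_ge0.
pose r := Num.sqrt r2; have rr : r ^+ 2 = r2 by rewrite sqr_sqrtr.
have r0 : 0 <= r by exact: sqrtr_ge0.
have er : eps <= r.
  by rewrite -(@ler_sqr _ eps) ?nnegrE // rr lerDl.
have rsmall : K * r <= rho0.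
  have d0 : 0 <= rho0 / K by rewrite ltW // divr_gt0.
  by rewrite mulrC -ler_pdivlMr // -(@ler_sqr _ r) ?nnegrE ?rr.
pose rho := K * r; have rho_ge0 : 0 <= rho by rewrite mulr_ge0 // ltW.
have [rho1 rhoc rhocq rhok] : [/\ rho <= 1 / 40, rho < c, rho / (c * q) <= 1 / 2 & kappa q c * rho <= 1 / 2].
  move: rsmall; rewrite -/rho !le_min => /andP[/andP[h1 h2] /andP[h3 h4]]; split => //.
  - by apply: le_lt_trans h2 _; rewrite ltr_pdivrMr // ltr_pMr // ltr1n.
  - by rewrite ler_pdivrMr // mulrC; apply: le_trans h3 _; rewrite mul1r.
  - rewrite mulrC -ler_pdivlMr //; apply: le_trans h4 _.
    by rewrite invfM mulrA.
have mX1 k : measurable_fun [set: T] (X (lshift m k)) by exact: mX.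
have mX2 k : measurable_fun [set: T] (X (rshift m k)) by exact: mX.
have t0 : 0 <= (K - 1) * r by rewrite mulr_ge0 // KE; lra.
have [B1 mB1 [PB1 HB1]] := sample_deviation s m0 e01 t0 mX1 (fun k => HX (lshift m k)) (independent_lshift indX).
have [B2 mB2 [PB2 HB2]] := sample_deviation s m0 e01 t0 mX2 (fun k => HX (rshift m k)) (independent_rshift indX).
have dev (x : 'I_m -> p.-tuple R) : deviates s ((K - 1) * r + eps) nu x -> deviates s rho nu x.
  move=> H f S fS cS; apply: le_trans (H f S fS cS) _.
  by rewrite ler_wpM2l // lerD2l /rho; lra.
exists (B1 `&` B2); split; first exact: measurableI.
- move=> w [w1 w2] Oh [bh [md Hest]].
  have dev1 := dev _ (HB1 w w1); have dev2 := dev _ (HB2 w w2).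
  have sq0 : 0 <= Num.sqrt s%:R * rho * C3 by rewrite !mulr_ge0 ?sqrtr_ge0 // ltW.
  have l1 : l1norm (Oh - Om) <= Num.sqrt s%:R * rho * C3.
    apply: bigmax_le => // j _; have [tb hmax med OE Olift] := Hest j.
    exact: (column_error M'1 symO eigO' sparseO gauss m0 rho_ge0 rho1 q0 c0 rhoc rhocq Hc rhok dev1 dev2 tb hmax med OE Olift).
  have l10 : 0 <= l1norm (Oh - Om) by apply: bigmax_ge_id.
  apply: (@le_trans _ _ ((Num.sqrt s%:R * rho * C3) ^+ 2)).
    by apply: lerXn2r; rewrite ?nnegrE.
  have -> : (Num.sqrt s%:R * rho * C3) ^+ 2 = (K * C3) ^+ 2 * (s%:R * r2).
    rewrite /rho -rr !exprMn sqr_sqrtr //; ring.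
  set mx := Num.max _ _; have -> : 2 * (K * C3) ^+ 2 * mx = (K * C3) ^+ 2 * (2 * mx) by ring.
  rewrite ler_wpM2l ?sqr_ge0 //; have -> : 2 * mx = mx + mx by ring.
  rewrite /mx.
  have -> : s%:R ^+ 2 * ln (expR 1 * p%:R / s%:R) / (m + m)%:R = s%:R * (L / (m + m)%:R).
    by rewrite /L /log_size expr2 !mulrA.
  rewrite /r2 mulrDr; apply: lerD; rewrite le_max ?lexx ?orbT //.
- have E : ~` (B1 `&` B2) = ~` B1 `|` ~` B2 by rewrite classical_sets.setCI.
  have mB : measurable (B1 `&` B2) by exact: measurableI.
  have PU : (P (~` (B1 `&` B2)) <= P (~` B1) + P (~` B2))%E.
    by rewrite E; apply: measureU2; exact: measurableC.
  have fP : P (B1 `&` B2) = (fine (P (B1 `&` B2)))%:E by rewrite fineK // fin_num_measure.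
  move: PU; rewrite probability_setC // fP -EFinB => PU.
  have := le_trans PU (leeD PB1 PB2); rewrite -EFinD lee_fin => h.
  rewrite lee_fin; set Lam := L + (m + m)%:R * eps ^+ 2.
  have Lam1 : 1 <= Lam.
    have : 0 <= (m + m)%:R * eps ^+ 2 by rewrite mulr_ge0 ?sqr_ge0.
    by rewrite /Lam; lra.
  have bd : deviation_bound p (minn (4 * s) p) m ((K - 1) * r) <= expR (- (44 * Lam)).
    rewrite /deviation_bound ler_expR.
    have ent := @entropy_le R s p s0 sp; rewrite -/L in ent.
    (* 320^2 / 128 = 800, and m r^2 = [Lam] / 2 since each half contains m of the 2m
       observations. *)
    have -> : m%:R * ((K - 1) * r) ^+ 2 / 128 = 400 * Lam.
      rewrite exprMn rr /r2 /Lam natrD KE; field.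
      by rewrite -natrD gt_eqF.
    move: ent; move: (entropy _ _) => en ent.
    have LLam : L <= Lam by rewrite /Lam lerDl mulr_ge0 ?sqr_ge0.
    by move: Lam LLam {Lam1 h} => Lam LLam; lra.
  (* The two halves double the failure probability; [Lam] >= 1 lets part of the exponent absorb this
     factor. *)
  have two : 2 * expR (- (44 * Lam)) <= expR (- (1 * Lam)).
    have : 2 <= expR (43 * Lam) by have := expR_ge1Dx (43 * Lam); lra.
    have -> : expR (- (1 * Lam)) = expR (43 * Lam) * expR (- (44 * Lam)) by rewrite -expRD; congr expR; ring.
    by move=> h2; rewrite ler_wpM2r ?expR_ge0.
  lra.
Qed.
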